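(* Let $a\in\mathbb{R}$, let $d>d_{\mathrm c}(a)$ with $\kappa=\frac1d-\frac{ad}{2}\neq 0$, and let $(\psi(\cdot;t),\eta(\cdot;t),\lambda(t))$ be the branch of Stokes waves bifurcating from the laminar flow $(U,d)$ as described in the context, with $\lambda(t)=1+\lambda_2t^2+O(t^4)$. Let $\mu(t)=\mu_2t^2+O(t^4)$ be the second eigenvalue of the Fréchet derivative along the branch (as defined in the context). Then $$\mu_2=-A\,\lambda_2,\qquad A=2\kappa^2\tau_*H(\tau_*d),\qquad H(z)=z+\Bigl(1-z\frac{\cosh z}{\sinh z}\Bigr)\frac{\cosh z}{\sinh z},$$ and $H(z)>0$ for all $z>0$; in particular $A>0$.
   Context: Laminar flow. Fix $a\in\mathbb{R}$ (constant vorticity). For $d>0$ put $U(y)=-\frac a2y(y-d)+\frac yd$, $\kappa=U'(d)=\frac1d-\frac{ad}2$, and $\mathcal R(d)=\frac12\bigl(\frac1{d^2}-a+\frac{a^2d^2}{4}\bigr)+d$. The function $\mathcal R$ is convex on $(0,\infty)$, and $d_{\mathrm c}=d_{\mathrm c}(a)$ is the point where it attains its minimum. The flow $(U,d)$ is subcritical if $d>d_{\mathrm c}$. If $d>d_{\mathrm c}$ and $\kappa\ne0$, the dispersion equation $\sigma(\tau):=\kappa^2\tau\coth(\tau d)+a\kappa-1=0$ has a unique positive root $\tau_*$; put $\Lambda_*=2\pi/\tau_*$ and $\gamma(y;\tau)=\sinh(\tau y)/\sinh(\tau d)$. Water-wave problem. With $R=\mathcal R(d)$ fixed, one seeks $\lambda>0$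 and $\eta(x)>0$, $\psi(x,y)$, even and $\Lambda_*$-periodic in $x$, such that $(\lambda^2\partial_x^2+\partial_y^2)\psi+a=0$ in $D_\eta=\{0<y<\eta(x)\}$, $\psi(x,0)=0$, $\psi(x,\eta(x))=1$, and $\frac12(\psi_y^2+\lambda^2\psi_x^2)+\eta=R$ on $S_\eta=\{y=\eta(x)\}$. Here $\lambda=\Lambda_*/\Lambda$, where $\Lambda$ is the physical wave period. Branch. It is known that there is a branch of solutions $(\psi(x,y;t),\eta(x;t),\lambda(t))$, $t\ge0$, analytic in $t$ (after flattening the domain by $\hat y=dy/\eta$), with, for small $t$, $\psi=U(y)-\kappa\gamma(y;\tau_* )\cos(\tau_*x)\,t+O(t^2)$, $\eta=d+t\cos(\tau_*x)+O(t^2)$, $\lambda(t)=1+\lambda_2t^2+O(t^4)$. Spectral problem (Fréchet derivative). For $(\psi,\eta,\lambda)$ on the branch, the eigenvalues $\mu$ are those numbers for which there is a nontrivial $v$, even and $\Lambda_*$-periodic in $x$, with $(\lambda^2\partial_x^2+\partial_y^2)v=0$ in $D_\eta$, $v=0$ for $y=0$, and $\lambda^2\psi_xv_x+\psi_yv_y-\frac{\widehat\rho}{\psi_y}v=\frac{\mu}{\psi_y}v$ on $S_\eta$, where $\widehat\rho=1+\lambda^2\psi_{xy}\psi_x+\psi_{yy}\psi_y$. The spectrum is real, bounded below, and consists of eigenvalues of finite multiplicity, ordered increasingly. $\mu(t)$ denotes the second eigenvalue at parameter value $t$; $\mu(0)=0$ and $\mu(t)=\mu_2t^2+O(t^4)$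 as $t\to0$. *)

(* Defs.v *)
From Stdlib Require Import Reals.
From Coquelicot Require Import Coquelicot.
Open Scope R_scope.

(** ** The laminar flow with constant vorticity [a] and depth [d] *)

Definition U (a d y : R) : R := - (a / 2) * y * (y - d) + y / d.

Definition kappa (a d : R) : R := 1 / d - a * d / 2.

Definition bernoulli (a d : R) : R :=
  1 / 2 * (1 / d ^ 2 - a + a ^ 2 * d ^ 2 / 4) + d.

Definition critical_depth (a dc : R) : Prop :=
  0 < dc /\ forall d, 0 < d -> bernoulli a dc <= bernoulli a d.

Definition coth (z : R) : R := cosh z / sinh z.

Definition sigma (a d tau : R) : R :=
  kappa a d ^ 2 * tau * coth (tau * d) + a * kappa a d - 1.

Definition dispersion_root (a d tau : R) : Prop :=
  0 < tau /\ sigma a d tau = 0.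

Definition gamma (d tau y : R) : R := sinh (tau * y) / sinh (tau * d).

(** ** Regularity

    A function of class C^2 on the closure of a fluid domain is represented by
    a C^2 extension to the whole plane.  Only its values on the closed domain
    matter: they determine its partial derivatives up to order two there. *)

Definition C2_line (f : R -> R) : Prop :=
  forall (k : nat) (x : R), (k <= 2)%nat ->
    ex_derive_n f k x /\ continuous (Derive_n f k) x.

Definition C2_plane (f : R -> R -> R) : Prop :=
  forall x y, ex_diff_n f 2 x y.

Definition even_periodic (per : R) (f : R -> R) : Prop :=
  (forall x, f (- x) = f x) /\ (forall x, f (x + per) = f x).

(** [partial_derive i j f x y] is the value at [(x, y)] of the derivative of
    [f], [i] times in [x] and [j] times in [y]. *)
Notation Dx := (partial_derive 1 0).
Notation Dy := (partial_derive 0 1).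
Notation Dxx := (partial_derive 2 0).
Notation Dxy := (partial_derive 1 1).
Notation Dyy := (partial_derive 0 2).

(** ** The water-wave problem

    [Rc] is the Bernoulli constant and [per] the period in [x]. *)

Record water_wave (a Rc per : R)
    (psi : R -> R -> R) (eta : R -> R) (lam : R) : Prop := {
  ww_lam : 0 < lam;
  ww_eta_pos : forall x, 0 < eta x;
  ww_eta_C2 : C2_line eta;
  ww_psi_C2 : C2_plane psi;
  ww_eta_sym : even_periodic per eta;
  ww_psi_sym : forall y, even_periodic per (fun x => psi x y);
  ww_eq : forall x y, 0 < y < eta x ->
    lam ^ 2 * Dxx psi x y + Dyy psi x y + a = 0;
  ww_bottom : forall x, psi x 0 = 0;
  ww_top : forall x, psi x (eta x) = 1;
  ww_bernoulli : forall x,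
    1 / 2 * (Dy psi x (eta x) ^ 2 + lam ^ 2 * Dx psi x (eta x) ^ 2) + eta x = Rc
}.

(** ** Analytic dependence on the parameter, on [0, T)

    Around each [t0] the function is the sum of a power series in [t - t0]
    whose coefficients [c n] satisfy [||c n|| * r ^ n <= M], the norm being that
    of R, of C^2 functions on the line, and of C^2 functions on the closed strip
    [0 <= y <= d], respectively. *)

Definition analytic (T : Rbar) (f : R -> R) : Prop :=
  forall t0, 0 <= t0 -> Rbar_lt t0 T ->
  exists (r M : R) (c : nat -> R),
    0 < r /\
    (forall n, Rabs (c n) * r ^ n <= M) /\
    (forall t, 0 <= t -> Rbar_lt t T -> Rabs (t - t0) < r ->
       is_pseries c (t - t0) (f t)).

Definition analytic_C2_line (T : Rbar) (f : R -> R -> R) : Prop :=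
  forall t0, 0 <= t0 -> Rbar_lt t0 T ->
  exists (r M : R) (c : nat -> R -> R),
    0 < r /\
    (forall n, C2_line (c n)) /\
    (forall n k x, (k <= 2)%nat -> Rabs (Derive_n (c n) k x) * r ^ n <= M) /\
    (forall t x, 0 <= t -> Rbar_lt t T -> Rabs (t - t0) < r ->
       is_pseries (fun n => c n x) (t - t0) (f t x)).

Definition analytic_C2_strip (d : R) (T : Rbar) (f : R -> R -> R -> R) : Prop :=
  forall t0, 0 <= t0 -> Rbar_lt t0 T ->
  exists (r M : R) (c : nat -> R -> R -> R),
    0 < r /\
    (forall n, C2_plane (c n)) /\
    (forall n i j x y, (i + j <= 2)%nat -> 0 <= y <= d ->
       Rabs (partial_derive i j (c n) x y) * r ^ n <= M) /\
    (forall t x y, 0 <= t -> Rbar_lt t T -> Rabs (t - t0) < r -> 0 <= y <= d ->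
       is_pseries (fun n => c n x y) (t - t0) (f t x y)).

(** [psi] in the flattened vertical coordinate [d * y / eta x]. *)
Definition flatten (d : R) (eta : R -> R) (psi : R -> R -> R) : R -> R -> R :=
  fun x y => psi x (y * eta x / d).

(** [f t = O(t ^ n)] as [t] tends to [0], with [t >= 0]. *)
Definition bigO (n : nat) (f : R -> R) : Prop :=
  exists C delta, 0 < delta /\
    forall t, 0 <= t < delta -> Rabs (f t) <= C * t ^ n.

(** ** The branch of Stokes waves bifurcating from the laminar flow

    The parameter ranges over [0, T), where [T] may be [p_infty]. *)

Record stokes_branch (a d tau : R) (T : Rbar) (psi : R -> R -> R -> R)
    (eta : R -> R -> R) (lam : R -> R) (lam2 : R) : Prop := {
  sb_wave : forall t, 0 <= t -> Rbar_lt t T ->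
    water_wave a (bernoulli a d) (2 * PI / tau) (psi t) (eta t) (lam t);
  sb_psi_analytic :
    analytic_C2_strip d T (fun t => flatten d (eta t) (psi t));
  sb_eta_analytic : analytic_C2_line T eta;
  sb_lam_analytic : analytic T lam;
  sb_psi_expansion : exists C delta, 0 < delta /\
    forall t x y, 0 <= t < delta -> 0 <= y <= eta t x ->
      Rabs (psi t x y
            - (U a d y - kappa a d * gamma d tau y * cos (tau * x) * t))
        <= C * t ^ 2;
  sb_eta_expansion : exists C delta, 0 < delta /\
    forall t x, 0 <= t < delta ->
      Rabs (eta t x - (d + t * cos (tau * x))) <= C * t ^ 2;
  sb_lam_expansion : bigO 4 (fun t => lam t - (1 + lam2 * t ^ 2))
}.

(** ** The spectral problem *)

Section Spectrum.
Variables (per : R) (psi : R -> R -> R) (eta : R -> R) (lam : R).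

Definition rho_hat (x : R) : R :=
  1 + lam ^ 2 * Dxy psi x (eta x) * Dx psi x (eta x)
    + Dyy psi x (eta x) * Dy psi x (eta x).

Record eigenfunction (mu : R) (v : R -> R -> R) : Prop := {
  ef_C2 : C2_plane v;
  ef_sym : forall y, even_periodic per (fun x => v x y);
  ef_nontrivial : exists x y, 0 < y < eta x /\ v x y <> 0;
  ef_eq : forall x y, 0 < y < eta x ->
    lam ^ 2 * Dxx v x y + Dyy v x y = 0;
  ef_bottom : forall x, v x 0 = 0;
  ef_top : forall x,
    lam ^ 2 * Dx psi x (eta x) * Dx v x (eta x)
      + Dy psi x (eta x) * Dy v x (eta x)
      - rho_hat x / Dy psi x (eta x) * v x (eta x)
    = mu / Dy psi x (eta x) * v x (eta x)
}.

(** [mus] lists all eigenvalues in nondecreasing order, each of them repeated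
    according to its (finite) multiplicity: the [v n] with [mus n = mu] form a
    basis of the eigenspace of [mu]. *)
Definition eigenvalue_sequence (mus : nat -> R) : Prop :=
  (forall n, mus n <= mus (S n)) /\
  (forall n, exists m, mus n < mus m) /\
  exists v : nat -> R -> R -> R,
    (forall n, eigenfunction (mus n) (v n)) /\
    (forall (N : nat) (c : nat -> R),
       (forall x y, 0 <= y <= eta x ->
          sum_n (fun n => c n * v n x y) N = 0) ->
       forall n, (n <= N)%nat -> c n = 0) /\
    (forall mu w, eigenfunction mu w ->
       exists (N : nat) (c : nat -> R),
         (forall n, mus n <> mu -> c n = 0) /\
         forall x y, 0 <= y <= eta x ->
           w x y = sum_n (fun n => c n * v n x y) N).

Definition second_eigenvalue (mu : R) : Prop :=
  exists mus, eigenvalue_sequence mus /\ mus 1%nat = mu.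

End Spectrum.

Definition H (z : R) : R := z + (1 - z * (cosh z / sinh z)) * (cosh z / sinh z).

Definition A (a d tau : R) : R := 2 * kappa a d ^ 2 * tau * H (tau * d).

(* Main.v *)
(** The proof pairs the eigenfunction with the [t]-derivative of the branch, in a form that
    only involves traces on the free surface.

    Fix a small [t0 > 0] and an eigenfunction [w] at [t0].  Stretching the wave of parameter
    [t] vertically by [k = lam t / lam t0] makes it solve an equation of parameter [lam t0], so
    Green's formula pairs it with [w] on the stretched domain; the remaining area integral is
    [o(t - t0)] because [w] is [lam t0]-harmonic up to the surface of the wave [t0].
    Differentiating at [t0], and using Bernoulli's law and the eigenvalue condition, gives an
    exact identity between integrals over one period
    [[
      int mu eta_t g / q + lam lam_t q eta_x^2 g
        + (lam_t / lam) (- q Th g + q eta b g + lam^2 q eta eta_x g_x - a eta g + a eta^2 b g) = 0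
    ]]
    where [g] is the trace of [w], [q] that of [psi_y], [Th = 1 + lam^2 eta_x^2], and [b g] is the
    conormal derivative of [w] on the surface.  Since [mu] and [lam_t / lam] are [O(t^2)] and
    [O(t)], only the first-order expansions of [eta] and [q] matter, and the identity becomes
    [t^2 c (mu2 / kappa + 2 lam2 kappa tau H (tau d)) = O(t^3)] with [c = int g cos (tau x)],
    when [sup |g| = 1].

    It remains to bound [|c|] from below.  Green's formula against [sinh (k tau lam y) cos (k tau x)]
    shows that the other Fourier modes of [g] are [O(t)], because [k coth (k z) > coth z].
    Rellich's identity bounds [g_x] in [L^2], so [g] stays above [1/2] on an interval of fixed
    length around a point where [g = 1], and integrating [g] against a Fejer kernel centred there
    leaves a definite amount to the first mode. *)

Require Import Defs.
From Stdlib Require Import Reals ZArith Lra Lia.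
From Coquelicot Require Import Coquelicot.
Open Scope R_scope.

(** * Calculus on the line and in the plane *)

(** The obstacle is that nothing is known of how the eigenfunction depends on [t], so it cannot be
    expanded. Pairing it, at an interior parameter, with the exact derivative of the branch avoids
    this. It also spares the second-order terms of the wave: they obey the differentiated equations,
    so the only forcing left comes from [mu] and the derivative of [lam]. [psi] is never
    differentiated in [t]. On the surface, Bernoulli's law and [psi = 1] determine [psi_y] up to
    sign from [eta] and its slope; inside the domain a uniform bound on [psi] suffices. At order
    zero the bracket multiplying [lam_t / lam] is the constant
    [(kappa + a d) (d tau coth (tau d) - 1)]. The mean of [g] is only [O(t)], so this constant would
    contribute at order [t^2], together with the terms sought. It is removed exactly, by subtracting
    a multiple of Green's formula for [w] against [y]. The maximum of [|g|] may sit at any [x0], so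
    the Fejer kernel detects the mode [cos (tau (x - x0))]; evenness of [w] kills the sine part and
    reduces it to [cos (tau x)]. *)

Ltac rmin_bounds := repeat match goal with
  | _ : context [Rmin ?a ?b] |- _ => lazymatch goal with
    | _ : Rmin a b <= a |- _ => fail
    | _ => let h1 := fresh "Hmin" in let h2 := fresh "Hmin" in
      pose proof (Rmin_l a b) as h1; pose proof (Rmin_r a b) as h2 end
  | |- context [Rmin ?a ?b] => lazymatch goal with
    | _ : Rmin a b <= a |- _ => fail
    | _ => let h1 := fresh "Hmin" in let h2 := fresh "Hmin" in
      pose proof (Rmin_l a b) as h1; pose proof (Rmin_r a b) as h2 end
  end.

(** Continuity is asked on the whole line because all functions here are global, [psi] and [w] being
    extensions to the plane. Side conditions of integrals then become structural goals for the hint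
    base [cont]. *)
Definition C0 (f : R -> R) : Prop := forall x, continuous f x.

Notation C02 f := (forall x y, continuity_2d_pt f x y).

Lemma C0_const (c : R) : C0 (fun _ => c).
Proof. intros x; apply continuous_const. Qed.

Lemma C0_id : C0 (fun x => x).
Proof. intros x; apply continuous_id. Qed.

Lemma C0_plus (f g : R -> R) : C0 f -> C0 g -> C0 (fun x => f x + g x).
Proof. intros Hf Hg x; exact (continuous_plus f g x (Hf x) (Hg x)). Qed.

Lemma C0_opp f : C0 f -> C0 (fun x => - f x).
Proof. intros Hf x; exact (continuous_opp f x (Hf x)). Qed.

Lemma C0_minus (f g : R -> R) : C0 f -> C0 g -> C0 (fun x => f x - g x).
Proof. intros Hf Hg x; exact (continuous_minus f g x (Hf x) (Hg x)). Qed.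

Lemma C0_mult (f g : R -> R) : C0 f -> C0 g -> C0 (fun x => f x * g x).
Proof. intros Hf Hg x; exact (continuous_mult f g x (Hf x) (Hg x)). Qed.

Lemma C0_pow f n : C0 f -> C0 (fun x => f x ^ n).
Proof.
  intros Hf; induction n as [|n IH]; simpl; [apply C0_const|].
  now apply C0_mult.
Qed.

Lemma C0_inv f : C0 f -> (forall x, f x <> 0) -> C0 (fun x => / f x).
Proof.
  intros Hf H0 x; apply (continuous_comp f Rinv); [apply Hf|].
  apply continuity_pt_filterlim, (continuity_pt_inv id); [|apply H0].
  apply derivable_continuous_pt, derivable_pt_id.
Qed.

Lemma C0_div (f g : R -> R) : C0 f -> C0 g -> (forall x, g x <> 0) -> C0 (fun x => f x / g x).
Proof. intros Hf Hg H0; apply C0_mult; [|apply C0_inv]; assumption. Qed.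

Lemma C0_comp (f g : R -> R) : C0 f -> C0 g -> C0 (fun x => f (g x)).
Proof. intros Hf Hg x; apply (continuous_comp g f); [apply Hg|apply Hf]. Qed.

Lemma C0_abs f : C0 f -> C0 (fun x => Rabs (f x)).
Proof. intros Hf x; apply (continuous_comp f Rabs); [apply Hf|apply continuous_Rabs]. Qed.

Lemma C0_derive (f df : R -> R) : (forall x, is_derive f x (df x)) -> C0 f.
Proof. intros H x; apply (ex_derive_continuous f); now exists (df x). Qed.

Lemma C0_pt f x : C0 f -> continuity_pt f x.
Proof. intros H; apply continuity_pt_filterlim, H. Qed.

Lemma continuity_2d_continuous (f : R -> R -> R) (x y : R) :
  continuity_2d_pt f x y <-> continuous (fun z : R * R => f (fst z) (snd z)) (x, y).
Proof. apply continuity_2d_pt_filterlim. Qed.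

Lemma C0_comp_2d (f : R -> R -> R) g h :
  (forall x, continuity_2d_pt f (g x) (h x)) -> C0 g -> C0 h -> C0 (fun x => f (g x) (h x)).
Proof.
  intros Hf Hg Hh x; apply (continuous_comp_2 g h f); [apply Hg|apply Hh|].
  apply continuity_2d_continuous, Hf.
Qed.

Lemma cosh_derive x : is_derive cosh x (sinh x).
Proof. apply is_derive_Reals, derivable_pt_lim_cosh. Qed.

Lemma sinh_derive x : is_derive sinh x (cosh x).
Proof. apply is_derive_Reals, derivable_pt_lim_sinh. Qed.

Lemma C0_cosh f : C0 f -> C0 (fun x => cosh (f x)).
Proof. apply C0_comp, (C0_derive _ sinh), cosh_derive. Qed.

Lemma C0_sinh f : C0 f -> C0 (fun x => sinh (f x)).
Proof. apply C0_comp, (C0_derive _ cosh), sinh_derive. Qed.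

Lemma C0_cos f : C0 f -> C0 (fun x => cos (f x)).
Proof. intros H; apply (C0_comp cos _); trivial. intros x; apply continuous_cos. Qed.

Lemma C0_sin f : C0 f -> C0 (fun x => sin (f x)).
Proof. intros H; apply (C0_comp sin _); trivial. intros x; apply continuous_sin. Qed.

Create HintDb cont discriminated.

Ltac cont := auto 14 with cont.

#[export] Hint Resolve C0_const C0_id C0_plus C0_opp C0_minus C0_mult C0_pow C0_abs
  C0_cosh C0_sinh C0_cos C0_sin : cont.

Lemma continuity_2d_pt_pow (f : R -> R -> R) n x y :
  continuity_2d_pt f x y -> continuity_2d_pt (fun u v => f u v ^ n) x y.
Proof.
  intros Hf; induction n as [|n IH]; simpl; [apply continuity_2d_pt_const|].
  now apply continuity_2d_pt_mult.
Qed.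

Lemma continuity_2d_pt_comp1 (f : R -> R) (g : R -> R -> R) x y :
  continuous f (g x y) -> continuity_2d_pt g x y ->
  continuity_2d_pt (fun u v => f (g u v)) x y.
Proof. intros H; apply continuity_1d_2d_pt_comp, continuity_pt_filterlim, H. Qed.

Lemma continuity_2d_pt_comp2 (f g h : R -> R -> R) x y :
  continuity_2d_pt f (g x y) (h x y) -> continuity_2d_pt g x y -> continuity_2d_pt h x y ->
  continuity_2d_pt (fun u v => f (g u v) (h u v)) x y.
Proof.
  intros Hf Hg Hh; apply continuity_2d_continuous.
  apply (continuous_comp_2 (fun z : R * R => g (fst z) (snd z))
                           (fun z : R * R => h (fst z) (snd z)) f);
    now apply continuity_2d_continuous.
Qed.

Lemma continuity_2d_pt_of1 (f : R -> R) x y : C0 f -> continuity_2d_pt (fun u _ => f u) x y.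
Proof.
  intros H; apply (continuity_2d_pt_comp1 f (fun u _ => u)); [apply H|apply continuity_2d_pt_id1].
Qed.

Lemma continuity_2d_pt_of2 (f : R -> R) x y : C0 f -> continuity_2d_pt (fun _ v => f v) x y.
Proof.
  intros H; apply (continuity_2d_pt_comp1 f (fun _ v => v)); [apply H|apply continuity_2d_pt_id2].
Qed.

#[export] Hint Resolve continuity_2d_pt_id1 continuity_2d_pt_id2 continuity_2d_pt_const
  continuity_2d_pt_plus continuity_2d_pt_opp continuity_2d_pt_minus continuity_2d_pt_mult
  continuity_2d_pt_pow : cont.

Lemma C0_slice_l (f : R -> R -> R) y : (C02 f) -> C0 (fun x => f x y).
Proof.
  intros H; apply (C0_comp_2d f (fun x => x) (fun _ => y)); cont.
Qed.

Lemma C0_slice_r (f : R -> R -> R) x : (C02 f) -> C0 (fun y => f x y).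
Proof.
  intros H; apply (C0_comp_2d f (fun _ => x) (fun y => y)); cont.
Qed.

Lemma C0_ex_RInt (f : R -> R) a b : C0 f -> ex_RInt f a b.
Proof. intros H; apply (ex_RInt_continuous f); intros; apply H. Qed.

(* [RInt] with its value cast to [R]: [ring] and [lra] reject equations whose
   type is displayed as the carrier of a normed module. *)
Definition integral (f : R -> R) (a b : R) : R := RInt f a b.

Lemma integral_ext (f g : R -> R) (a b : R) : (forall x, f x = g x) -> integral f a b = integral g a b.
Proof. intros H; apply (RInt_ext f g); auto. Qed.

Lemma integral_ext_open (f g : R -> R) (a b : R) : a <= b -> (forall x, a < x < b -> f x = g x) ->
  integral f a b = integral g a b.
Proof.
  intros Hab H; apply (RInt_ext f g); intros x; rewrite Rmin_left, Rmax_right by trivial; auto.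
Qed.

Lemma integral_Chasles (f : R -> R) (a b c : R) : C0 f -> integral f a b + integral f b c = integral f a c.
Proof. intros Hf; apply (RInt_Chasles f); now apply C0_ex_RInt. Qed.

Lemma integral_plus (f g : R -> R) (a b : R) : C0 f -> C0 g ->
  integral (fun x => f x + g x) a b = integral f a b + integral g a b.
Proof. intros Hf Hg; apply (RInt_plus f g); now apply C0_ex_RInt. Qed.

Lemma integral_minus (f g : R -> R) (a b : R) : C0 f -> C0 g ->
  integral (fun x => f x - g x) a b = integral f a b - integral g a b.
Proof. intros Hf Hg; apply (RInt_minus f g); now apply C0_ex_RInt. Qed.

Lemma integral_scal (f : R -> R) (k a b : R) : C0 f -> integral (fun x => k * f x) a b = k * integral f a b.
Proof. intros Hf; apply (RInt_scal f); now apply C0_ex_RInt. Qed.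

Lemma integral_opp (f : R -> R) (a b : R) : C0 f -> integral (fun x => - f x) a b = - integral f a b.
Proof. intros Hf; apply (RInt_opp f); now apply C0_ex_RInt. Qed.

Lemma integral_const (c a b : R) : integral (fun _ => c) a b = c * (b - a).
Proof. unfold integral; rewrite RInt_const; apply Rmult_comm. Qed.

Lemma integral_le (f g : R -> R) (a b : R) : a <= b -> C0 f -> C0 g -> (forall x, f x <= g x) ->
  integral f a b <= integral g a b.
Proof.
  intros Hab Hf Hg H; apply RInt_le; trivial; now apply C0_ex_RInt.
Qed.

Lemma integral_zero (f : R -> R) (a b : R) : (forall x, f x = 0) -> integral f a b = 0.
Proof.
  intros H; rewrite (integral_ext f (fun _ => 0)), integral_const by exact H; ring.
Qed.

Lemma integral_nonneg (f : R -> R) (a b : R) : a <= b -> C0 f -> (forall x, 0 <= f x) ->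
  0 <= integral f a b.
Proof.
  intros Hab Hf H; rewrite <- (Rmult_0_l (b - a)), <- integral_const.
  apply integral_le; cont.
Qed.

Lemma integral_bound (f g : R -> R) (a b : R) : a <= b -> C0 f -> C0 g -> (forall x, Rabs (f x) <= g x) ->
  Rabs (integral f a b) <= integral g a b.
Proof.
  intros Hab Hf Hg H; apply Rabs_le; split.
  - apply Ropp_le_cancel; rewrite Ropp_involutive.
    rewrite <- integral_opp by assumption.
    apply integral_le; cont.
    intros x; generalize (Rabs_le_between (f x) (g x)); specialize (H x).
    intros [H1 _]; specialize (H1 H); lra.
  - apply integral_le; auto. intros x; generalize (Rle_abs (f x)); specialize (H x); lra.
Qed.

Lemma integral_derive (f df : R -> R) a b : (forall x, is_derive f x (df x)) -> C0 df ->
  integral df a b = f b - f a.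
Proof.
  intros H1 H2; apply is_RInt_unique; apply (is_RInt_derive f df); intros; auto; apply H2.
Qed.

Lemma integral_derive_point (f : R -> R) a x : C0 f -> is_derive (integral f a) x (f x).
Proof.
  intros H; apply (is_derive_RInt f (integral f a) a).
  - apply filter_forall; intros y. apply (RInt_correct f), C0_ex_RInt, H.
  - apply H.
Qed.

Lemma integral_pos_zero (f : R -> R) a b : a < b -> C0 f -> (forall x, 0 <= f x) -> integral f a b = 0 ->
  forall x, a <= x <= b -> f x = 0.
Proof.
  intros Hab Hf Hp H0 x Hx.
  destruct (Req_dec (f x) 0) as [|Hn]; trivial; exfalso.
  assert (Hfx : 0 < f x) by (generalize (Hp x); lra).
  destruct (proj1 (continuity_pt_locally f x) (C0_pt _ x Hf) (mkposreal _ Hfx)) as [e He].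
  simpl in He.
  assert (Hpos : forall y, Rabs (y - x) < e -> 0 < f y).
  { intros y Hy; specialize (He y Hy); apply Rabs_def2 in He; lra. }
  assert (He0 := cond_pos e).
  set (u := Rmax a (x - e / 2)); set (v := Rmin b (x + e / 2)).
  assert (Hu : a <= u /\ x - e / 2 <= u /\ u <= x) by
    (unfold u; repeat split; [apply Rmax_l|apply Rmax_r|apply Rmax_lub; lra]).
  assert (Hv : v <= b /\ v <= x + e / 2 /\ x <= v) by
    (unfold v; repeat split; [apply Rmin_l|apply Rmin_r|apply Rmin_glb; lra]).
  assert (Huv : u < v).
  { unfold u, v. apply Rmax_lub_lt; apply Rmin_glb_lt; lra. }
  assert (H1 : 0 < integral f u v).
  { apply RInt_gt_0; trivial.
    intros y Hy; apply Hpos, Rabs_def1; lra. }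
  assert (H2 : 0 <= integral f a u) by
    (apply integral_nonneg; auto; lra).
  assert (H3 : 0 <= integral f v b) by
    (apply integral_nonneg; auto; lra).
  assert (E1 := integral_Chasles f a u v Hf).
  assert (E2 := integral_Chasles f a v b Hf).
  lra.
Qed.

(** Differentiability at the point follows from one partial derivative that is continuous there and
    another that merely exists there. *)
Lemma is_derive_comp_2d (f fx fy : R -> R -> R) (g h : R -> R) (x dg dh : R) :
  (forall x y, is_derive (fun z => f z y) x (fx x y)) ->
  is_derive (fun z => f (g x) z) (h x) (fy (g x) (h x)) ->
  continuity_2d_pt fx (g x) (h x) ->
  is_derive g x dg -> is_derive h x dh ->
  is_derive (fun z => f (g z) (h z)) x (fx (g x) (h x) * dg + fy (g x) (h x) * dh).
Proof.
  intros Hx Hy Hc Hg Hh; apply is_derive_Reals.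
  apply derivable_pt_lim_comp_2d; [|now apply is_derive_Reals..].
  apply filterdiff_differentiable_pt_lim.
  apply (is_derive_filterdiff f _ _ fx (fy (g x) (h x))); trivial.
  - apply filter_forall; intros [u v]; apply Hx.
  - now apply continuity_2d_continuous.
Qed.

Lemma is_derive_RInt_param_explicit (f df : R -> R -> R) (a b t0 : R) :
  locally t0 (fun t => forall x, is_derive (fun u => f u x) t (df t x)) ->
  (forall x, continuity_2d_pt df t0 x) ->
  locally t0 (fun t => C0 (f t)) ->
  is_derive (fun t => integral (f t) a b) t0 (integral (df t0) a b).
Proof.
  intros Hd Hc H0.
  assert (E : integral (df t0) a b = integral (fun x => Derive (fun u => f u x) t0) a b).
  { apply RInt_ext; intros x _; symmetry; apply is_derive_unique.
    exact (locally_singleton _ _ Hd x). }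
  rewrite E; apply (is_derive_RInt_param f).
  - revert Hd; apply filter_imp; intros t Ht x _; now exists (df t x).
  - intros x _; apply (continuity_2d_pt_ext_loc df); [|apply Hc].
    destruct Hd as [e He]; exists e; intros u v Hu Hv.
    symmetry; apply is_derive_unique, He; apply Hu.
  - revert H0; apply filter_imp; intros t Ht; now apply C0_ex_RInt.
Qed.

Lemma is_derive_RInt_param_upper (f df : R -> R -> R) (h : R -> R) (x dh : R) :
  (forall x y, is_derive (fun u => f u y) x (df x y)) ->
  (C02 f) ->
  (C02 df) ->
  is_derive h x dh ->
  is_derive (fun x => integral (f x) 0 (h x)) x (integral (df x) 0 (h x) + f x (h x) * dh).
Proof.
  intros Hd Hf Hdf Hh.
  assert (E : integral (df x) 0 (h x) + f x (h x) * dh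
     = integral (fun t => Derive (fun u => f u t) x) 0 (h x) + - f x 0 * 0 + f x (h x) * dh).
  { rewrite (integral_ext (df x) (fun t => Derive (fun u => f u t) x)); [unfold integral; ring|].
    intros y; symmetry; apply is_derive_unique, Hd. }
  assert (Hex : forall y a b, ex_RInt (fun t => f y t) a b).
  { intros; now apply C0_ex_RInt, C0_slice_r. }
  assert (HD : forall u v, continuity_2d_pt (fun u v => Derive (fun z => f z v) u) u v).
  { intros u v; apply (continuity_2d_pt_ext df); [|apply Hdf].
    intros; symmetry; apply is_derive_unique, Hd. }
  rewrite E; apply (is_derive_RInt_param_bound_comp f (fun _ => 0) h).
  - apply filter_forall; auto.
  - exists (mkposreal 1 Rlt_0_1); apply filter_forall; auto.
  - exists (mkposreal 1 Rlt_0_1); apply filter_forall; auto.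
  - auto_derive; auto.
  - exact Hh.
  - exists (mkposreal 1 Rlt_0_1); apply filter_forall; intros u t _; now exists (df u t).
  - intros; apply HD.
  - exists (mkposreal 1 Rlt_0_1); intros; apply HD.
  - exists (mkposreal 1 Rlt_0_1); intros; apply HD.
  - now apply C0_pt, C0_slice_r.
  - now apply C0_pt, C0_slice_r.
Qed.

(** The equations hold in the open domain only; this carries them to the free surface, where they
    are used pointwise. *)
Lemma continuous_zero_right (f : R -> R) h : 0 < h -> C0 f -> (forall y, 0 < y < h -> f y = 0) -> f h = 0.
Proof.
  intros Hh Hf H0; destruct (Req_dec (f h) 0) as [|Hn]; trivial; exfalso.
  assert (Hp : 0 < Rabs (f h)) by now apply Rabs_pos_lt.
  destruct (proj1 (continuity_pt_locally f h) (C0_pt _ h Hf) (mkposreal _ Hp)) as [e He].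
  simpl in He; assert (He0 := cond_pos e).
  set (y := Rmax (h / 2) (h - e / 2)).
  assert (h / 2 <= y /\ h - e / 2 <= y /\ y < h) as (A1 & A2 & A3) by
    (unfold y; repeat split; [apply Rmax_l|apply Rmax_r|apply Rmax_lub_lt; lra]).
  assert (Hy : Rabs (y - h) < e) by (apply Rabs_def1; lra).
  specialize (He y Hy); rewrite (H0 y), Rminus_0_l, Rabs_Ropp in He; lra.
Qed.

(** * Stokes, Green and Rellich on a domain below a graph *)

Lemma der_eq (f : R -> R) (x l l' : R) : is_derive f x l -> l = l' -> is_derive f x l'.
Proof. now intros H <-. Qed.

Lemma der_plus (f g : R -> R) (x a b : R) :
  is_derive f x a -> is_derive g x b -> is_derive (fun z => f z + g z) x (a + b).
Proof. intros Hf Hg; exact (is_derive_plus f g x a b Hf Hg). Qed.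

Lemma der_minus (f g : R -> R) (x a b : R) :
  is_derive f x a -> is_derive g x b -> is_derive (fun z => f z - g z) x (a - b).
Proof. intros Hf Hg; exact (is_derive_minus f g x a b Hf Hg). Qed.

Lemma der_opp (f : R -> R) (x a : R) : is_derive f x a -> is_derive (fun z => - f z) x (- a).
Proof. intros Hf; exact (is_derive_opp f x a Hf). Qed.

Lemma der_mult (f g : R -> R) (x a b : R) :
  is_derive f x a -> is_derive g x b -> is_derive (fun z => f z * g z) x (a * g x + f x * b).
Proof. intros Hf Hg; exact (is_derive_mult f g x a b Hf Hg Rmult_comm). Qed.

Lemma der_const (c x : R) : is_derive (fun _ : R => c) x 0.
Proof. apply (is_derive_const c x). Qed.

Lemma der_id (x : R) : is_derive (fun z : R => z) x 1.
Proof. apply (is_derive_id x). Qed.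

Lemma der_pow2 (f : R -> R) (x a : R) :
  is_derive f x a -> is_derive (fun z => f z ^ 2) x (2 * f x * a).
Proof.
  intros Hf; apply (is_derive_ext (fun z => f z * f z)); [intros; simpl; ring|].
  eapply der_eq; [apply der_mult; eassumption|ring].
Qed.

Lemma der_comp (f g : R -> R) (x a b : R) :
  is_derive f (g x) a -> is_derive g x b -> is_derive (fun z => f (g z)) x (a * b).
Proof.
  intros Hf Hg; eapply der_eq; [exact (is_derive_comp f g x a b Hf Hg)|].
  unfold scal; simpl; unfold mult; simpl; ring.
Qed.

Create HintDb der discriminated.
#[export] Hint Resolve der_const der_id der_plus der_minus der_opp der_mult der_pow2 : der.

(** A function bundled with explicit derivatives up to order two, so that identities between them
    are settled by [ring]. A single field [jxy] serves both mixed derivatives: Schwarz's theorem is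
    built in. *)
Record jet := Jet {
  j0 : R -> R -> R; jx : R -> R -> R; jy : R -> R -> R;
  jxx : R -> R -> R; jxy : R -> R -> R; jyy : R -> R -> R;
  jx_spec : forall x y, is_derive (fun z => j0 z y) x (jx x y);
  jy_spec : forall x y, is_derive (fun z => j0 x z) y (jy x y);
  jxx_spec : forall x y, is_derive (fun z => jx z y) x (jxx x y);
  jxy_spec : forall x y, is_derive (fun z => jx x z) y (jxy x y);
  jyx_spec : forall x y, is_derive (fun z => jy z y) x (jxy x y);
  jyy_spec : forall x y, is_derive (fun z => jy x z) y (jyy x y);
  j0_cont : C02 j0;
  jx_cont : C02 jx;
  jy_cont : C02 jy;
  jxx_cont : C02 jxx;
  jxy_cont : C02 jxy;
  jyy_cont : C02 jyy }.

#[export] Hint Resolve jx_spec jy_spec jxx_spec jxy_spec jyx_spec jyy_spec : der.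
#[export] Hint Resolve j0_cont jx_cont jy_cont jxx_cont jxy_cont jyy_cont : cont.

Lemma C2_plane_jet (f : R -> R -> R) : C2_plane f ->
  exists w : jet, j0 w = f /\ jx w = partial_derive 1 0 f /\ jy w = partial_derive 0 1 f /\
    jxx w = partial_derive 2 0 f /\ jxy w = partial_derive 1 1 f /\ jyy w = partial_derive 0 2 f.
Proof.
  intros H.
  (* [partial_derive 1 1] differentiates in [y] first, so it is by definition the [x]-derivative of
     [jy]. Being the [y]-derivative of [jx] is what Schwarz's theorem adds. *)
  assert (HS : forall x y, partial_derive 1 1 f x y = Derive (fun z => Derive (fun t => f t z) x) y).
  { intros x y; apply (Schwarz f).
    - exists (mkposreal 1 Rlt_0_1); intros u v _ _.
      destruct (H u v) as (_ & A & B & (_ & _ & A2 & _) & (_ & B2 & _)).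
      repeat split; trivial.
    - destruct (H x y) as (_ & _ & _ & _ & (_ & _ & _ & (B & _) & _)); exact B.
    - destruct (H x y) as (_ & _ & _ & (_ & _ & _ & _ & (B & _)) & _); exact B. }
  unshelve eexists (Jet f (partial_derive 1 0 f) (partial_derive 0 1 f)
    (partial_derive 2 0 f) (partial_derive 1 1 f) (partial_derive 0 2 f)
    _ _ _ _ _ _ _ _ _ _ _ _); [..|simpl; repeat split]; intros x y;
    destruct (H x y) as (H0 & A & B & (A0 & A1 & A2 & (A3 & _) & (A4 & _)) &
      (B0 & B1 & B2 & (B3 & _) & (B4 & _)));
    trivial.
  - now apply Derive_correct.
  - now apply Derive_correct.
  - now apply Derive_correct.
  - rewrite HS. now apply Derive_correct.
  - now apply Derive_correct.
  - now apply Derive_correct.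
Qed.

Definition periodic2 (per : R) (f : R -> R -> R) : Prop := forall x y, f (x + per) y = f x y.

Lemma periodic_derive (per : R) (f df : R -> R) :
  (forall x, f (x + per) = f x) -> (forall x, is_derive f x (df x)) ->
  forall x, df (x + per) = df x.
Proof.
  intros Hp Hd x.
  assert (H : is_derive f x (df (x + per) * 1)).
  { apply (is_derive_ext (fun z => f (z + per))); [exact Hp|].
    apply (der_comp f); [apply Hd|].
    eapply der_eq; [apply der_plus; [apply der_id|apply der_const]|ring]. }
  rewrite Rmult_1_r in H.
  now rewrite <- (is_derive_unique f x _ H), <- (is_derive_unique f x _ (Hd x)).
Qed.

Lemma periodic_jx per w : periodic2 per (j0 w) -> periodic2 per (jx w).
Proof.
  intros H x y; apply (periodic_derive per (fun z => j0 w z y) (fun z => jx w z y)); auto with der.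
Qed.

Lemma periodic_jy per w : periodic2 per (j0 w) -> periodic2 per (jy w).
Proof.
  intros H x y.
  rewrite <- (is_derive_unique _ _ _ (jy_spec w (x + per) y)).
  rewrite <- (is_derive_unique _ _ _ (jy_spec w x y)).
  apply Derive_ext; intros; apply H.
Qed.

Lemma C0_jet_surface (f : R -> R -> R) (h : R -> R) :
  (C02 f) -> C0 h -> C0 (fun x => f x (h x)).
Proof. intros Hf Hh; apply C0_comp_2d; cont. Qed.

Lemma der_surface (f fx fy : R -> R -> R) (h : R -> R) (x dh : R) :
  (forall x y, is_derive (fun z => f z y) x (fx x y)) ->
  (forall x y, is_derive (fun z => f x z) y (fy x y)) ->
  (C02 fx) -> is_derive h x dh ->
  is_derive (fun z => f z (h z)) x (fx x (h x) + fy x (h x) * dh).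
Proof.
  intros Hx Hy Hc Hh.
  eapply der_eq; [apply (is_derive_comp_2d f fx fy (fun z => z) h); eauto using der_id|ring].
Qed.

Lemma C0_integral_01 (f : R -> R -> R) :
  (C02 f) -> C0 (fun x => integral (f x) 0 1).
Proof.
  intros Hf x; apply continuity_pt_filterlim, continuity_pt_locally; intros eps.
  destruct (uniform_continuity_2d f (x - 1) (x + 1) 0 1 (fun u v _ _ => Hf u v)
    (mkposreal _ (is_pos_div_2 eps))) as [d Hd].
  assert (Hm : 0 < Rmin d 1) by (apply Rmin_glb_lt; [apply cond_pos|lra]).
  exists (mkposreal _ Hm); intros u Hu; simpl in Hd.
  change (Rabs (u - x) < Rmin d 1) in Hu.
  assert (Hu1 : Rabs (u - x) < d) by (eapply Rlt_le_trans; [apply Hu|apply Rmin_l]).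
  assert (Hu2 : Rabs (u - x) < 1) by (eapply Rlt_le_trans; [apply Hu|apply Rmin_r]).
  apply Rabs_def2 in Hu2.
  rewrite <- integral_minus by now apply C0_slice_r.
  assert (E : forall g : R -> R, C0 g -> (forall y, 0 < y < 1 -> Rabs (g y) <= eps / 2) ->
    Rabs (integral g 0 1) <= eps / 2).
  { intros g Hg Hb; apply Rabs_le; split.
    - replace (- (eps / 2)) with (integral (fun _ => - (eps / 2)) 0 1) by (rewrite integral_const; lra).
      apply RInt_le; try lra; try (apply C0_ex_RInt; cont).
      intros y Hy; apply (proj1 (Rabs_le_between _ _) (Hb y Hy)).
    - replace (eps / 2) with (integral (fun _ => eps / 2) 0 1) by (rewrite integral_const; lra).
      apply RInt_le; try lra; try (apply C0_ex_RInt; cont).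
      intros y Hy; apply (proj1 (Rabs_le_between _ _) (Hb y Hy)). }
  eapply Rle_lt_trans; [apply E|generalize (cond_pos eps); lra].
  - apply C0_minus; now apply C0_slice_r.
  - intros y Hy; left; apply Hd; try lra.
    rewrite Rminus_diag, Rabs_R0; apply cond_pos.
Qed.

(** The substitution [y = h x * s] moves the variable upper end to the fixed interval from 0 to 1,
    where uniform continuity applies. *)
Lemma C0_integral_param (f : R -> R -> R) (h : R -> R) :
  (C02 f) -> C0 h -> C0 (fun x => integral (f x) 0 (h x)).
Proof.
  intros Hf Hh.
  assert (H : C0 (fun x => integral (fun s => h x * f x (h x * s)) 0 1)).
  { apply (C0_integral_01 (fun x s => h x * f x (h x * s))); intros x s.
    apply continuity_2d_pt_mult; [now apply continuity_2d_pt_of1|].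
    apply (continuity_2d_pt_comp2 f (fun x _ => x) (fun x s => h x * s)); cont.
    apply continuity_2d_pt_mult; cont. now apply continuity_2d_pt_of1. }
  intros x; apply (continuous_ext (fun x => integral (fun s => h x * f x (h x * s)) 0 1)); [|apply H].
  intros u; unfold integral.
  assert (E := RInt_comp_lin (f u) (h u) 0 0 1 (C0_ex_RInt _ _ _ (C0_slice_r f u Hf))).
  rewrite Rmult_0_r, Rmult_1_r, !Rplus_0_r in E; rewrite <- E.
  apply RInt_ext; intros y _; now rewrite Rplus_0_r.
Qed.

Section Surface.
Variables (per lam : R) (h dh : R -> R).
Hypothesis h_der : forall x, is_derive h x (dh x).
Hypothesis dh_cont : C0 dh.
Hypothesis h_per : forall x, h (x + per) = h x.

Let h_cont : C0 h := C0_derive h dh h_der.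

(** The vertical part is integrated directly. For the horizontal part, the integral of [F] over a
    vertical segment is periodic in [x], so its derivative has integral zero; the moving upper end
    contributes the term in [dh]. *)
Lemma stokes (F Fx G Gy : R -> R -> R) (al : R) :
  (forall x y, is_derive (fun z => F z y) x (Fx x y)) ->
  (forall x y, is_derive (fun z => G x z) y (Gy x y)) ->
  (C02 F) -> (C02 Fx) ->
  (C02 G) -> (C02 Gy) ->
  periodic2 per F ->
  integral (fun x => integral (fun y => Fx x y + Gy x y) 0 (h x)) al (al + per) =
  integral (fun x => G x (h x) - G x 0 - dh x * F x (h x)) al (al + per).
Proof.
  intros HF HG cF cFx cG cGy pF.
  assert (cFh : C0 (fun x => F x (h x))) by now apply C0_jet_surface.
  assert (cGh : C0 (fun x => G x (h x))) by now apply C0_jet_surface.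
  assert (cG0 : C0 (fun x => G x 0)) by now apply C0_slice_l.
  assert (cP : C0 (fun x => integral (Fx x) 0 (h x) + F x (h x) * dh x)).
  { apply C0_plus; [now apply C0_integral_param|cont]. }
  assert (H0 : integral (fun x => integral (Fx x) 0 (h x) + F x (h x) * dh x) al (al + per) = 0).
  { rewrite (integral_derive (fun x => integral (F x) 0 (h x))); trivial.
    - rewrite h_per.
      rewrite (integral_ext (F (al + per)) (F al)); [ring|intros; apply pF].
    - intros x; now apply is_derive_RInt_param_upper. }
  rewrite (integral_ext _ (fun x => (integral (Fx x) 0 (h x) + F x (h x) * dh x)
     + (G x (h x) - G x 0 - dh x * F x (h x)))).
  - rewrite integral_plus, H0; cont; ring.
  - intros x; rewrite (integral_plus (Fx x) (Gy x)) by now apply C0_slice_r.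
    rewrite (integral_derive (G x) (Gy x)); [ring|intros; apply HG|now apply C0_slice_r].
Qed.

Definition lap (w : jet) (x y : R) : R := lam ^ 2 * jxx w x y + jyy w x y.
(** The conormal derivative of [lap] along the graph, with the length element absorbed so that
    surface integrals are taken in [dx]. *)
Definition flux (w : jet) (x : R) : R := jy w x (h x) - lam ^ 2 * dh x * jx w x (h x).
Definition trace (w : jet) (x : R) : R := j0 w x (h x).

Lemma lap_cont w x y : continuity_2d_pt (lap w) x y.
Proof. unfold lap; cont. Qed.

Lemma flux_cont w : C0 (flux w).
Proof.
  unfold flux; apply C0_minus; [|apply C0_mult; [cont|]];
    apply C0_jet_surface; cont.
Qed.

Lemma trace_cont w : C0 (trace w).
Proof. unfold trace; apply C0_jet_surface; cont. Qed.

Lemma green (u w : jet) (al : R) :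
  periodic2 per (j0 u) -> periodic2 per (j0 w) ->
  (forall x, j0 u x 0 = 0) -> (forall x, j0 w x 0 = 0) ->
  integral (fun x => trace u x * flux w x - trace w x * flux u x) al (al + per) =
  integral (fun x => integral (fun y => j0 u x y * lap w x y - j0 w x y * lap u x y) 0 (h x)) al (al + per).
Proof.
  intros pu pw u0 w0.
  assert (pux := periodic_jx _ _ pu). assert (pwx := periodic_jx _ _ pw).
  rewrite (integral_ext (fun x => trace u x * flux w x - trace w x * flux u x) (fun x =>
    (j0 u x (h x) * jy w x (h x) - j0 w x (h x) * jy u x (h x))
     - (j0 u x 0 * jy w x 0 - j0 w x 0 * jy u x 0)
     - dh x * (lam ^ 2 * (j0 u x (h x) * jx w x (h x) - j0 w x (h x) * jx u x (h x))))).
  2: { intros x; unfold trace, flux; rewrite u0, w0; ring. }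
  rewrite <- (stokes
    (fun x y => lam ^ 2 * (j0 u x y * jx w x y - j0 w x y * jx u x y))
    (fun x y => lam ^ 2 * (j0 u x y * jxx w x y - j0 w x y * jxx u x y))
    (fun x y => j0 u x y * jy w x y - j0 w x y * jy u x y)
    (fun x y => j0 u x y * jyy w x y - j0 w x y * jyy u x y)); cont.
  - apply integral_ext; intros x; apply integral_ext; intros y; unfold lap; ring.
  - intros x y; eapply der_eq; [auto 10 with der|ring].
  - intros x y; eapply der_eq; [auto 10 with der|ring].
  - intros x y; simpl; now rewrite pu, pw, pux, pwx.
Qed.

Section Harmonic.
Variable w : jet.
Hypothesis h_pos : forall x, 0 < h x.
Hypothesis w_per : periodic2 per (j0 w).
Hypothesis w_bottom : forall x, j0 w x 0 = 0.
Hypothesis w_harm : forall x y, 0 < y < h x -> lap w x y = 0.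

Lemma lap_surface x : lap w x (h x) = 0.
Proof.
  apply (continuous_zero_right (lap w x) (h x)); trivial; auto.
  apply C0_slice_r; intros; apply lap_cont.
Qed.

Lemma green_harmonic (u : jet) (al : R) :
  periodic2 per (j0 u) -> (forall x, j0 u x 0 = 0) ->
  integral (fun x => trace u x * flux w x - trace w x * flux u x) al (al + per) =
  integral (fun x => integral (fun y => - (j0 w x y * lap u x y)) 0 (h x)) al (al + per).
Proof.
  intros pu u0; rewrite green by trivial.
  apply integral_ext; intros x; apply integral_ext_open; [left; apply h_pos|].
  intros y Hy; rewrite w_harm by trivial; ring.
Qed.

Lemma energy_identity (al : R) :
  integral (fun x => integral (fun y => lam ^ 2 * jx w x y ^ 2 + jy w x y ^ 2) 0 (h x)) al (al + per) =
  integral (fun x => trace w x * flux w x) al (al + per).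
Proof.
  assert (px := periodic_jx _ _ w_per).
  rewrite (integral_ext (fun x => trace w x * flux w x) (fun x =>
    j0 w x (h x) * jy w x (h x) - j0 w x 0 * jy w x 0
     - dh x * (lam ^ 2 * (j0 w x (h x) * jx w x (h x))))).
  2: { intros x; unfold trace, flux; rewrite w_bottom; ring. }
  rewrite <- (stokes
    (fun x y => lam ^ 2 * (j0 w x y * jx w x y))
    (fun x y => lam ^ 2 * (jx w x y ^ 2 + j0 w x y * jxx w x y))
    (fun x y => j0 w x y * jy w x y)
    (fun x y => jy w x y ^ 2 + j0 w x y * jyy w x y)); cont.
  - apply integral_ext; intros x; apply integral_ext_open; [left; apply h_pos|]; intros y Hy.
    generalize (w_harm x y Hy); unfold lap; intros E.
    replace (jyy w x y) with (- (lam ^ 2 * jxx w x y)) by lra; ring.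
  - intros x y; eapply der_eq; [auto 10 with der|ring].
  - intros x y; eapply der_eq; [auto 10 with der|ring].
  - intros x y; simpl; now rewrite w_per, px.
Qed.

(* Rellich's identity for the vertical field: the bottom contributes with a sign. *)
Lemma rellich (al : R) : 0 <= per ->
  integral (fun x => lam ^ 2 * (1 + lam ^ 2 * dh x ^ 2) * jx w x (h x) ^ 2) al (al + per) <=
  integral (fun x => flux w x ^ 2) al (al + per).
Proof.
  intros Hper.
  assert (px := periodic_jx _ _ w_per). assert (py := periodic_jy _ _ w_per).
  assert (x0 : forall x, jx w x 0 = 0).
  { intros x; rewrite <- (is_derive_unique _ _ _ (jx_spec w x 0)).
    rewrite (Derive_ext _ (fun _ => 0)) by apply w_bottom; apply Derive_const. }
  assert (cx : C0 (fun x => jx w x (h x))) by (apply C0_jet_surface; cont).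
  assert (cy : C0 (fun x => jy w x (h x))) by (apply C0_jet_surface; cont).
  assert (cy0 : C0 (fun x => jy w x 0)) by (apply C0_slice_l; cont).
  assert (cf := flux_cont w).
  assert (E : integral (fun x => (lam ^ 2 * jx w x (h x) ^ 2 - jy w x (h x) ^ 2)
      - (lam ^ 2 * jx w x 0 ^ 2 - jy w x 0 ^ 2)
      - dh x * (- 2 * lam ^ 2 * (jx w x (h x) * jy w x (h x)))) al (al + per) = 0).
  (* The divergence of this field is [-2 * jy w * lap w]: the equation multiplied by the vertical
     derivative of [w]. *)
  { rewrite <- (stokes
      (fun x y => - 2 * lam ^ 2 * (jx w x y * jy w x y))
      (fun x y => - 2 * lam ^ 2 * (jxx w x y * jy w x y + jx w x y * jxy w x y))
      (fun x y => lam ^ 2 * jx w x y ^ 2 - jy w x y ^ 2)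
      (fun x y => 2 * lam ^ 2 * (jx w x y * jxy w x y) - 2 * (jy w x y * jyy w x y)));
      cont.
    - rewrite integral_zero; [ring|].
      intros x; rewrite (integral_ext_open _ (fun _ => 0)); [rewrite integral_const; ring| |].
      + left; apply h_pos.
      + intros y Hy; generalize (w_harm x y Hy); unfold lap; intros E.
        replace (jyy w x y) with (- (lam ^ 2 * jxx w x y)) by lra; ring.
    - intros x y; eapply der_eq; [auto 10 with der|ring].
    - intros x y; eapply der_eq; [auto 10 with der|ring].
    - intros x y; simpl; now rewrite px, py. }
  (* On the bottom only [jy] survives, with a favourable sign. On the surface, completing the square
     absorbs [jy] into the flux. *)
  rewrite (integral_ext _ (fun x => (lam ^ 2 * (1 + lam ^ 2 * dh x ^ 2) * jx w x (h x) ^ 2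
      - flux w x ^ 2) + jy w x 0 ^ 2)) in E.
  2: { intros x; unfold flux; rewrite x0; ring. }
  rewrite integral_plus, integral_minus in E; cont.
  assert (0 <= integral (fun x => jy w x 0 ^ 2) al (al + per)).
  { apply integral_nonneg; [lra|cont|intros; apply pow2_ge_0]. }
  lra.
Qed.

Lemma trace_derive x :
  is_derive (trace w) x (jx w x (h x) + jy w x (h x) * dh x).
Proof. apply (der_surface (j0 w) (jx w) (jy w)); auto with der cont. Qed.

(** Splits the slope of the trace into the two quantities compared by Rellich's identity. *)
Lemma trace_derive_flux x :
  jx w x (h x) + jy w x (h x) * dh x =
  jx w x (h x) * (1 + lam ^ 2 * dh x ^ 2) + dh x * flux w x.
Proof. unfold flux; ring. Qed.

(** If the trace vanished, the energy identity would make the gradient vanish, and [w = 0] would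
    spread upwards from the bottom. This permits normalising an eigenfunction by its trace. *)
Lemma trace_nonzero : 0 < per ->
  (exists x y, 0 < y < h x /\ j0 w x y <> 0) -> exists x, trace w x <> 0.
Proof.
  intros Hper (x & y & Hy & Hn).
  destruct (Req_dec (integral (fun x => trace w x * flux w x) x (x + per)) 0) as [E|E].
  - exfalso; rewrite <- energy_identity in E.
    assert (cE : forall x, C0 (fun y => lam ^ 2 * jx w x y ^ 2 + jy w x y ^ 2)).
    { intros z; apply (C0_slice_r (fun x y => lam ^ 2 * jx w x y ^ 2 + jy w x y ^ 2));
        cont. }
    assert (pE : forall x y, 0 <= lam ^ 2 * jx w x y ^ 2 + jy w x y ^ 2).
    { intros u v; generalize (pow2_ge_0 lam), (pow2_ge_0 (jx w u v)), (pow2_ge_0 (jy w u v)).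
      intros; nra. }
    assert (E1 : integral (fun y => lam ^ 2 * jx w x y ^ 2 + jy w x y ^ 2) 0 (h x) = 0).
    { apply (integral_pos_zero
        (fun x => integral (fun y => lam ^ 2 * jx w x y ^ 2 + jy w x y ^ 2) 0 (h x)) x (x + per));
        trivial; try lra.
      - apply (C0_integral_param (fun x y => lam ^ 2 * jx w x y ^ 2 + jy w x y ^ 2));
          cont.
      - intros u; apply integral_nonneg; auto; left; apply h_pos. }
    assert (E2 : forall z, 0 <= z <= h x -> jy w x z = 0).
    { intros z Hz.
      generalize (integral_pos_zero _ 0 (h x) (h_pos x) (cE x) (pE x) E1 z Hz); simpl.
      generalize (pow2_ge_0 (lam * jx w x z)); intros; nra. }
    apply Hn; enough (j0 w x y - j0 w x 0 = 0) as E3 by (rewrite w_bottom in E3; lra).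
    rewrite <- (integral_derive (j0 w x) (jy w x)).
    + rewrite (integral_ext_open _ (fun _ => 0)); [rewrite integral_const; ring|lra|].
      intros z Hz; apply E2; lra.
    + intros; auto with der.
    + apply C0_slice_r; cont.
  - destruct (Classical_Prop.classic (exists x, trace w x <> 0)) as [|Hno]; trivial.
    exfalso; apply E; rewrite integral_zero; [ring|].
    intros z; destruct (Req_dec (trace w z) 0) as [->|Hz]; [ring|].
    exfalso; apply Hno; now exists z.
Qed.

End Harmonic.
End Surface.

(** * Hyperbolic functions, test functions and Fejer kernels *)

Lemma positive_of_derive (f df : R -> R) : (forall x, is_derive f x (df x)) -> f 0 = 0 ->
  (forall x, 0 < x -> 0 < df x) -> forall x, 0 < x -> 0 < f x.
Proof.
  intros Hd H0 Hp x Hx.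
  assert (Hdiv : derivable f).
  { intros y; apply ex_derive_Reals_0; now exists (df y). }
  destruct (MVT_cor2 f df 0 x Hx) as (c & Hc & Hc2).
  - intros c _; apply is_derive_Reals, Hd.
  - rewrite H0, Rminus_0_r, Rminus_0_r in Hc; rewrite Hc.
    apply Rmult_lt_0_compat; [apply Hp|]; lra.
Qed.

Lemma cosh2_sinh2 z : cosh z ^ 2 = 1 + sinh z ^ 2.
Proof.
  unfold cosh, sinh.
  assert (E : exp z * exp (- z) = 1) by (rewrite <- exp_plus, Rplus_opp_r; apply exp_0).
  nra.
Qed.

Lemma cosh_pos z : 0 < cosh z.
Proof. unfold cosh; generalize (exp_pos z), (exp_pos (- z)); lra. Qed.

Lemma sinh_pos z : 0 < z -> 0 < sinh z.
Proof.
  apply (positive_of_derive sinh cosh); [apply sinh_derive|apply sinh_0|].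
  intros; apply cosh_pos.
Qed.

#[export] Hint Resolve cosh_derive sinh_derive : der.

Lemma der_lin (k x : R) : is_derive (fun z => k * z) x k.
Proof. eapply der_eq; [auto with der|cbv beta; ring]. Qed.

(** In other words [z coth z > 1]: it excludes the constant mode from the limit problem. *)
Lemma sinh_lt_z_cosh z : 0 < z -> 0 < z * cosh z - sinh z.
Proof.
  apply (positive_of_derive (fun z => z * cosh z - sinh z) (fun z => z * sinh z)).
  - intros x; eapply der_eq; [auto with der|cbv beta; ring].
  - rewrite sinh_0; ring.
  - intros x Hx; apply Rmult_lt_0_compat; [trivial|now apply sinh_pos].
Qed.

Lemma z_lt_sinh_cosh z : 0 < z -> 0 < sinh z * cosh z - z.
Proof.
  apply (positive_of_derive (fun z => sinh z * cosh z - z) (fun z => 2 * sinh z ^ 2)).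
  - intros x; eapply der_eq; [auto with der|].
    generalize (cosh2_sinh2 x); simpl; intros; nra.
  - rewrite sinh_0; ring.
  - intros x Hx; apply sinh_pos in Hx; simpl; nra.
Qed.

(** This is [k coth (k z) > coth z] without denominators. The two terms with a product of hyperbolic
    cosines cancel in the derivative, which leaves a positive multiple of a product of hyperbolic
    sines. *)
Lemma coth_increasing k z : 1 < k -> 0 < z ->
  0 < k * (cosh (k * z) * sinh z) - cosh z * sinh (k * z).
Proof.
  intros Hk.
  apply (positive_of_derive (fun z => k * (cosh (k * z) * sinh z) - cosh z * sinh (k * z))
    (fun z => (k * k - 1) * (sinh (k * z) * sinh z))).
  - intros x; eapply der_eq.
    + apply der_minus; [apply der_mult; [apply der_const|]|]; apply der_mult; auto with der.
      * apply (der_comp cosh); [apply cosh_derive|apply der_lin].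
      * apply (der_comp sinh); [apply sinh_derive|apply der_lin].
    + cbv beta; ring.
  - rewrite Rmult_0_r, sinh_0; ring.
  - intros x Hx; apply Rmult_lt_0_compat; [nra|].
    apply Rmult_lt_0_compat; apply sinh_pos; nra.
Qed.

Lemma H_coth z : 0 < z -> H z = (sinh z * cosh z - z) / sinh z ^ 2.
Proof.
  intros Hz; assert (Hs := sinh_pos z Hz); unfold H.
  assert (E : cosh z ^ 2 = 1 + sinh z ^ 2) by apply cosh2_sinh2.
  replace (z + (1 - z * (cosh z / sinh z)) * (cosh z / sinh z))
    with ((z * sinh z ^ 2 + sinh z * cosh z - z * cosh z ^ 2) / sinh z ^ 2) by (field; lra).
  rewrite E; field; lra.
Qed.

Lemma H_positive z : 0 < z -> 0 < H z.
Proof.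
  intros Hz; rewrite H_coth by trivial.
  apply Rdiv_lt_0_compat; [now apply z_lt_sinh_cosh|].
  apply pow_lt; now apply sinh_pos.
Qed.

(** * Test functions vanishing on the bottom, and operations on jets *)

Ltac jet_solve :=
  intros; try (eapply der_eq; [auto 10 with der|cbv beta; ring]); cont.

Definition jet_y : jet.
Proof.
  refine (Jet (fun _ y => y) (fun _ _ => 0) (fun _ _ => 1) (fun _ _ => 0) (fun _ _ => 0)
    (fun _ _ => 0) _ _ _ _ _ _ _ _ _ _ _ _); jet_solve.
Defined.

(** Its [lap] is 1, so Green's formula against it turns the area integral of a harmonic function
    into a surface integral. *)
Definition jet_y2 : jet.
Proof.
  refine (Jet (fun _ y => / 2 * y ^ 2) (fun _ _ => 0) (fun _ y => y) (fun _ _ => 0) (fun _ _ => 0)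
    (fun _ _ => 1) _ _ _ _ _ _ _ _ _ _ _ _); jet_solve.
  eapply der_eq; [auto 10 with der|cbv beta; field].
Defined.

(** [lap lam] annihilates it when [p = lam * r]. The two rates are separate because the period fixes
    [r] while [lam] moves along the branch. *)
Definition jet_mode (p r x0 : R) : jet.
Proof.
  assert (Hc : forall x, is_derive (fun x => cos (r * (x - x0))) x (- r * sin (r * (x - x0)))).
  { intros x; eapply der_eq; [apply (der_comp cos); [apply is_derive_cos|auto with der]|ring]. }
  assert (Hs : forall x, is_derive (fun x => sin (r * (x - x0))) x (r * cos (r * (x - x0)))).
  { intros x; eapply der_eq; [apply (der_comp sin); [apply is_derive_sin|auto with der]|ring]. }
  assert (Hsh : forall y, is_derive (fun y => sinh (p * y)) y (p * cosh (p * y))).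
  { intros y; eapply der_eq; [apply (der_comp sinh); [apply sinh_derive|apply der_lin]|ring]. }
  assert (Hch : forall y, is_derive (fun y => cosh (p * y)) y (p * sinh (p * y))).
  { intros y; eapply der_eq; [apply (der_comp cosh); [apply cosh_derive|apply der_lin]|ring]. }
  assert (Kc : forall x y, continuity_2d_pt (fun x _ => cos (r * (x - x0))) x y).
  { intros; apply (continuity_2d_pt_of1 (fun x => cos (r * (x - x0)))); cont. }
  assert (Ks : forall x y, continuity_2d_pt (fun x _ => sin (r * (x - x0))) x y).
  { intros; apply (continuity_2d_pt_of1 (fun x => sin (r * (x - x0)))); cont. }
  assert (Ksh : forall x y, continuity_2d_pt (fun _ y => sinh (p * y)) x y).
  { intros; apply (continuity_2d_pt_of2 (fun x => sinh (p * x))); cont. }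
  assert (Kch : forall x y, continuity_2d_pt (fun _ y => cosh (p * y)) x y).
  { intros; apply (continuity_2d_pt_of2 (fun x => cosh (p * x))); cont. }
  refine (Jet (fun x y => sinh (p * y) * cos (r * (x - x0)))
    (fun x y => sinh (p * y) * (- r * sin (r * (x - x0))))
    (fun x y => p * cosh (p * y) * cos (r * (x - x0)))
    (fun x y => sinh (p * y) * (- r * (r * cos (r * (x - x0)))))
    (fun x y => p * cosh (p * y) * (- r * sin (r * (x - x0))))
    (fun x y => p * (p * sinh (p * y)) * cos (r * (x - x0)))
    _ _ _ _ _ _ _ _ _ _ _ _); jet_solve.
Defined.

Definition jet_scal (c : R) (w : jet) : jet.
Proof.
  refine (Jet (fun x y => c * j0 w x y) (fun x y => c * jx w x y) (fun x y => c * jy w x y)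
    (fun x y => c * jxx w x y) (fun x y => c * jxy w x y) (fun x y => c * jyy w x y)
    _ _ _ _ _ _ _ _ _ _ _ _); jet_solve.
Defined.

Definition jet_stretch (m : R) (w : jet) : jet.
Proof.
  assert (D : forall f df : R -> R, (forall y, is_derive f y (df y)) ->
    forall y, is_derive (fun y => f (m * y)) y (m * df (m * y))).
  { intros f df Hf y; eapply der_eq; [apply (der_comp f); [apply Hf|apply der_lin]|ring]. }
  assert (K : forall f x y, (C02 f) ->
    continuity_2d_pt (fun x y => f x (m * y)) x y).
  { intros f x y Hf; apply (continuity_2d_pt_comp2 f (fun x _ => x) (fun _ y => m * y));
      cont. }
  refine (Jet (fun x y => j0 w x (m * y)) (fun x y => jx w x (m * y))
    (fun x y => m * jy w x (m * y)) (fun x y => jxx w x (m * y))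
    (fun x y => m * jxy w x (m * y)) (fun x y => m * (m * jyy w x (m * y)))
    _ _ _ _ _ _ _ _ _ _ _ _); intros; try apply K; cont.
  - auto with der.
  - apply (D (fun y => j0 w x y) (fun y => jy w x y)); auto with der.
  - auto with der.
  - apply (D (fun y => jx w x y) (fun y => jxy w x y)); auto with der.
  - eapply der_eq; [auto with der|cbv beta; ring].
  - eapply der_eq; [apply der_mult; [apply der_const|]|].
    + apply (D (fun y => jy w x y) (fun y => jyy w x y)); auto with der.
    + cbv beta; ring.
Defined.

(** * Dirichlet and Fejer kernels *)

Fixpoint dirichlet (j : nat) (th : R) : R :=
  match j with O => 1 | S i => dirichlet i th + 2 * cos (INR j * th) end.

(* Unnormalised: [N] times the usual kernel. *)
Fixpoint fejer (N : nat) (th : R) : R :=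
  match N with O => 0 | S j => fejer j th + dirichlet j th end.

Lemma dirichlet_telescope j th :
  (1 - cos th) * dirichlet j th = cos (INR j * th) - cos (INR (S j) * th).
Proof.
  induction j as [|j IH].
  - simpl; rewrite Rmult_0_l, Rmult_1_l, cos_0; ring.
  - change (dirichlet (S j) th) with (dirichlet j th + 2 * cos (INR (S j) * th)).
    rewrite Rmult_plus_distr_l, IH.
    replace (INR j * th) with (INR (S j) * th - th) by (rewrite S_INR; ring).
    replace (INR (S (S j)) * th) with (INR (S j) * th + th) by (rewrite !S_INR; ring).
    rewrite cos_plus, cos_minus; ring.
Qed.

(** The closed form is kept multiplied by [1 - cos th], the weight that also appears in the moment
    of the kernel; so written it holds at the zeros of that weight too. *)
Lemma fejer_telescope N th : (1 - cos th) * fejer N th = 1 - cos (INR N * th).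
Proof.
  induction N as [|N IH].
  - simpl; rewrite Rmult_0_l, cos_0; ring.
  - change (fejer (S N) th) with (fejer N th + dirichlet N th).
    rewrite Rmult_plus_distr_l, IH, dirichlet_telescope; ring.
Qed.

Lemma cos_le_1 x : cos x <= 1.
Proof. generalize (COS_bound x); lra. Qed.

(** Where [cos th <> 1] the closed form can be divided; where [cos th = 1] every cosine in the sums
    equals 1. *)
Lemma fejer_nonneg N th : 0 <= fejer N th.
Proof.
  destruct (Req_dec (cos th) 1) as [E|E].
  - assert (Es : sin th = 0) by (generalize (sin2_cos2 th); unfold Rsqr; rewrite E; nra).
    assert (Ek : forall k, cos (INR k * th) = 1).
    { induction k as [|k IH]; [simpl; rewrite Rmult_0_l; apply cos_0|].
      rewrite S_INR, Rmult_plus_distr_r, Rmult_1_l, cos_plus, IH, E, Es; ring. }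
    assert (Ed : forall j, 0 <= dirichlet j th).
    { induction j as [|j IH]; [simpl; lra|].
      change (dirichlet (S j) th) with (dirichlet j th + 2 * cos (INR (S j) * th)).
      rewrite Ek; lra. }
    induction N as [|N IH]; simpl; [lra|]. specialize (Ed N); lra.
  - generalize (fejer_telescope N th), (cos_le_1 (INR N * th)), (cos_le_1 th); intros.
    assert (0 < 1 - cos th) by lra. nra.
Qed.

Section Fourier.
Variables (tau x0 : R).
Hypothesis tau_pos : 0 < tau.
Notation per := (2 * PI / tau).

Lemma period_pos : 0 < per.
Proof. generalize PI_RGT_0; intros; apply Rdiv_lt_0_compat; lra. Qed.

Definition mode (g : R -> R) (k : nat) : R :=
  integral (fun x => g x * cos (INR k * (tau * (x - x0)))) 0 per.

Lemma C0_dirichlet j : C0 (fun x => dirichlet j (tau * (x - x0))).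
Proof.
  induction j as [|j IH]; [apply (C0_const 1)|].
  change (C0 (fun x => dirichlet j (tau * (x - x0)) + 2 * cos (INR (S j) * (tau * (x - x0))))).
  cont.
Qed.

Lemma C0_fejer N : C0 (fun x => fejer N (tau * (x - x0))).
Proof.
  induction N as [|N IH]; simpl; [cont|].
  apply C0_plus; [exact IH|apply C0_dirichlet].
Qed.

Lemma mode_dirichlet_0 g : C0 g ->
  integral (fun x => g x * dirichlet 0 (tau * (x - x0))) 0 per = mode g 0.
Proof.
  intros Hg; apply integral_ext; intros x; simpl; now rewrite Rmult_0_l, cos_0.
Qed.

Lemma mode_dirichlet_S g j : C0 g ->
  integral (fun x => g x * dirichlet (S j) (tau * (x - x0))) 0 per =
  integral (fun x => g x * dirichlet j (tau * (x - x0))) 0 per + 2 * mode g (S j).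
Proof.
  intros Hg; unfold mode.
  rewrite <- integral_scal, <- integral_plus by auto 10 using C0_dirichlet with cont.
  apply integral_ext; intros x.
  change (dirichlet (S j) (tau * (x - x0)))
    with (dirichlet j (tau * (x - x0)) + 2 * cos (INR (S j) * (tau * (x - x0)))); ring.
Qed.

Lemma mode_fejer_S g N : C0 g ->
  integral (fun x => g x * fejer (S N) (tau * (x - x0))) 0 per =
  integral (fun x => g x * fejer N (tau * (x - x0))) 0 per +
  integral (fun x => g x * dirichlet N (tau * (x - x0))) 0 per.
Proof.
  intros Hg; rewrite <- integral_plus by auto using C0_mult, C0_dirichlet, C0_fejer.
  apply integral_ext; intros x; simpl; ring.
Qed.

Lemma mode_one k : mode (fun _ => 1) k = match k with O => per | S _ => 0 end.
Proof.
  destruct k as [|k]; unfold mode.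
  - rewrite (integral_ext _ (fun _ => 1)); [rewrite integral_const; ring|].
    intros x; simpl; rewrite Rmult_0_l, cos_0; ring.
  - assert (Hk : 0 < INR (S k)) by (apply lt_0_INR; lia).
    rewrite (integral_derive (fun x => / (INR (S k) * tau) * sin (INR (S k) * (tau * (x - x0))))).
    + replace (INR (S k) * (tau * (per - x0)))
        with (INR (S k) * (tau * (0 - x0)) + 2 * INR (S k) * PI) by (field; lra).
      rewrite sin_period; ring.
    + intros x; eapply der_eq.
      * apply der_mult; [apply der_const|].
        apply (der_comp sin); [apply is_derive_sin|auto 10 with der].
      * cbv beta; field; lra.
    + cont.
Qed.

Lemma integral_dirichlet j : integral (fun x => 1 * dirichlet j (tau * (x - x0))) 0 per = per.
Proof.
  induction j as [|j IH].
  - rewrite mode_dirichlet_0 by cont; apply mode_one.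
  - rewrite mode_dirichlet_S, IH, mode_one by cont; ring.
Qed.

Lemma integral_fejer N : integral (fun x => 1 * fejer N (tau * (x - x0))) 0 per = INR N * per.
Proof.
  induction N as [|N IH].
  - simpl; rewrite (integral_ext _ (fun _ => 0)); [rewrite integral_const; ring|intros; ring].
  - rewrite mode_fejer_S, IH, integral_dirichlet, S_INR by cont; ring.
Qed.

(** Concentration of the kernel: its mass is [N] periods, while the moment of [1 - cos] stays at one
    period. *)
Lemma integral_fejer_moment N : (0 < N)%nat ->
  integral (fun x => (1 - cos (tau * (x - x0))) * fejer N (tau * (x - x0))) 0 per = per.
Proof.
  intros HN.
  rewrite (integral_ext _ (fun x => 1 - 1 * cos (INR N * (tau * (x - x0)))));
    [|intros; rewrite fejer_telescope; ring].
  rewrite integral_minus, integral_const by cont.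
  fold (mode (fun _ => 1) N); rewrite mode_one; destruct N; [lia|ring].
Qed.

(** The kernel is expanded into modes; all but the first cost at most [e] each, weighted by their
    coefficients. *)
Lemma fejer_upper g N e : C0 g -> 0 <= e ->
  (forall k, (k < N)%nat -> k <> 1%nat -> Rabs (mode g k) <= e) ->
  integral (fun x => g x * fejer N (tau * (x - x0))) 0 per <=
  INR N * (2 * Rabs (mode g 1) + (2 * INR N + 1) * e).
Proof.
  intros Hg He Hk.
  assert (Hd : forall j, (j < N)%nat ->
    integral (fun x => g x * dirichlet j (tau * (x - x0))) 0 per <=
    (* The first mode enters every Dirichlet kernel except the one of index 0, always with
       coefficient 2. *)
    (match j with O => 0 | S _ => 2 * Rabs (mode g 1) end) + (2 * INR j + 1) * e).
  { induction j as [|j IH]; intros Hj.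
    - rewrite mode_dirichlet_0 by trivial; simpl.
      generalize (Hk 0%nat Hj ltac:(lia)), (Rle_abs (mode g 0)); lra.
    - rewrite mode_dirichlet_S by trivial; rewrite S_INR.
      specialize (IH ltac:(lia)); destruct j as [|j].
      + simpl in IH |- *; generalize (Rle_abs (mode g 1)); lra.
      + generalize (Hk (S (S j)) Hj ltac:(lia)), (Rle_abs (mode g (S (S j)))); lra. }
  assert (HN : forall n, (n <= N)%nat ->
    integral (fun x => g x * fejer n (tau * (x - x0))) 0 per <=
    INR n * (2 * Rabs (mode g 1) + (2 * INR N + 1) * e)).
  { induction n as [|n IH]; intros Hn.
    - simpl; rewrite integral_zero; [lra|intros; ring].
    - rewrite mode_fejer_S, S_INR by trivial; specialize (IH ltac:(lia)).
      specialize (Hd n ltac:(lia)).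
      assert (INR n <= INR N) by (apply le_INR; lia).
      assert (match n with O => 0 | S _ => 2 * Rabs (mode g 1) end <= 2 * Rabs (mode g 1))
        by (generalize (Rabs_pos (mode g 1)); destruct n; lra).
      nra. }
  now apply HN.
Qed.

Lemma fejer_lower g B N : C0 g -> (0 < N)%nat ->
  (forall x, 0 <= x <= per -> / 2 - B * (1 - cos (tau * (x - x0))) <= g x) ->
  INR N * per / 2 - B * per <= integral (fun x => g x * fejer N (tau * (x - x0))) 0 per.
Proof.
  intros Hg HN Hlow.
  replace (INR N * per / 2 - B * per) with
    (integral (fun x => / 2 * (1 * fejer N (tau * (x - x0)))
       - B * ((1 - cos (tau * (x - x0))) * fejer N (tau * (x - x0)))) 0 per).
  - apply RInt_le; try (apply C0_ex_RInt; auto 10 using C0_fejer with cont).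
    + left; apply period_pos.
    + intros x Hx; generalize (Hlow x ltac:(lra)), (fejer_nonneg N (tau * (x - x0))); nra.
  - rewrite integral_minus by auto 10 using C0_fejer with cont.
    rewrite (integral_scal (fun x => 1 * fejer N (tau * (x - x0)))) by
      auto 10 using C0_fejer with cont.
    rewrite (integral_scal (fun x => (1 - cos (tau * (x - x0))) * fejer N (tau * (x - x0)))) by
      auto 10 using C0_fejer with cont.
    rewrite integral_fejer, integral_fejer_moment by trivial; field; lra.
Qed.

End Fourier.

(** Young's inequality [|dg| <= C + dg^2 / (4 C)] replaces Cauchy-Schwarz: over a length of at most
    [1 / (4 C)] each of its two terms integrates to at most [1/4]. *)
Lemma holder_half (g dg : R -> R) (per C y z : R) :
  (forall x, is_derive g x (dg x)) -> C0 dg -> 0 < C ->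
  (forall al, integral (fun x => dg x ^ 2) al (al + per) <= C) ->
  y <= z <= y + per -> z - y <= / (4 * C) -> Rabs (g z - g y) <= / 2.
Proof.
  intros Hd Hc HC Hint Hyz Hd2.
  rewrite <- (integral_derive g dg) by trivial.
  eapply Rle_trans; [apply (integral_bound dg (fun x => C + / (4 * C) * dg x ^ 2))|].
  - lra.
  - trivial.
  - cont.
  - intros x.
    assert (0 <= (Rabs (dg x) - 2 * C) ^ 2) by apply pow2_ge_0.
    rewrite <- (pow2_abs (dg x)).
    apply (Rmult_le_reg_l (4 * C)); [lra|].
    rewrite Rmult_plus_distr_l, <- Rmult_assoc, Rinv_r, Rmult_1_l by lra. nra.
  - rewrite integral_plus, integral_const, integral_scal by cont.
    assert (A1 : integral (fun x => dg x ^ 2) y z <= C).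
    { eapply Rle_trans; [|apply (Hint y)].
      rewrite <- (integral_Chasles _ y z (y + per)) by cont.
      enough (0 <= integral (fun x => dg x ^ 2) z (y + per)) by lra.
      apply integral_nonneg; [lra|cont|intros; apply pow2_ge_0]. }
    assert (0 < / (4 * C)) by (apply Rinv_0_lt_compat; lra).
    assert (E : / (4 * C) * C = / 4) by (field; lra). nra.
Qed.

(** Within the radius [Rmin (PI / tau) (/ (4 * C))] of [x0] the function is at least [1/2]. Farther
    away the subtracted term is at least 2, which brings the bound below [-1]. Capping the radius at
    half a period keeps the cosine monotone. *)
Lemma local_lower (g dg : R -> R) (tau x0 C : R) :
  0 < tau -> 0 <= x0 <= 2 * PI / tau ->
  (forall x, is_derive g x (dg x)) -> C0 dg -> 0 < C ->
  (forall al, integral (fun x => dg x ^ 2) al (al + 2 * PI / tau) <= C) ->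
  (forall x, g (x + 2 * PI / tau) = g x) -> (forall x, Rabs (g x) <= 1) -> g x0 = 1 ->
  forall x, 0 <= x <= 2 * PI / tau ->
  / 2 - / (1 - cos (tau * Rmin (PI / tau) (/ (4 * C)))) * 2 * (1 - cos (tau * (x - x0))) <= g x.
Proof.
  intros Htau Hx0 Hd Hc HC Hint Hper Hb Hg0 x Hx.
  set (del := Rmin (PI / tau) (/ (4 * C))).
  assert (HPI := PI_RGT_0).
  assert (Hpt : 0 < PI / tau) by (apply Rdiv_lt_0_compat; lra).
  assert (H4 : 0 < / (4 * C)) by (apply Rinv_0_lt_compat; lra).
  assert (Hdel : 0 < del) by now apply Rmin_glb_lt.
  assert (Hdel1 : del <= PI / tau) by apply Rmin_l.
  assert (Hdel2 : del <= / (4 * C)) by apply Rmin_r.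
  assert (Et : forall u, u <= PI / tau -> tau * u <= PI).
  { intros u Hu; replace PI with (tau * (PI / tau)) by (field; lra).
    apply Rmult_le_compat_l; lra. }
  assert (Hcos : cos (tau * del) < 1).
  { rewrite <- cos_0; apply cos_decreasing_1; try lra.
    - apply Rmult_le_pos; lra.
    - apply Et; trivial.
    - apply Rmult_lt_0_compat; lra. }
  assert (HB : 0 < / (1 - cos (tau * del))) by (apply Rinv_0_lt_compat; lra).
  assert (Hp2 : 2 * PI / tau = PI / tau + PI / tau) by (field; lra).
  assert (Hu : forall u, - (PI / tau) <= u - x0 <= PI / tau ->
     / 2 - / (1 - cos (tau * del)) * 2 * (1 - cos (tau * (u - x0))) <= g u).
  { intros u Hu.
    assert (Hcu := cos_le_1 (tau * (u - x0))).
    destruct (Rle_dec (Rabs (u - x0)) del) as [Hle|Hgt].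
    - assert (Hhalf : Rabs (g u - g x0) <= / 2).
      { apply Rabs_le_between in Hle.
        destruct (Rle_dec x0 u).
        - apply (holder_half g dg (2 * PI / tau) C); trivial; lra.
        - rewrite <- Rabs_Ropp, Ropp_minus_distr.
          apply (holder_half g dg (2 * PI / tau) C); trivial; lra. }
      apply Rabs_le_between in Hhalf. nra.
    - assert (Hcl : cos (tau * (u - x0)) <= cos (tau * del)).
      { replace (cos (tau * (u - x0))) with (cos (tau * Rabs (u - x0))).
        - apply cos_decr_1.
          + apply Rmult_le_pos; lra.
          + now apply Et.
          + apply Rmult_le_pos; [lra|apply Rabs_pos].
          + apply Et, Rabs_le; lra.
          + apply Rmult_le_compat_l; lra.
        - unfold Rabs; destruct (Rcase_abs (u - x0)); trivial.
          rewrite <- Ropp_mult_distr_r; apply cos_neg. }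
      assert (1 <= / (1 - cos (tau * del)) * (1 - cos (tau * (u - x0)))).
      { apply (Rle_trans _ (/ (1 - cos (tau * del)) * (1 - cos (tau * del)))).
        - rewrite Rinv_l; lra.
        - apply Rmult_le_compat_l; lra. }
      generalize (proj1 (Rabs_le_between _ _) (Hb u)); nra. }
  (* A point of the base period may be more than half a period away from [x0]; a shift by one period
     brings it back into the range of [Hu]. *)
  assert (Ec : forall s, cos (tau * (s + 2 * PI / tau - x0)) = cos (tau * (s - x0))).
  { intros s; replace (tau * (s + 2 * PI / tau - x0)) with (tau * (s - x0) + 2 * INR 1 * PI)
      by (simpl; field; lra). apply cos_period. }
  destruct (Rle_dec (x - x0) (- (PI / tau))) as [H1|H1].
  - rewrite <- Hper, <- Ec; apply Hu; lra.
  - destruct (Rle_dec (x - x0) (PI / tau)) as [H2|H2]; [apply Hu; lra|].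
    replace x with (x - 2 * PI / tau + 2 * PI / tau) by ring.
    rewrite Hper, Ec; apply Hu; lra.
Qed.

(** * Power series in the parameter and uniform expansions *)

Definition geometric (M r : R) (c : nat -> R) : Prop := forall n, Rabs (c n) * r ^ n <= M.

Lemma geometric_nonneg M r c : geometric M r c -> 0 <= M.
Proof.
  intros H; generalize (H 0%nat), (Rabs_pos (c 0%nat)); simpl; lra.
Qed.

Lemma geometric_radius M r c t : 0 < r -> geometric M r c -> Rabs t < r ->
  Rbar_lt (Rabs t) (CV_radius c).
Proof.
  intros Hr Hc Ht; apply (Rbar_lt_le_trans _ (Finite r)); [exact Ht|].
  apply (CV_radius_bounded c); exists M; intros n.
  rewrite Rabs_mult, (Rabs_pos_eq (r ^ n)); [apply Hc|apply pow_le; lra].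
Qed.

(** At half the radius the terms are dominated by [M / 2^n]; the factor 2 is the sum of that
    geometric series. *)
Lemma geometric_PSeries_bound M r c t : 0 < r -> geometric M r c -> Rabs t <= r / 2 ->
  Rabs (PSeries c t) <= 2 * M.
Proof.
  intros Hr Hc Ht.
  assert (HM := geometric_nonneg _ _ _ Hc).
  assert (Hs : is_series (fun n => M * (/ 2) ^ n) (M * / (1 - / 2))).
  { apply (is_series_scal M (fun n => (/ 2) ^ n)).
    apply is_series_geom; rewrite Rabs_pos_eq; lra. }
  assert (Hle : forall n, Rabs (c n * t ^ n) <= M * (/ 2) ^ n).
  { intros n; rewrite Rabs_mult, <- RPow_abs.
    apply (Rle_trans _ (Rabs (c n) * (r / 2) ^ n)).
    - apply Rmult_le_compat_l; [apply Rabs_pos|].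
      apply pow_incr; split; [apply Rabs_pos|exact Ht].
    - unfold Rdiv; rewrite Rpow_mult_distr, <- Rmult_assoc.
      apply Rmult_le_compat_r; [apply pow_le; lra|apply Hc]. }
  assert (Hex : ex_series (fun n => Rabs (c n * t ^ n))).
  { apply (ex_series_le (fun n => Rabs (c n * t ^ n)) (fun n => M * (/ 2) ^ n)).
    - intros n; unfold norm; simpl; unfold abs; simpl; rewrite Rabs_Rabsolu; apply Hle.
    - eexists; exact Hs. }
  unfold PSeries; eapply Rle_trans; [apply Series_Rabs, Hex|].
  replace (2 * M) with (Series (fun n => M * (/ 2) ^ n)).
  - apply Series_le; [|eexists; exact Hs].
    intros n; split; [apply Rabs_pos|apply Hle].
  - rewrite (is_series_unique _ _ Hs); field.
Qed.

Lemma geometric_tail M r c : 0 < r -> geometric M r c ->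
  geometric (M / r) r (fun n => c (S n)).
Proof.
  intros Hr Hc n; apply (Rmult_le_reg_r r); trivial.
  replace (M / r * r) with M by (field; lra).
  specialize (Hc (S n)); simpl in Hc; lra.
Qed.

Lemma PSeries_tail M r c t : 0 < r -> geometric M r c -> Rabs t < r ->
  PSeries c t = c 0%nat + t * PSeries (fun n => c (S n)) t.
Proof.
  intros Hr Hc Ht; apply PSeries_decr_1, CV_radius_inside; eapply geometric_radius; eassumption.
Qed.

Lemma S_le_pow2 n : INR (S n) <= 2 ^ n.
Proof.
  induction n as [|n IH]; [simpl; lra|].
  rewrite S_INR; simpl pow; assert (1 <= 2 ^ n) by (apply pow_R1_Rle; lra); lra.
Qed.

(** Halving the radius gains [2^n], which absorbs the factor [n + 1] brought down by
    differentiation. *)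
Lemma geometric_derive M r c : 0 < r -> geometric M r c ->
  geometric (M / r) (r / 2) (PS_derive c).
Proof.
  intros Hr Hc n; unfold PS_derive.
  rewrite Rabs_mult, (Rabs_pos_eq (INR (S n))) by apply pos_INR.
  eapply Rle_trans; [|apply (geometric_tail M r c Hr Hc n)].
  unfold Rdiv; rewrite Rpow_mult_distr.
  assert (H2 := S_le_pow2 n).
  assert (Hp : 0 < (/ 2) ^ n) by (apply pow_lt; lra).
  assert (H1 : INR (S n) * (/ 2) ^ n <= 1).
  { replace 1 with (2 ^ n * (/ 2) ^ n).
    - apply Rmult_le_compat_r; lra.
    - rewrite <- Rpow_mult_distr, Rinv_r, pow1; lra. }
  assert (Ha : 0 <= Rabs (c (S n)) * r ^ n).
  { apply Rmult_le_pos; [apply Rabs_pos|apply pow_le; lra]. }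
  nra.
Qed.

Definition psum (c : nat -> R -> R) (t x : R) : R := PSeries (fun n => c n x) t.

Definition geometric_family (M r : R) (c : nat -> R -> R) : Prop :=
  forall n x, Rabs (c n x) * r ^ n <= M.

Lemma psum_minus M r (c : nat -> R -> R) t x y : 0 < r -> geometric_family M r c -> Rabs t < r ->
  psum c t x - psum c t y = PSeries (fun n => c n x - c n y) t.
Proof.
  intros Hr Hc Ht; symmetry; apply (PSeries_minus (fun n => c n x) (fun n => c n y));
    apply CV_radius_inside; apply (geometric_radius M r); trivial; intros n; apply Hc.
Qed.

Lemma lipschitz_of_derive (f df : R -> R) (K x y : R) :
  (forall x, is_derive f x (df x)) -> (forall x, Rabs (df x) <= K) ->
  Rabs (f x - f y) <= K * Rabs (x - y).
Proof.
  intros Hd HK.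
  destruct (MVT_gen f y x df) as (z & _ & ->).
  - intros; apply Hd.
  - intros; apply C0_pt, (C0_derive f df), Hd.
  - rewrite Rabs_mult; apply Rmult_le_compat_r; [apply Rabs_pos|apply HK].
Qed.

Lemma family_lipschitz M r (c dc : nat -> R -> R) : 0 < r ->
  (forall n x, is_derive (c n) x (dc n x)) -> geometric_family M r dc ->
  forall n x y, Rabs (c n x - c n y) * r ^ n <= M * Rabs (x - y).
Proof.
  intros Hr Hd Hg n x y.
  assert (Hp : 0 < r ^ n) by now apply pow_lt.
  assert (H : Rabs (c n x - c n y) <= M / r ^ n * Rabs (x - y)).
  { apply (lipschitz_of_derive _ (dc n)); [apply Hd|].
    intros z; apply (Rmult_le_reg_r (r ^ n)); trivial.
    replace (M / r ^ n * r ^ n) with M by (field; lra). apply Hg. }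
  apply (Rmult_le_compat_r (r ^ n)) in H; [|lra].
  replace (M / r ^ n * Rabs (x - y) * r ^ n) with (M * Rabs (x - y)) in H by (field; lra).
  exact H.
Qed.

Lemma psum_lipschitz M M' r (c : nat -> R -> R) t x y : 0 < r ->
  geometric_family M r c ->
  (forall n x y, Rabs (c n x - c n y) * r ^ n <= M' * Rabs (x - y)) -> Rabs t <= r / 2 ->
  Rabs (psum c t x - psum c t y) <= 2 * M' * Rabs (x - y).
Proof.
  intros Hr Hc HL Ht; rewrite (psum_minus M r) by (trivial; lra).
  replace (2 * M' * Rabs (x - y)) with (2 * (M' * Rabs (x - y))) by ring.
  apply (geometric_PSeries_bound _ r); trivial; intros n; apply HL.
Qed.

(** Continuity in [t] at the single abscissa [x] suffices, because the sum is Lipschitz in [x]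
    uniformly in [t]. *)
Lemma psum_cont M M' r (c : nat -> R -> R) t x : 0 < r ->
  geometric_family M r c ->
  (forall n x y, Rabs (c n x - c n y) * r ^ n <= M' * Rabs (x - y)) -> Rabs t < r / 2 ->
  continuity_2d_pt (psum c) t x.
Proof.
  intros Hr Hc HL Ht eps.
  assert (HM' : 0 <= M').
  { generalize (HL 0%nat 1 0), (Rabs_pos (c 0%nat 1 - c 0%nat 0)); simpl.
    rewrite Rminus_0_r, Rabs_R1; lra. }
  assert (Hct : continuity_pt (PSeries (fun n => c n x)) t).
  { apply PSeries_continuity, (geometric_radius M r); trivial; [intros n; apply Hc|lra]. }
  destruct (proj1 (continuity_pt_locally _ _) Hct (mkposreal _ (is_pos_div_2 eps))) as [d1 Hd1].
  simpl in Hd1.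
  assert (Hd2 : 0 < r / 2 - Rabs t) by lra.
  assert (Hd3 : 0 < eps / (4 * M' + 1)).
  { apply Rdiv_lt_0_compat; [apply cond_pos|lra]. }
  assert (Hd : 0 < Rmin d1 (Rmin (r / 2 - Rabs t) (eps / (4 * M' + 1)))).
  { repeat apply Rmin_glb_lt; trivial; apply cond_pos. }
  exists (mkposreal _ Hd); simpl; intros u v Hu Hv.
  assert (Hu1 : Rabs (u - t) < d1) by (eapply Rlt_le_trans; [exact Hu|apply Rmin_l]).
  assert (Hu2 : Rabs (u - t) < r / 2 - Rabs t).
  { eapply Rlt_le_trans; [exact Hu|]; eapply Rle_trans; [apply Rmin_r|apply Rmin_l]. }
  assert (Hv2 : Rabs (v - x) < eps / (4 * M' + 1)).
  { eapply Rlt_le_trans; [exact Hv|]; eapply Rle_trans; [apply Rmin_r|apply Rmin_r]. }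
  assert (Hut : Rabs u <= r / 2).
  { replace u with (u - t + t) by ring; eapply Rle_trans; [apply Rabs_triang|lra]. }
  replace (psum c u v - psum c t x)
    with ((psum c u v - psum c u x) + (psum c u x - psum c t x)) by ring.
  eapply Rle_lt_trans; [apply Rabs_triang|].
  assert (A1 := psum_lipschitz M M' r c u v x Hr Hc HL Hut).
  assert (A2 : Rabs (psum c u x - psum c t x) < eps / 2) by (apply Hd1; exact Hu1).
  assert (A3 : 2 * M' * Rabs (v - x) <= eps / 2).
  { apply (Rle_trans _ (2 * M' * (eps / (4 * M' + 1)))).
    - apply Rmult_le_compat_l; lra.
    - apply (Rmult_le_reg_r (4 * M' + 1)); [lra|].
      replace (2 * M' * (eps / (4 * M' + 1)) * (4 * M' + 1)) with (2 * M' * eps) by (field; lra).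
      generalize (cond_pos eps); nra. }
  lra.
Qed.

Lemma is_derive_of_quadratic (f : R -> R) (x l K : R) :
  (forall y, Rabs (f y - f x - l * (y - x)) <= K * (y - x) ^ 2) -> is_derive f x l.
Proof.
  intros H; apply is_derive_Reals; intros eps Heps.
  assert (HK : 0 < Rabs K + 1) by (generalize (Rabs_pos K); lra).
  assert (Hd : 0 < eps / (Rabs K + 1)) by now apply Rdiv_lt_0_compat.
  exists (mkposreal _ Hd); intros h Hh Hlt; simpl in Hlt.
  replace ((f (x + h) - f x) / h - l) with ((f (x + h) - f x - l * (x + h - x)) / h)
    by (field; trivial).
  assert (Hh0 : 0 < Rabs h) by now apply Rabs_pos_lt.
  unfold Rdiv at 1; rewrite Rabs_mult, Rabs_inv.
  apply (Rmult_lt_reg_r (Rabs h)); trivial.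
  rewrite Rmult_assoc, Rinv_l, Rmult_1_r by lra.
  eapply Rle_lt_trans; [apply H|].
  replace (x + h - x) with h by ring; rewrite <- (pow2_abs h).
  assert (Hlt2 : Rabs h * (Rabs K + 1) < eps).
  { apply (Rmult_lt_compat_r (Rabs K + 1)) in Hlt; trivial.
    replace (eps / (Rabs K + 1) * (Rabs K + 1)) with eps in Hlt by (field; lra); exact Hlt. }
  generalize (Rle_abs K); nra.
Qed.

Lemma quadratic_of_lipschitz (f df : R -> R) (K x y : R) :
  (forall x, is_derive f x (df x)) -> 0 <= K ->
  (forall x y, Rabs (df x - df y) <= K * Rabs (x - y)) ->
  Rabs (f y - f x - df x * (y - x)) <= K * (y - x) ^ 2.
Proof.
  intros Hd HK HL.
  destruct (MVT_gen f x y df) as (z & Hz & E).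
  - intros; apply Hd.
  - intros; apply C0_pt, (C0_derive f df), Hd.
  - rewrite E; replace (df z * (y - x) - df x * (y - x)) with ((df z - df x) * (y - x)) by ring.
    rewrite Rabs_mult, <- (pow2_abs (y - x)).
    assert (Rabs (z - x) <= Rabs (y - x)).
    { unfold Rmin, Rmax in Hz; destruct (Rle_dec x y); unfold Rabs;
        destruct (Rcase_abs (z - x)), (Rcase_abs (y - x)); lra. }
    specialize (HL z x); generalize (Rabs_pos (y - x)), (Rabs_pos (z - x)); intros.
    simpl; rewrite Rmult_1_r, <- Rmult_assoc; apply Rmult_le_compat_r; trivial.
    eapply Rle_trans; [exact HL|]; now apply Rmult_le_compat_l.
Qed.

(** The quadratic Taylor remainders of the coefficients are again geometrically bounded. Summing
    them bounds the remainder of the whole series, so no separate limit of derivatives has to be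
    exchanged. *)
Lemma psum_derive_x M r (c dc : nat -> R -> R) t x : 0 < r ->
  (forall n x, is_derive (c n) x (dc n x)) ->
  geometric_family M r c -> geometric_family M r dc ->
  (forall n x y, Rabs (dc n x - dc n y) * r ^ n <= M * Rabs (x - y)) ->
  Rabs t <= r / 2 -> is_derive (psum c t) x (psum dc t x).
Proof.
  intros Hr Hd Hc Hdc HL Ht.
  assert (HM : 0 <= M) by (apply (geometric_nonneg M r (fun n => c n 0)); intros n; apply Hc).
  apply (is_derive_of_quadratic _ _ _ (2 * M)); intros y.
  assert (Ex : forall (g : nat -> R), geometric M r g -> ex_pseries g t).
  { intros g Hg; apply CV_radius_inside, (geometric_radius M r); trivial; lra. }
  rewrite (psum_minus M r) by (trivial; lra); unfold psum.
  rewrite (Rmult_comm (PSeries _ _)), <- (PSeries_scal (y - x) (fun n => dc n x)).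
  rewrite <- (PSeries_minus (fun n => c n y - c n x)).
  - rewrite Rmult_assoc; apply (geometric_PSeries_bound _ r); trivial; intros n.
    assert (Hp : 0 < r ^ n) by now apply pow_lt.
    assert (Q : Rabs (c n y - c n x - dc n x * (y - x)) <= M / r ^ n * (y - x) ^ 2).
    { apply quadratic_of_lipschitz; [apply Hd| |].
      - apply Rmult_le_pos; [trivial|left; now apply Rinv_0_lt_compat].
      - intros u v; apply (Rmult_le_reg_r (r ^ n)); trivial.
        replace (M / r ^ n * Rabs (u - v) * r ^ n) with (M * Rabs (u - v)) by (field; lra).
        apply HL. }
    apply (Rmult_le_compat_r (r ^ n)) in Q; [|lra].
    replace (M / r ^ n * (y - x) ^ 2 * r ^ n) with (M * (y - x) ^ 2) in Q by (field; lra).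
    unfold PS_minus, PS_plus, PS_opp, PS_scal, plus, opp, scal; simpl; unfold mult; simpl.
    replace (c n y - c n x + - ((y - x) * dc n x))
      with (c n y - c n x - dc n x * (y - x)) by ring; exact Q.
  - apply (ex_pseries_minus (fun n => c n y) (fun n => c n x)); apply Ex; intros n; apply Hc.
  - apply (ex_pseries_scal (y - x) (fun n => dc n x)); [apply Rmult_comm|].
    apply Ex; intros n; apply Hdc.
Qed.

Definition family_derive (c : nat -> R -> R) (n : nat) (x : R) : R := INR (S n) * c (S n) x.

Lemma psum_derive_t M r (c : nat -> R -> R) t x : 0 < r ->
  geometric_family M r c -> Rabs t < r ->
  is_derive (fun t => psum c t x) t (psum (family_derive c) t x).
Proof.
  intros Hr Hc Ht; apply (is_derive_PSeries (fun n => c n x)).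
  apply (geometric_radius M r); trivial; intros n; apply Hc.
Qed.

Lemma family_derive_geometric M r (c : nat -> R -> R) : 0 < r ->
  geometric_family M r c -> geometric_family (M / r) (r / 2) (family_derive c).
Proof.
  intros Hr Hc n x; apply (geometric_derive M r (fun n => c n x)); trivial; intros m; apply Hc.
Qed.

Lemma family_derive_lipschitz M r (c : nat -> R -> R) : 0 < r ->
  (forall n x y, Rabs (c n x - c n y) * r ^ n <= M * Rabs (x - y)) ->
  forall n x y, Rabs (family_derive c n x - family_derive c n y) * (r / 2) ^ n
     <= M / r * Rabs (x - y).
Proof.
  intros Hr Hc n x y.
  replace (M / r * Rabs (x - y)) with (M * Rabs (x - y) / r) by (field; lra).
  generalize (geometric_derive (M * Rabs (x - y)) r (fun n => c n x - c n y) Hr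
    (fun n => Hc n x y) n).
  unfold PS_derive, family_derive; now rewrite Rmult_minus_distr_l.
Qed.

(** * Bounds of order [t^n] that are uniform in [x] *)

Lemma small_mult (C e : R) : 0 < e ->
  exists delta, 0 < delta /\ forall t, 0 <= t < delta -> Rabs C * t < e.
Proof.
  intros He; assert (HC : 0 < Rabs C + 1) by (generalize (Rabs_pos C); lra).
  exists (e / (Rabs C + 1)); split; [now apply Rdiv_lt_0_compat|]; intros t Ht.
  assert (t * (Rabs C + 1) < e).
  { apply (Rlt_le_trans _ (e / (Rabs C + 1) * (Rabs C + 1))).
    - apply Rmult_lt_compat_r; lra.
    - right; field; lra. }
  lra.
Qed.

(** One-sided in [t], as the branch is, and uniform in [x], so that the bounds can be integrated
    over a period. *)
Definition Ou (n : nat) (f : R -> R -> R) : Prop :=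
  exists C delta, 0 < delta /\ forall t x, 0 <= t < delta -> Rabs (f t x) <= C * t ^ n.

Lemma Ou_loc n f g : Ou n f ->
  (exists delta, 0 < delta /\ forall t x, 0 <= t < delta -> f t x = g t x) -> Ou n g.
Proof.
  intros (C & d & Hd & H) (d' & Hd' & E); exists C, (Rmin d d'); split.
  - now apply Rmin_glb_lt.
  - intros t x Ht; rmin_bounds.
    rewrite <- E by lra; apply H; lra.
Qed.

Lemma Ou_ext n f g : Ou n f -> (forall t x, f t x = g t x) -> Ou n g.
Proof. intros H E; apply (Ou_loc n f); trivial; exists 1; split; [lra|auto]. Qed.

Lemma Ou_plus n f g : Ou n f -> Ou n g -> Ou n (fun t x => f t x + g t x).
Proof.
  intros (C & d & Hd & H) (C' & d' & Hd' & H'); exists (C + C'), (Rmin d d'); split.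
  - now apply Rmin_glb_lt.
  - intros t x Ht; rmin_bounds.
    eapply Rle_trans; [apply Rabs_triang|].
    rewrite Rmult_plus_distr_r; apply Rplus_le_compat; [apply H|apply H']; lra.
Qed.

Lemma Ou_opp n f : Ou n f -> Ou n (fun t x => - f t x).
Proof.
  intros (C & d & Hd & H); exists C, d; split; trivial.
  intros; rewrite Rabs_Ropp; auto.
Qed.

Lemma Ou_minus n f g : Ou n f -> Ou n g -> Ou n (fun t x => f t x - g t x).
Proof. intros Hf Hg; apply (Ou_plus n f (fun t x => - g t x)); trivial; now apply Ou_opp. Qed.

Lemma Ou_mult n m f g : Ou n f -> Ou m g -> Ou (n + m) (fun t x => f t x * g t x).
Proof.
  intros (C & d & Hd & H) (C' & d' & Hd' & H'); exists (C * C'), (Rmin d d'); split.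
  - now apply Rmin_glb_lt.
  - intros t x Ht; rmin_bounds.
    rewrite Rabs_mult, pow_add.
    replace (C * C' * (t ^ n * t ^ m)) with (C * t ^ n * (C' * t ^ m)) by ring.
    apply Rmult_le_compat; try apply Rabs_pos; [apply H|apply H']; lra.
Qed.

Lemma Ou_le n m f : (m <= n)%nat -> Ou n f -> Ou m f.
Proof.
  intros Hmn (C & d & Hd & H); exists (Rabs C), (Rmin d 1); split.
  - apply Rmin_glb_lt; lra.
  - intros t x Ht; rmin_bounds.
    eapply Rle_trans; [apply H; lra|].
    assert (0 <= t ^ n) by (apply pow_le; lra).
    assert (t ^ n <= t ^ m).
    { replace n with (m + (n - m))%nat by lia; rewrite pow_add.
      rewrite <- (Rmult_1_r (t ^ m)) at 2.
      apply Rmult_le_compat_l; [apply pow_le; lra|].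
      rewrite <- (pow1 (n - m)); apply pow_incr; lra. }
    generalize (Rle_abs C), (Rabs_pos C); nra.
Qed.

Lemma Ou_bounded f K : (forall t x, Rabs (f t x) <= K) -> Ou 0 f.
Proof. intros H; exists K, 1; split; [lra|]; intros; simpl; rewrite Rmult_1_r; auto. Qed.

Lemma Ou_const c : Ou 0 (fun _ _ => c).
Proof. apply (Ou_bounded _ (Rabs c)); intros; apply Rle_refl. Qed.

Lemma Ou_t : Ou 1 (fun t _ => t).
Proof.
  exists 1, 1; split; [lra|]; intros t x Ht; rewrite Rabs_pos_eq; simpl; lra.
Qed.

Lemma Ou_scal n c f : Ou n f -> Ou n (fun t x => c * f t x).
Proof. intros H; apply (Ou_mult 0 n (fun _ _ => c) f); trivial; apply Ou_const. Qed.

Lemma Ou_cos (f : R -> R -> R) : Ou 0 (fun t x => cos (f t x)).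
Proof. apply (Ou_bounded _ 1); intros; apply Rabs_le, COS_bound. Qed.

Lemma Ou_sin (f : R -> R -> R) : Ou 0 (fun t x => sin (f t x)).
Proof. apply (Ou_bounded _ 1); intros; apply Rabs_le, SIN_bound. Qed.

(** First-order closeness to a constant. Carrying the limit [c] as a parameter lets limits of
    compound expressions be computed along their structure. *)
Definition near (c : R) (f : R -> R -> R) : Prop := Ou 1 (fun t x => f t x - c).

Lemma near_Ou c f : near c f -> Ou 0 f.
Proof.
  intros H; apply (Ou_ext 0 (fun t x => (f t x - c) + c)); [|intros; ring].
  apply Ou_plus; [apply (Ou_le 1); [lia|exact H]|apply Ou_const].
Qed.

Lemma near_const c : near c (fun _ _ => c).
Proof.
  apply (Ou_ext 1 (fun t _ => 0 * t)); [apply Ou_scal, Ou_t|intros; ring].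
Qed.

Lemma near_eq c c' f : near c f -> c = c' -> near c' f.
Proof. now intros H <-. Qed.

Lemma near_loc c f g : near c f ->
  (exists delta, 0 < delta /\ forall t x, 0 <= t < delta -> f t x = g t x) -> near c g.
Proof.
  intros H (d & Hd & E); apply (Ou_loc _ _ _ H); exists d; split; trivial.
  intros t x Ht; now rewrite E.
Qed.

Lemma near_0 f : Ou 1 f -> near 0 f.
Proof. intros H; apply (Ou_ext 1 f); trivial; intros; ring. Qed.

Lemma near_0_inv f : near 0 f -> Ou 1 f.
Proof. intros H; apply (Ou_ext 1 _ _ H); intros; ring. Qed.

Lemma near_plus c c' f g : near c f -> near c' g -> near (c + c') (fun t x => f t x + g t x).
Proof.
  intros Hf Hg; apply (Ou_ext 1 (fun t x => (f t x - c) + (g t x - c'))); [|intros; ring].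
  now apply Ou_plus.
Qed.

Lemma near_minus c c' f g : near c f -> near c' g -> near (c - c') (fun t x => f t x - g t x).
Proof.
  intros Hf Hg; apply (Ou_ext 1 (fun t x => (f t x - c) - (g t x - c'))); [|intros; ring].
  now apply Ou_minus.
Qed.

Lemma near_mult c c' f g : near c f -> near c' g -> near (c * c') (fun t x => f t x * g t x).
Proof.
  intros Hf Hg.
  apply (Ou_ext 1 (fun t x => (f t x - c) * g t x + c * (g t x - c'))); [|intros; ring].
  apply Ou_plus; [|now apply Ou_scal].
  apply (Ou_mult 1 0); trivial; now apply (near_Ou c').
Qed.

Lemma near_small c f e : near c f -> 0 < e ->
  exists delta, 0 < delta /\ forall t x, 0 <= t < delta -> Rabs (f t x - c) < e.
Proof.
  intros (C & d & Hd & H) He; destruct (small_mult C e He) as (d' & Hd' & H').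
  exists (Rmin d d'); split; [now apply Rmin_glb_lt|]; intros t x Ht.
  rmin_bounds.
  specialize (H t x ltac:(lra)); specialize (H' t ltac:(lra)).
  simpl in H; generalize (Rle_abs C); nra.
Qed.

Lemma near_comp (phi : R -> R) c f : ex_derive phi c -> near c f ->
  near (phi c) (fun t x => phi (f t x)).
Proof.
  intros [l Hl] N.
  apply is_derive_Reals in Hl.
  (* With tolerance 1, the difference quotients at [c] are bounded by [Rabs l + 1]. *)
  destruct (Hl 1 Rlt_0_1) as [e He].
  destruct (near_small _ _ _ N (cond_pos e)) as (d' & Hd' & H2).
  destruct N as (C & d & Hd & H).
  exists ((Rabs l + 1) * C), (Rmin d d'); split; [now apply Rmin_glb_lt|]; intros t x Ht.
  rmin_bounds.
  specialize (H t x ltac:(lra)); specialize (H2 t x ltac:(lra)).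
  assert (Hl0 := Rabs_pos l).
  destruct (Req_dec (f t x - c) 0) as [E|E].
  { replace (f t x) with c in H |- * by lra.
    rewrite !Rminus_diag, !Rabs_R0 in *; rewrite Rmult_assoc; apply Rmult_le_pos; lra. }
  specialize (He (f t x - c) E H2).
  replace (c + (f t x - c)) with (f t x) in He by ring.
  replace (phi (f t x) - phi c)
    with ((((phi (f t x) - phi c) / (f t x - c) - l) + l) * (f t x - c)) by (field; trivial).
  rewrite Rabs_mult, Rmult_assoc.
  apply Rmult_le_compat; try apply Rabs_pos; trivial.
  eapply Rle_trans; [apply Rabs_triang|lra].
Qed.

Lemma near_inv c f : c <> 0 -> near c f -> near (/ c) (fun t x => / f t x).
Proof.
  intros Hc Hf; apply (near_comp Rinv); trivial.
  auto_derive; trivial.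
Qed.

Lemma near_div c c' f g : c' <> 0 -> near c f -> near c' g ->
  near (c / c') (fun t x => f t x / g t x).
Proof. intros Hc Hf Hg; apply near_mult; trivial; now apply near_inv. Qed.

Lemma near_pow c f n : near c f -> near (c ^ n) (fun t x => f t x ^ n).
Proof.
  intros Hf; induction n as [|n IH]; simpl; [apply near_const|]; now apply near_mult.
Qed.

Lemma near_pos c f : 0 < c -> near c f ->
  exists delta, 0 < delta /\ forall t x, 0 <= t < delta -> c / 2 <= f t x.
Proof.
  intros Hc N; destruct (near_small _ _ (c / 2) N ltac:(lra)) as (d & Hd & H).
  exists d; split; trivial; intros t x Ht.
  specialize (H t x Ht); apply Rabs_def2 in H; lra.
Qed.

Lemma polynomial_coefficients (p0 p1 p2 C d : R) : 0 < d ->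
  (forall t, 0 <= t < d -> Rabs (p0 + t * p1 + t ^ 2 * p2) <= C * t ^ 3) ->
  p0 = 0 /\ p1 = 0 /\ p2 = 0.
Proof.
  intros Hd H.
  (* A number bounded by [B * t] for all small [t > 0] is zero. This settles [p1] and [p2]; [p0] is
     read off at [t = 0]. *)
  assert (L : forall p B, (forall t, 0 < t < Rmin d 1 -> Rabs p <= B * t) -> p = 0).
  { intros p B Hp; destruct (Req_dec p 0) as [|Hn]; trivial; exfalso.
    destruct (small_mult B (Rabs p) (Rabs_pos_lt _ Hn)) as (d' & Hd' & H').
    assert (Hm : 0 < Rmin (Rmin d 1) d') by (repeat apply Rmin_glb_lt; lra).
    rmin_bounds.
    specialize (Hp (Rmin (Rmin d 1) d' / 2) ltac:(lra)).
    specialize (H' (Rmin (Rmin d 1) d' / 2) ltac:(lra)).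
    generalize (Rle_abs B); nra. }
  rmin_bounds.
  assert (E0 : p0 = 0).
  { specialize (H 0 ltac:(lra)).
    replace (p0 + 0 * p1 + 0 ^ 2 * p2) with p0 in H by ring.
    replace (C * 0 ^ 3) with 0 in H by ring.
    destruct (Req_dec p0 0) as [|Hn]; trivial; apply Rabs_pos_lt in Hn; lra. }
  subst p0.
  assert (E1 : p1 = 0).
  { apply (L _ (Rabs C + Rabs p2)); intros t Ht.
    specialize (H t ltac:(lra)).
    assert (Ht2 : Rabs (t ^ 2) = t ^ 2) by (apply Rabs_pos_eq, pow2_ge_0).
    assert (Ht1 : Rabs t = t) by (apply Rabs_pos_eq; lra).
    assert (E : Rabs (t * p1) <= Rabs (0 + t * p1 + t ^ 2 * p2) + Rabs (t ^ 2 * p2)).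
    { replace (t * p1) with ((0 + t * p1 + t ^ 2 * p2) + - (t ^ 2 * p2)) at 1 by ring.
      eapply Rle_trans; [apply Rabs_triang|]; rewrite Rabs_Ropp; lra. }
    rewrite !Rabs_mult, Ht1, Ht2 in E.
    apply (Rmult_le_reg_l t); [lra|].
    assert (C * t ^ 3 <= Rabs C * t ^ 2).
    { generalize (Rle_abs C), (Rabs_pos C); intros.
      assert (0 <= t ^ 3 <= t ^ 2) by (simpl; nra). nra. }
    simpl in *; nra. }
  subst p1; repeat split.
  apply (L _ (Rabs C)); intros t Ht.
  specialize (H t ltac:(lra)).
  replace (0 + t * 0 + t ^ 2 * p2) with (t ^ 2 * p2) in H by ring.
  rewrite Rabs_mult, (Rabs_pos_eq (t ^ 2)) in H by apply pow2_ge_0.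
  assert (0 < t ^ 2) by (simpl; nra).
  apply (Rmult_le_reg_l (t ^ 2)); trivial.
  eapply Rle_trans; [exact H|].
  replace (t ^ 2 * (Rabs C * t)) with (Rabs C * t ^ 3) by ring.
  apply Rmult_le_compat_r; [apply pow_le; lra|apply Rle_abs].
Qed.

(** * A single wave *)

Set Implicit Arguments.
(** The derivatives of the surface are explicit functions, so that along the branch the surface and
    its slope can be taken as sums of power series in the parameter. *)
Record jet_wave (a Rc per : R) (p : jet) (e de dde : R -> R) (lam : R) : Prop := {
  jw_lam : 0 < lam;
  jw_pos : forall x, 0 < e x;
  jw_de : forall x, is_derive e x (de x);
  jw_dde : forall x, is_derive de x (dde x);
  jw_dde_cont : C0 dde;
  jw_e_per : forall x, e (x + per) = e x;
  jw_p_per : periodic2 per (j0 p);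
  jw_eq : forall x y, 0 < y < e x -> lap lam p x y = - a;
  jw_bottom : forall x, j0 p x 0 = 0;
  jw_top : forall x, j0 p x (e x) = 1;
  jw_bernoulli : forall x,
    1 / 2 * (jy p x (e x) ^ 2 + lam ^ 2 * jx p x (e x) ^ 2) + e x = Rc }.
Unset Implicit Arguments.

Set Implicit Arguments.
Section Wave.
Variables (a Rc per : R) (p : jet) (e de dde : R -> R) (lam : R).
Hypothesis W : jet_wave a Rc per p e de dde lam.

Definition top_speed (x : R) : R := jy p x (e x).
Definition top_speed_derive (x : R) : R := jxy p x (e x) + jyy p x (e x) * de x.

Lemma wave_e_cont : C0 e.
Proof. apply (C0_derive e de), W. Qed.

Lemma wave_de_cont : C0 de.
Proof. apply (C0_derive de dde), W. Qed.

Lemma wave_de_per x : de (x + per) = de x.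
Proof. revert x; apply (periodic_derive per e); apply W. Qed.

Lemma top_speed_cont : C0 top_speed.
Proof. apply (C0_jet_surface (jy p) e); [cont|apply wave_e_cont]. Qed.

Lemma top_speed_spec x : is_derive top_speed x (top_speed_derive x).
Proof. apply (der_surface (jy p) (jxy p) (jyy p)); auto with der cont; apply W. Qed.

Lemma top_speed_derive_cont : C0 top_speed_derive.
Proof.
  unfold top_speed_derive; apply C0_plus; [|apply C0_mult; [|apply wave_de_cont]];
    apply C0_jet_surface; cont; apply wave_e_cont.
Qed.

Lemma wave_top_slope x : jx p x (e x) = - de x * top_speed x.
Proof.
  assert (D : is_derive (fun z => j0 p z (e z)) x (jx p x (e x) + jy p x (e x) * de x)).
  { apply (der_surface (j0 p) (jx p) (jy p)); auto with der cont; apply W. }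
  apply is_derive_unique in D.
  rewrite (Derive_ext _ (fun _ => 1)), Derive_const in D by apply W.
  unfold top_speed; lra.
Qed.

(** Since [psi = 1] along the surface, its horizontal derivative there is [- de * top_speed].
    Bernoulli's law then gives the speed, up to sign, from the surface alone. *)
Lemma wave_speed_squared x :
  top_speed x ^ 2 * (1 + lam ^ 2 * de x ^ 2) = 2 * (Rc - e x).
Proof.
  rewrite <- (jw_bernoulli W x), wave_top_slope; unfold top_speed; field.
Qed.

Lemma wave_speed_squared_derive x :
  2 * top_speed x * top_speed_derive x * (1 + lam ^ 2 * de x ^ 2)
    + top_speed x ^ 2 * (lam ^ 2 * (2 * de x * dde x)) = - 2 * de x.
Proof.
  assert (D : is_derive (fun x => top_speed x ^ 2 * (1 + lam ^ 2 * de x ^ 2)) x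
    (2 * top_speed x * top_speed_derive x * (1 + lam ^ 2 * de x ^ 2)
      + top_speed x ^ 2 * (lam ^ 2 * (2 * de x * dde x)))).
  { assert (D1 := top_speed_spec x). assert (D2 := jw_dde W x).
    eapply der_eq; [eauto 12 with der|cbv beta; ring]. }
  assert (D' : is_derive (fun x => 2 * (Rc - e x)) x (- 2 * de x)).
  { assert (D2 := jw_de W x).
    eapply der_eq; [eauto 12 with der|cbv beta; ring]. }
  rewrite <- (is_derive_unique _ _ _ D), <- (is_derive_unique _ _ _ D').
  apply Derive_ext, wave_speed_squared.
Qed.

Definition rho (x : R) : R :=
  1 + lam ^ 2 * jxy p x (e x) * jx p x (e x) + jyy p x (e x) * jy p x (e x).

(** Second derivatives of [psi] are eliminated: the tangential derivative of the slope relation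
    gives [jxx + jxy * de], and the equation, carried up to the surface, replaces [jyy]. *)
Lemma rho_top_speed x :
  rho x = 1 - a * top_speed x
    + lam ^ 2 * top_speed x * (dde x * top_speed x + de x * top_speed_derive x).
Proof.
  assert (D : is_derive (fun z => jx p z (e z)) x (jxx p x (e x) + jxy p x (e x) * de x)).
  { apply (der_surface (jx p) (jxx p) (jxy p)); auto with der cont; apply W. }
  assert (D' : is_derive (fun z => - de z * top_speed z) x
    (- (dde x * top_speed x + de x * top_speed_derive x))).
  { assert (D1 := top_speed_spec x). assert (D2 := jw_dde W x).
    eapply der_eq; [eauto 12 with der|cbv beta; ring]. }
  assert (E : jxx p x (e x) + jxy p x (e x) * de x
     = - (dde x * top_speed x + de x * top_speed_derive x)).
  { rewrite <- (is_derive_unique _ _ _ D), <- (is_derive_unique _ _ _ D').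
    apply Derive_ext, wave_top_slope. }
  assert (L : lap lam p x (e x) + a = 0).
  { apply (continuous_zero_right (fun y => lap lam p x y + a)); [apply W| |].
    - apply C0_plus; [apply C0_slice_r; intros; apply lap_cont|cont].
    - intros y Hy; rewrite (jw_eq W x Hy); ring. }
  unfold lap in L.
  replace (dde x * top_speed x + de x * top_speed_derive x)
    with (- (jxx p x (e x) + jxy p x (e x) * de x)) by lra.
  unfold rho; rewrite wave_top_slope; unfold top_speed.
  replace (jyy p x (e x)) with (- a - lam ^ 2 * jxx p x (e x)) by lra; ring.
Qed.

Unset Implicit Arguments.

(* Green's identity between a wave of parameter [k lam0], stretched vertically by [k],
   and a function [w]: the stretched wave solves an equation of parameter [lam0]. *)
Lemma wave_green (lam0 k C : R) (w : jet) : 0 < per -> 0 < lam0 -> lam = k * lam0 ->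
  periodic2 per (j0 w) -> (forall x, j0 w x 0 = 0) ->
  (forall x y, 0 <= y <= e x -> Rabs (j0 p x y) <= C) ->
  let h := fun x => k * e x in
  Rabs (integral (fun x => flux lam0 h (fun x => k * de x) w x
     - top_speed x * (1 + lam ^ 2 * de x ^ 2) / k * trace h w x
     - a / k ^ 2 * integral (j0 w x) 0 (h x)) 0 per)
  <= C * integral (fun x => integral (fun y => Rabs (lap lam0 w x y)) 0 (h x)) 0 per.
Proof.
  intros Hper Hlam0 Hlam pw w0 HC h.
  assert (Hk : 0 < k).
  { generalize (jw_lam W); rewrite Hlam; intros; nra. }
  set (u := jet_stretch (/ k) p).
  assert (Hh : forall x, is_derive h x (k * de x)).
  { intros x; assert (D := jw_de W x).
    eapply der_eq; [unfold h; eauto with der|cbv beta; ring]. }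
  assert (ch : C0 h) by (apply (C0_derive _ _ Hh)).
  assert (cd : C0 (fun x => k * de x)) by (generalize wave_de_cont; cont).
  assert (Ek : forall x, / k * h x = e x) by (intros; unfold h; field; lra).
  assert (G := green per lam0 h (fun x => k * de x) Hh cd
    ltac:(intros; unfold h; now rewrite (jw_e_per W)) u w 0
    (fun x y => jw_p_per W x (/ k * y)) pw
    ltac:(intros; simpl; rewrite Rmult_0_r; apply W) w0).
  rewrite Rplus_0_l in G.
  rewrite (integral_ext (fun x => trace h u x * flux lam0 h (fun x => k * de x) w x
      - trace h w x * flux lam0 h (fun x => k * de x) u x)
    (fun x => flux lam0 h (fun x => k * de x) w x
     - top_speed x * (1 + lam ^ 2 * de x ^ 2) / k * trace h w x)) in G.
  (* On its own surface the stretched wave has trace 1 and flux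
     [top_speed * (1 + lam^2 de^2) / k]. *)
  2: { intros x; unfold u, trace at 1, flux at 2; simpl; rewrite Ek.
       rewrite (jw_top W), wave_top_slope.
       fold (top_speed x); rewrite Hlam; field; lra. }
  assert (cI : C0 (fun x => integral (j0 w x) 0 (h x))).
  { apply C0_integral_param; cont. }
  assert (cA : C0 (fun x => integral (fun y => Rabs (lap lam0 w x y)) 0 (h x))).
  { apply (C0_integral_param (fun x y => Rabs (lap lam0 w x y))); trivial.
    intros; apply (continuity_2d_pt_comp1 Rabs); [apply continuous_Rabs|apply lap_cont]. }
  assert (cL : C0 (fun x => integral (fun y => j0 u x y * lap lam0 w x y) 0 (h x))).
  { apply (C0_integral_param (fun x y => j0 u x y * lap lam0 w x y)); trivial.
    intros; apply continuity_2d_pt_mult; [apply j0_cont|apply lap_cont]. }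
  assert (cF : C0 (fun x => flux lam0 h (fun x => k * de x) w x
     - top_speed x * (1 + lam ^ 2 * de x ^ 2) / k * trace h w x)).
  { assert (c1 := wave_de_cont). assert (c2 := top_speed_cont).
    apply C0_minus; [now apply (flux_cont lam0 h (fun x => k * de x) Hh)|].
    apply C0_mult; [|apply (trace_cont h (fun x => k * de x)); auto].
    apply C0_mult; cont. }
  rewrite (integral_ext (fun x => integral (fun y => _) 0 (h x))
    (fun x => integral (fun y => j0 u x y * lap lam0 w x y) 0 (h x)
       + a / k ^ 2 * integral (j0 w x) 0 (h x))) in G.
  2: { intros x; rewrite <- integral_scal by (apply C0_slice_r; cont).
       rewrite <- integral_plus.
       - apply integral_ext_open; [left; unfold h; apply Rmult_lt_0_compat; [trivial|apply W]|].
         intros y Hy.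
         assert (Hy2 : 0 < / k * y < e x).
         { rewrite <- Ek; split; [apply Rmult_lt_0_compat; [now apply Rinv_0_lt_compat|lra]|].
           apply Rmult_lt_compat_l; [now apply Rinv_0_lt_compat|lra]. }
         assert (E := jw_eq W x Hy2); unfold lap in E.
         (* As [lam = k * lam0], applying [lap lam0] to the stretched wave gives [k^-2] times
            [lap lam p] at the height [y / k]. *)
         replace (lap lam0 u x y) with (- a / k ^ 2); [field; lra|].
         unfold lap, u; simpl; rewrite <- E, Hlam; field; lra.
       - apply (C0_slice_r (fun x y => j0 u x y * lap lam0 w x y)).
         intros; apply continuity_2d_pt_mult; [apply j0_cont|apply lap_cont].
       - apply C0_mult; [cont|apply C0_slice_r; cont]. }
  rewrite integral_minus by cont.
  rewrite G, integral_plus, integral_scal by cont.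
  match goal with |- Rabs ?z <= _ => replace z with
    (integral (fun x => integral (fun y => j0 u x y * lap lam0 w x y) 0 (h x)) 0 per) by ring end.
  rewrite <- integral_scal by trivial.
  apply integral_bound; cont; [lra|].
  intros x.
  assert (Hhx : 0 <= h x) by (left; unfold h; apply Rmult_lt_0_compat; [trivial|apply W]).
  assert (cS : C0 (fun y => Rabs (lap lam0 w x y))).
  { apply C0_abs, C0_slice_r; intros; apply lap_cont. }
  assert (cU : C0 (fun y => j0 u x y * lap lam0 w x y)).
  { apply C0_mult; apply C0_slice_r; intros; [apply j0_cont|apply lap_cont]. }
  rewrite <- integral_scal by trivial.
  apply Rabs_le; rewrite <- integral_opp by cont.
  assert (B : forall y, 0 < y < h x ->
    Rabs (j0 u x y * lap lam0 w x y) <= C * Rabs (lap lam0 w x y)).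
  { intros y Hy; rewrite Rabs_mult; apply Rmult_le_compat_r; [apply Rabs_pos|].
    unfold u; simpl; apply HC; rewrite <- Ek.
    assert (0 < / k) by now apply Rinv_0_lt_compat.
    split; [apply Rmult_le_pos; lra|apply Rmult_le_compat_l; lra]. }
  split; (apply RInt_le; [trivial|apply C0_ex_RInt; cont..|]);
    intros y Hy; specialize (B y Hy); apply Rabs_le_between in B; lra.
Qed.

End Wave.

(** * Variation along the branch *)

Lemma continuity_2d_pt_integral (f : R -> R -> R) (x y : R) :
  (C02 f) ->
  continuity_2d_pt (fun x y => integral (f x) 0 y) x y.
Proof.
  intros Hf eps.
  assert (Hfx : forall x, C0 (f x)) by (intros; now apply C0_slice_r).
  assert (Hc : continuity_pt (fun x => integral (f x) 0 y) x).
  { apply C0_pt, (C0_integral_param f (fun _ => y)); cont. }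
  destruct (proj1 (continuity_pt_locally _ _) Hc (mkposreal _ (is_pos_div_2 eps))) as [d1 Hd1].
  destruct (Hf x y (mkposreal 1 Rlt_0_1)) as [d2 Hd2]; simpl in Hd1, Hd2.
  set (B := Rabs (f x y) + 1).
  assert (HB : 0 < B) by (unfold B; generalize (Rabs_pos (f x y)); lra).
  assert (Hd3 : 0 < eps / 2 / B).
  { apply Rdiv_lt_0_compat; [generalize (cond_pos eps); lra|trivial]. }
  assert (Hd : 0 < Rmin d1 (Rmin d2 (eps / 2 / B))).
  { repeat apply Rmin_glb_lt; trivial; apply cond_pos. }
  exists (mkposreal _ Hd); simpl; intros u v Hu Hv.
  rmin_bounds.
  replace (integral (f u) 0 v - integral (f x) 0 y)
    with ((integral (f u) 0 v - integral (f u) 0 y)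
       + (integral (f u) 0 y - integral (f x) 0 y)) by ring.
  eapply Rle_lt_trans; [apply Rabs_triang|].
  assert (A1 : Rabs (integral (f u) 0 y - integral (f x) 0 y) < eps / 2).
  { apply Hd1; change (Rabs (u - x) < d1); lra. }
  assert (A2 : Rabs (integral (f u) 0 v - integral (f u) 0 y) <= B * Rabs (v - y)).
  { destruct (MVT_gen (integral (f u) 0) y v (f u)) as (z & Hz & E).
    - intros; now apply integral_derive_point.
    - intros; apply C0_pt, (C0_derive _ (f u)); intros; now apply integral_derive_point.
    - rewrite E, Rabs_mult; apply Rmult_le_compat_r; [apply Rabs_pos|].
      assert (Hzy : Rabs (z - y) < d2).
      { apply (Rle_lt_trans _ (Rabs (v - y))); [|lra].
        unfold Rmin, Rmax in Hz; destruct (Rle_dec y v); unfold Rabs;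
          destruct (Rcase_abs (z - y)), (Rcase_abs (v - y)); lra. }
      specialize (Hd2 u z ltac:(lra) Hzy).
      unfold B; replace (f u z) with (f x y + (f u z - f x y)) by ring.
      eapply Rle_trans; [apply Rabs_triang|lra]. }
  assert (A3 : B * Rabs (v - y) < eps / 2).
  { replace (eps / 2) with (B * (eps / 2 / B)) by (field; lra).
    apply Rmult_lt_compat_l; lra. }
  lra.
Qed.

(** A bound by a function with a double zero becomes an equality at first order. The area integral
    of Green's formula is therefore only estimated, never differentiated. *)
Lemma derive_zero_of_dominated (K Y : R -> R) (t0 l C : R) :
  is_derive K t0 l -> is_derive Y t0 0 -> Y t0 = 0 ->
  locally t0 (fun t => Rabs (K t) <= C * Y t) -> l = 0.
Proof.
  intros HK HY Y0 Hloc.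
  assert (K0 : K t0 = 0).
  { assert (A := locally_singleton _ _ Hloc); simpl in A; rewrite Y0, Rmult_0_r in A.
    destruct (Req_dec (K t0) 0) as [|Hn]; trivial; apply Rabs_pos_lt in Hn; lra. }
  assert (D : is_derive K t0 0); [|now rewrite <- (is_derive_unique _ _ _ HK), (is_derive_unique _ _ _ D)].
  apply is_derive_Reals in HY; apply is_derive_Reals; intros eps Heps.
  assert (HC : 0 < Rabs C + 1) by (generalize (Rabs_pos C); lra).
  destruct (HY (eps / (Rabs C + 1)) ltac:(now apply Rdiv_lt_0_compat)) as [d1 Hd1].
  destruct Hloc as [d2 Hd2].
  assert (Hd : 0 < Rmin d1 d2) by (apply Rmin_glb_lt; apply cond_pos).
  exists (mkposreal _ Hd); simpl; intros h Hh Hlt.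
  rmin_bounds.
  specialize (Hd1 h Hh ltac:(lra)).
  assert (B : Rabs (K (t0 + h)) <= C * Y (t0 + h)).
  { apply Hd2; change (Rabs (t0 + h - t0) < d2).
    replace (t0 + h - t0) with h by ring; lra. }
  rewrite K0, !Rminus_0_r in *; rewrite Y0, Rminus_0_r in Hd1.
  assert (Hah : 0 < Rabs h) by now apply Rabs_pos_lt.
  unfold Rdiv in *; rewrite Rabs_mult, Rabs_inv in Hd1 |- *.
  apply (Rmult_lt_reg_r (Rabs h)); trivial.
  apply (Rmult_lt_compat_r (Rabs h)) in Hd1; trivial.
  rewrite Rmult_assoc, Rinv_l, Rmult_1_r in Hd1 |- * by lra.
  apply (Rmult_lt_compat_r (Rabs C + 1)) in Hd1; trivial.
  replace (eps * / (Rabs C + 1) * Rabs h * (Rabs C + 1)) with (eps * Rabs h) in Hd1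
    by (field; lra).
  generalize (Rle_abs (C * Y (t0 + h))), (Rabs_pos (Y (t0 + h))); rewrite Rabs_mult; nra.
Qed.

Section Variation.
Variables (a Rc per t0 : R) (e0 e1 d0 d1 : R -> R -> R) (lam dlam : R -> R) (s C : R).
Variables (r0 : posreal) (w : jet).
(** A two-sided neighbourhood: the branch is differentiated at an interior parameter. *)
Let nearby (t : R) : Prop := Rabs (t - t0) < r0.
Hypothesis per_pos : 0 < per.
Hypothesis s_square : s * s = 1.
Hypothesis e0_t : forall t x, nearby t -> is_derive (fun u => e0 u x) t (d0 t x).
Hypothesis e1_t : forall t x, nearby t -> is_derive (fun u => e1 u x) t (d1 t x).
Hypothesis e0_c : forall t x, nearby t -> continuity_2d_pt e0 t x.
Hypothesis e1_c : forall t x, nearby t -> continuity_2d_pt e1 t x.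
Hypothesis d0_c : forall t x, nearby t -> continuity_2d_pt d0 t x.
Hypothesis d1_c : forall t x, nearby t -> continuity_2d_pt d1 t x.
Hypothesis lam_t : forall t, nearby t -> is_derive lam t (dlam t).
Hypothesis dlam_c : forall t, nearby t -> continuous dlam t.
Hypothesis waves : forall t, nearby t -> exists p dde,
  jet_wave a Rc per p (e0 t) (e1 t) dde (lam t) /\
  (forall x, 0 < s * top_speed p (e0 t) x) /\
  (forall x y, 0 <= y <= e0 t x -> Rabs (j0 p x y) <= C).
Hypothesis w_per : periodic2 per (j0 w).
Hypothesis w_bottom : forall x, j0 w x 0 = 0.
Hypothesis w_harm : forall x y, 0 < y < e0 t0 x -> lap (lam t0) w x y = 0.

Let k (t : R) : R := lam t / lam t0.
Let ik (t : R) : R := / k t.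
Let dk (t : R) : R := dlam t / lam t0.
Let dik (t : R) : R := - (dk t * ik t ^ 2).
Let h (t x : R) : R := k t * e0 t x.
Let z (t x : R) : R := dk t * e0 t x + k t * d0 t x.
(** By Bernoulli's law this is the square of [top_speed * (1 + lam^2 e1^2)]. With the sign [s] of
    the speed, [s * sqrt (Q t x)] expresses the flux of the wave through the surface alone, and so
    can be differentiated in [t]. *)
Let Q (t x : R) : R := 2 * (Rc - e0 t x) * (1 + lam t ^ 2 * e1 t x ^ 2).
Let dQ (t x : R) : R := - 2 * d0 t x * (1 + lam t ^ 2 * e1 t x ^ 2)
  + 2 * (Rc - e0 t x) * (2 * lam t * dlam t * e1 t x ^ 2 + lam t ^ 2 * (2 * e1 t x * d1 t x)).
Let F (t x : R) : R := jy w x (h t x) - lam t0 ^ 2 * (k t * e1 t x) * jx w x (h t x)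
  - s * sqrt (Q t x) * ik t * j0 w x (h t x) - a * ik t ^ 2 * integral (j0 w x) 0 (h t x).
Let dF (t x : R) : R := jyy w x (h t x) * z t x
  - (lam t0 ^ 2 * (dk t * e1 t x + k t * d1 t x) * jx w x (h t x)
     + lam t0 ^ 2 * (k t * e1 t x) * (jxy w x (h t x) * z t x))
  - ((s * (dQ t x / (2 * sqrt (Q t x))) * ik t + s * sqrt (Q t x) * dik t) * j0 w x (h t x)
     + s * sqrt (Q t x) * ik t * (jy w x (h t x) * z t x))
  - (a * (2 * ik t * dik t) * integral (j0 w x) 0 (h t x)
     + a * ik t ^ 2 * (j0 w x (h t x) * z t x)).

Lemma nearby_t0 : nearby t0.
Proof. unfold nearby; rewrite Rminus_diag, Rabs_R0; apply cond_pos. Qed.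

Lemma locally_nearby (P : R -> Prop) : (forall t, nearby t -> P t) -> locally t0 P.
Proof. intros H; exists r0; intros t Ht; apply H, Ht. Qed.

Lemma lam_pos t : nearby t -> 0 < lam t.
Proof. intros Ht; destruct (waves t Ht) as (p & dde & W & _); apply W. Qed.

Lemma k_pos t : nearby t -> 0 < k t.
Proof. intros Ht; apply Rdiv_lt_0_compat; apply lam_pos; trivial; apply nearby_t0. Qed.

Lemma Q_speed t x p dde : jet_wave a Rc per p (e0 t) (e1 t) dde (lam t) ->
  0 < s * top_speed p (e0 t) x ->
  0 < Q t x /\ s * sqrt (Q t x) = top_speed p (e0 t) x * (1 + lam t ^ 2 * e1 t x ^ 2).
Proof.
  intros W Hs.
  assert (HT : 0 < 1 + lam t ^ 2 * e1 t x ^ 2).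
  { generalize (pow2_ge_0 (lam t)), (pow2_ge_0 (e1 t x)); intros; nra. }
  assert (Hsq : 0 < s * (top_speed p (e0 t) x * (1 + lam t ^ 2 * e1 t x ^ 2))).
  { rewrite <- Rmult_assoc; now apply Rmult_lt_0_compat. }
  assert (E : Q t x = (s * (top_speed p (e0 t) x * (1 + lam t ^ 2 * e1 t x ^ 2))) ^ 2).
  { unfold Q; rewrite <- (wave_speed_squared W).
    replace ((s * (top_speed p (e0 t) x * (1 + lam t ^ 2 * e1 t x ^ 2))) ^ 2) with
      (s * s * (top_speed p (e0 t) x * (1 + lam t ^ 2 * e1 t x ^ 2)) ^ 2) by ring.
    rewrite s_square; ring. }
  split; [rewrite E; now apply pow_lt|].
  rewrite E, sqrt_pow2 by lra; rewrite <- Rmult_assoc, s_square; ring.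
Qed.

Lemma Q_pos t x : nearby t -> 0 < Q t x.
Proof.
  intros Ht; destruct (waves t Ht) as (p & dde & W & Hs & _); now apply (Q_speed t x p dde).
Qed.

Lemma k_t t : nearby t -> is_derive k t (dk t).
Proof.
  intros Ht; assert (H := lam_t t Ht).
  eapply der_eq; [unfold k, Rdiv; eauto with der|unfold dk; field].
  apply Rgt_not_eq, lam_pos, nearby_t0.
Qed.

Lemma ik_t t : nearby t -> is_derive ik t (dik t).
Proof.
  intros Ht; assert (Hk := k_pos t Ht).
  eapply der_eq; [exact (is_derive_inv k t (dk t) (k_t t Ht) ltac:(lra))|].
  unfold dik, ik; field; lra.
Qed.

Lemma h_t t x : nearby t -> is_derive (fun u => h u x) t (z t x).
Proof.
  intros Ht; apply (der_mult k (fun u => e0 u x)); [now apply k_t|now apply e0_t].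
Qed.

Lemma Q_t t x : nearby t -> is_derive (fun u => Q u x) t (dQ t x).
Proof.
  intros Ht; assert (H0 := e0_t t x Ht). assert (H1 := e1_t t x Ht). assert (H2 := lam_t t Ht).
  eapply der_eq; [unfold Q; eauto 12 with der|unfold dQ; cbv beta; ring].
Qed.

Lemma F_t t x : nearby t -> is_derive (fun u => F u x) t (dF t x).
Proof.
  intros Ht; assert (Hh := h_t t x Ht). assert (Hk := k_t t Ht). assert (Hi := ik_t t Ht).
  assert (H1 := e1_t t x Ht).
  assert (HQ := is_derive_sqrt _ _ _ (Q_t t x Ht) (Q_pos t x Ht)).
  assert (Dy := der_comp (jy w x) (fun u => h u x) t _ _ (jyy_spec w x (h t x)) Hh).
  assert (Dx := der_comp (jx w x) (fun u => h u x) t _ _ (jxy_spec w x (h t x)) Hh).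
  assert (D0 := der_comp (j0 w x) (fun u => h u x) t _ _ (jy_spec w x (h t x)) Hh).
  assert (DI := der_comp (integral (j0 w x) 0) (fun u => h u x) t _ _
    (integral_derive_point (j0 w x) 0 (h t x) (C0_slice_r _ x (j0_cont w))) Hh).
  assert (Di := der_pow2 _ _ _ Hi).
  apply (der_minus (fun u => jy w x (h u x) - lam t0 ^ 2 * (k u * e1 u x) * jx w x (h u x)
      - s * sqrt (Q u x) * ik u * j0 w x (h u x))
    (fun u => a * ik u ^ 2 * integral (j0 w x) 0 (h u x))).
  1: apply (der_minus (fun u => jy w x (h u x) - lam t0 ^ 2 * (k u * e1 u x) * jx w x (h u x))
    (fun u => s * sqrt (Q u x) * ik u * j0 w x (h u x))).
  1: apply (der_minus (fun u => jy w x (h u x))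
    (fun u => lam t0 ^ 2 * (k u * e1 u x) * jx w x (h u x))).
  - exact Dy.
  - apply (der_mult (fun u => lam t0 ^ 2 * (k u * e1 u x)) (fun u => jx w x (h u x)));
      [|exact Dx].
    eapply der_eq.
    + apply (der_mult (fun _ => lam t0 ^ 2)); [apply der_const|].
      apply (der_mult k (fun u => e1 u x)); eassumption.
    + cbv beta; ring.
  - apply (der_mult (fun u => s * sqrt (Q u x) * ik u) (fun u => j0 w x (h u x))); [|exact D0].
    eapply der_eq.
    + apply (der_mult (fun u => s * sqrt (Q u x)) ik); [|exact Hi].
      apply (der_mult (fun _ => s)); [apply der_const|exact HQ].
    + cbv beta; ring.
  - apply (der_mult (fun u => a * ik u ^ 2) (fun u => integral (j0 w x) 0 (h u x)));
      [|exact DI].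
    eapply der_eq; [apply (der_mult (fun _ => a)); [apply der_const|exact Di]|].
    cbv beta; ring.
Qed.

Lemma of_t_cont (f : R -> R) t x : continuous f t -> continuity_2d_pt (fun t _ => f t) t x.
Proof. intros H; apply (continuity_2d_pt_comp1 f (fun u _ => u)); cont. Qed.

Lemma lam_cont t : nearby t -> continuous lam t.
Proof. intros Ht; apply (ex_derive_continuous lam); exists (dlam t); now apply lam_t. Qed.

Lemma k_cont t : nearby t -> continuous k t.
Proof. intros Ht; apply (ex_derive_continuous k); exists (dk t); now apply k_t. Qed.

Lemma ik_cont t : nearby t -> continuous ik t.
Proof. intros Ht; apply (ex_derive_continuous ik); exists (dik t); now apply ik_t. Qed.

Lemma dk_cont2 t x : nearby t -> continuity_2d_pt (fun t _ => dk t) t x.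
Proof.
  intros Ht; unfold dk, Rdiv; apply continuity_2d_pt_mult; [|apply continuity_2d_pt_const].
  apply of_t_cont, dlam_c, Ht.
Qed.

Lemma h_cont t x : nearby t -> continuity_2d_pt h t x.
Proof.
  intros Ht; apply continuity_2d_pt_mult; [apply of_t_cont, k_cont, Ht|now apply e0_c].
Qed.

Lemma at_surface_cont (f : R -> R -> R) t x : (C02 f) ->
  nearby t -> continuity_2d_pt (fun t x => f x (h t x)) t x.
Proof.
  intros Hf Ht; apply (continuity_2d_pt_comp2 f (fun _ x => x) h); cont.
  now apply h_cont.
Qed.

Lemma sqrtQ_cont t x : nearby t -> continuity_2d_pt (fun t x => sqrt (Q t x)) t x.
Proof.
  intros Ht; apply (continuity_2d_pt_comp1 sqrt Q); [apply continuous_sqrt|].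
  assert (H1 := of_t_cont lam t x (lam_cont t Ht)).
  assert (H2 := e0_c t x Ht). assert (H3 := e1_c t x Ht).
  unfold Q; cont.
Qed.

Lemma z_cont t x : nearby t -> continuity_2d_pt z t x.
Proof.
  intros Ht; assert (K1 := dk_cont2 t x Ht). assert (K2 := of_t_cont k t x (k_cont t Ht)).
  assert (K3 := e0_c t x Ht). assert (K4 := d0_c t x Ht).
  unfold z; cont.
Qed.

Lemma F_cont t x : nearby t -> continuity_2d_pt F t x.
Proof.
  intros Ht.
  assert (K2 := of_t_cont k t x (k_cont t Ht)). assert (K3 := of_t_cont ik t x (ik_cont t Ht)).
  assert (K4 := e1_c t x Ht). assert (K5 := sqrtQ_cont t x Ht).
  assert (K6 := at_surface_cont _ t x (j0_cont w) Ht).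
  assert (K7 := at_surface_cont _ t x (jx_cont w) Ht).
  assert (K8 := at_surface_cont _ t x (jy_cont w) Ht).
  assert (K9 := at_surface_cont (fun x y => integral (j0 w x) 0 y) t x
    (fun x y => continuity_2d_pt_integral _ x y (j0_cont w)) Ht).
  unfold F; cont.
Qed.

Lemma dF_cont t x : nearby t -> continuity_2d_pt dF t x.
Proof.
  intros Ht.
  assert (K1 := dk_cont2 t x Ht).
  assert (K2 := of_t_cont k t x (k_cont t Ht)). assert (K3 := of_t_cont ik t x (ik_cont t Ht)).
  assert (K4 := e1_c t x Ht). assert (K5 := sqrtQ_cont t x Ht).
  assert (K6 := at_surface_cont _ t x (j0_cont w) Ht).
  assert (K7 := at_surface_cont _ t x (jx_cont w) Ht).
  assert (K8 := at_surface_cont _ t x (jy_cont w) Ht).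
  assert (K9 := at_surface_cont _ t x (jxy_cont w) Ht).
  assert (K10 := at_surface_cont _ t x (jyy_cont w) Ht).
  assert (K11 := at_surface_cont (fun x y => integral (j0 w x) 0 y) t x
    (fun x y => continuity_2d_pt_integral _ x y (j0_cont w)) Ht).
  assert (K12 := z_cont t x Ht).
  assert (K13 := of_t_cont lam t x (lam_cont t Ht)).
  assert (K14 := of_t_cont dlam t x (dlam_c t Ht)).
  assert (K15 := e0_c t x Ht). assert (K16 := d0_c t x Ht). assert (K17 := d1_c t x Ht).
  assert (K18 : continuity_2d_pt dQ t x) by (unfold dQ; cont).
  assert (K19 : continuity_2d_pt (fun t _ => dik t) t x) by (unfold dik; cont).
  assert (K20 : continuity_2d_pt (fun t x => dQ t x / (2 * sqrt (Q t x))) t x).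
  { apply continuity_2d_pt_mult; trivial; apply continuity_2d_pt_inv; cont.
    generalize (sqrt_lt_R0 _ (Q_pos t x Ht)); lra. }
  unfold dF.
  apply continuity_2d_pt_minus; [apply continuity_2d_pt_minus; [apply continuity_2d_pt_minus|]|];
    cont.
Qed.

Lemma slice_cont (G : R -> R -> R) t : (forall x, continuity_2d_pt G t x) -> C0 (G t).
Proof.
  intros H; apply (C0_comp_2d G (fun _ => t) (fun x => x)); cont.
Qed.

(** The integral of [F t] is bounded by [C * Y t], where [Y] integrates the modulus of [lap w] over
    the stretched domain. [Y] vanishes at [t0] together with its derivative. *)
Lemma variation_zero : integral (dF t0) 0 per = 0.
Proof.
  set (Y := fun t => integral (fun x => integral (fun y => Rabs (lap (lam t0) w x y)) 0 (h t x)) 0 per).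
  assert (cL : forall x y, continuity_2d_pt (fun x y => Rabs (lap (lam t0) w x y)) x y).
  { intros; apply (continuity_2d_pt_comp1 Rabs); [apply continuous_Rabs|apply lap_cont]. }
  assert (h0 : forall x, h t0 x = e0 t0 x).
  { intros; unfold h, k; field; apply Rgt_not_eq, lam_pos, nearby_t0. }
  destruct (waves t0 nearby_t0) as (p0 & dde0 & W0 & _).
  apply (derive_zero_of_dominated (fun t => integral (F t) 0 per) Y t0 _ C).
  - apply is_derive_RInt_param_explicit.
    + apply locally_nearby; intros t Ht x; now apply F_t.
    + intros x; apply dF_cont, nearby_t0.
    + apply locally_nearby; intros t Ht; apply slice_cont; intros; now apply F_cont.
  - eapply der_eq.
    + apply (is_derive_RInt_param_explicit
        (fun t x => integral (fun y => Rabs (lap (lam t0) w x y)) 0 (h t x))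
        (fun t x => Rabs (lap (lam t0) w x (h t x)) * z t x)).
      * apply locally_nearby; intros t Ht x.
        apply (der_comp (integral (fun y => Rabs (lap (lam t0) w x y)) 0) (fun u => h u x)).
        -- apply (integral_derive_point (fun y => Rabs (lap (lam t0) w x y))).
           now apply (C0_slice_r (fun x y => Rabs (lap (lam t0) w x y))).
        -- now apply h_t.
      * intros x; apply continuity_2d_pt_mult; [|apply z_cont, nearby_t0].
        apply (at_surface_cont (fun x y => Rabs (lap (lam t0) w x y))); trivial; apply nearby_t0.
      * apply locally_nearby; intros t Ht.
        apply (slice_cont (fun t x => integral (fun y => Rabs (lap (lam t0) w x y)) 0 (h t x))).
        intros x; apply (at_surface_cont (fun x y => integral (fun y => Rabs (lap (lam t0) w x y)) 0 y));
          trivial.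
        intros; now apply (continuity_2d_pt_integral (fun x y => Rabs (lap (lam t0) w x y))).
    (* The derivative of [Y] only sees [lap w] on the surface, where it vanishes by continuity,
       whatever the extension of [w] does above. *)
    + rewrite integral_zero; [ring|].
      intros x; rewrite h0, (lap_surface (lam t0) (e0 t0) w (jw_pos W0) w_harm).
      rewrite Rabs_R0; ring.
  - unfold Y; rewrite integral_zero; [ring|].
    intros x; rewrite (integral_ext_open _ (fun _ => 0)); [rewrite integral_const; ring| |].
    + rewrite h0; left; apply W0.
    + intros y Hy; rewrite h0 in Hy; rewrite w_harm by trivial; apply Rabs_R0.
  - apply locally_nearby; intros t Ht; destruct (waves t Ht) as (p & dde & W & Hs & HC).
    assert (Hl : lam t = k t * lam t0).
    { unfold k; field; apply Rgt_not_eq, lam_pos, nearby_t0. }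
    assert (G := wave_green _ _ _ _ _ _ _ _ W (lam t0) (k t) C w per_pos
      (lam_pos t0 nearby_t0) Hl w_per w_bottom HC).
    unfold Y; eapply Rle_trans; [right|exact G].
    f_equal; apply integral_ext; intros x; unfold F, flux, trace.
    destruct (Q_speed t x p dde W (Hs x)) as [_ ->].
    assert (Hk := k_pos t Ht); fold (h t x); unfold ik; field; lra.
Qed.

(** * The exact identity in terms of traces at [t0] *)

Variables (p : jet) (dde b : R -> R) (mu : R).
Hypothesis W : jet_wave a Rc per p (e0 t0) (e1 t0) dde (lam t0).
Hypothesis p_sign : forall x, 0 < s * top_speed p (e0 t0) x.
Hypothesis d0_x : forall x, is_derive (d0 t0) x (d1 t0 x).
Hypothesis d0_per : forall x, d0 t0 (x + per) = d0 t0 x.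
Hypothesis w_flux : forall x, flux (lam t0) (e0 t0) (e1 t0) w x = b x * trace (e0 t0) w x.
Hypothesis b_cont : C0 b.
Hypothesis b_spec : forall x,
  b x * top_speed p (e0 t0) x ^ 2 = rho p (e0 t0) (lam t0) x + mu.

Let L : R := dlam t0 / lam t0.
Let q : R -> R := top_speed p (e0 t0).
Let dq : R -> R := top_speed_derive p (e0 t0) (e1 t0).
Let g : R -> R := trace (e0 t0) w.
Let wx (x : R) : R := jx w x (e0 t0 x).
Let dg (x : R) : R := jx w x (e0 t0 x) + jy w x (e0 t0 x) * e1 t0 x.

(* The terms free of [L] in the variation are [int (dF)] up to two total derivatives:
   of [lam^2 wx (L eta + d0)] and of [lam^2 eta' q d0 g]. *)
Lemma variation_identity :
  integral (fun x => mu * d0 t0 x * g x / q x + lam t0 * dlam t0 * (q x * e1 t0 x ^ 2) * g x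
    + L * (- (q x * (1 + lam t0 ^ 2 * e1 t0 x ^ 2)) * g x + q x * e0 t0 x * b x * g x
           + q x * lam t0 ^ 2 * e0 t0 x * e1 t0 x * dg x
           - a * e0 t0 x * g x + a * e0 t0 x ^ 2 * b x * g x)) 0 per = 0.
Proof.
  assert (Hlam := lam_pos t0 nearby_t0).
  assert (Hk : k t0 = 1) by (unfold k; field; lra).
  assert (Hik : ik t0 = 1) by (unfold ik; rewrite Hk; apply Rinv_1).
  assert (h0 : forall x, h t0 x = e0 t0 x) by (intros; unfold h; rewrite Hk; ring).
  assert (ce : C0 (e0 t0)) by exact (wave_e_cont W).
  assert (cde : C0 (e1 t0)) by exact (wave_de_cont W).
  assert (cdde := jw_dde_cont W).
  assert (cq : C0 q) by exact (top_speed_cont W).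
  assert (cdq : C0 dq) by exact (top_speed_derive_cont W).
  assert (cd0 : C0 (d0 t0)) by exact (C0_derive _ _ d0_x).
  assert (cd1 : C0 (d1 t0)) by (apply slice_cont; intros; apply d1_c, nearby_t0).
  assert (He := jw_de W). assert (Hde := jw_dde W).
  assert (cg : C0 g) by (apply (trace_cont (e0 t0) (e1 t0)); trivial).
  assert (Hg : forall x, is_derive g x (dg x)) by (intros; apply trace_derive; trivial).
  assert (cS : forall f, (C02 f) -> C0 (fun x => f x (e0 t0 x))).
  { intros f Hf; now apply C0_jet_surface. }
  assert (cwx : C0 wx) by (apply cS; cont).
  assert (cwy : C0 (fun x => jy w x (e0 t0 x))) by (apply cS; cont).
  assert (cdg : C0 dg) by (unfold dg; cont).
  assert (cI : C0 (fun x => integral (j0 w x) 0 (e0 t0 x))).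
  { apply C0_integral_param; cont. }
  assert (Hq : forall x, q x <> 0).
  { intros x E; generalize (p_sign x); fold q; rewrite E; lra. }
  assert (Hwx : forall x, is_derive wx x (jxx w x (e0 t0 x) + jxy w x (e0 t0 x) * e1 t0 x)).
  { intros; apply (der_surface (jx w) (jxx w) (jxy w)); auto with der cont. }
  assert (cwxx : C0 (fun x => jxx w x (e0 t0 x))) by (apply cS; cont).
  assert (cwxy : C0 (fun x => jxy w x (e0 t0 x))) by (apply cS; cont).
  assert (Hdq : forall x, is_derive q x (dq x)) by (intros; exact (top_speed_spec W x)).
  assert (pe := jw_e_per W). assert (pde := wave_de_per W).
  assert (pq : q (0 + per) = q 0).
  { unfold q, top_speed; rewrite pe; apply periodic_jy, W. }
  assert (pg : g (0 + per) = g 0) by (unfold g, trace; rewrite pe; apply w_per).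
  assert (pwx : wx (0 + per) = wx 0) by (unfold wx; rewrite pe; apply periodic_jx, w_per).
  rewrite Rplus_0_l in pq, pg, pwx.
  assert (pe' : e0 t0 per = e0 t0 0) by (rewrite <- (pe 0); f_equal; ring).
  assert (pde' : e1 t0 per = e1 t0 0) by (rewrite <- (pde 0); f_equal; ring).
  assert (pd' : d0 t0 per = d0 t0 0) by (rewrite <- (d0_per 0); f_equal; ring).
  set (T1 := fun x => - lam t0 ^ 2 * ((L * e1 t0 x + d1 t0 x) * wx x
    + (L * e0 t0 x + d0 t0 x) * (jxx w x (e0 t0 x) + jxy w x (e0 t0 x) * e1 t0 x))).
  assert (cT1 : C0 T1) by (unfold T1; cont).
  assert (I1 : integral T1 0 per = 0).
  { rewrite (integral_derive (fun x => - lam t0 ^ 2 * ((L * e0 t0 x + d0 t0 x) * wx x))); trivial.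
    - rewrite pe', pd', pwx; ring.
    - intros x; eapply der_eq.
      + apply der_mult; [apply der_const|apply der_mult; [|apply Hwx]].
        apply der_plus; [apply der_mult; [apply der_const|apply He]|apply d0_x].
      + unfold T1; cbv beta; ring. }
  set (T2 := fun x => lam t0 ^ 2 * ((dde x * q x + e1 t0 x * dq x) * d0 t0 x * g x
    + e1 t0 x * q x * (d1 t0 x * g x + d0 t0 x * dg x))).
  assert (cT2 : C0 T2) by (unfold T2; cont).
  assert (I2 : integral T2 0 per = 0).
  { rewrite (integral_derive (fun x => lam t0 ^ 2 * ((e1 t0 x * q x) * (d0 t0 x * g x)))); trivial.
    - rewrite pde', pd', pq, pg; ring.
    - intros x; eapply der_eq.
      + apply der_mult; [apply der_const|apply der_mult; apply der_mult; eauto].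
      + unfold T2; cbv beta; ring. }
  (* Green's formula against [y^2 / 2] expresses the area integral of [w] by traces. The factor
     [2 * a] matches the derivative of [a / k^2] in [dF]. *)
  set (T3 := fun x => (- (2 * a * e0 t0 x * g x) + a * e0 t0 x ^ 2 * b x * g x)
    + 2 * a * integral (j0 w x) 0 (e0 t0 x)).
  assert (cT3 : C0 T3) by (unfold T3; cont).
  assert (I3 : integral T3 0 per = 0).
  { assert (G := green_harmonic per (lam t0) (e0 t0) (e1 t0) He cde pe w
      (jw_pos W) w_per w_bottom w_harm jet_y2 0
      (fun _ _ => eq_refl) ltac:(intros; simpl; ring)).
    rewrite Rplus_0_l in G.
    rewrite (integral_ext (fun x => integral _ 0 (e0 t0 x))
      (fun x => - integral (j0 w x) 0 (e0 t0 x))) in G.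
    2: { intros x; rewrite <- integral_opp by (apply C0_slice_r; cont).
         apply integral_ext; intros y; unfold lap; simpl; ring. }
    rewrite integral_opp in G by trivial.
    rewrite (integral_ext _ (fun x => / 2 * e0 t0 x ^ 2 * (b x * g x) - g x * e0 t0 x)) in G.
    2: { intros x; rewrite w_flux; fold g; unfold flux, trace at 1; simpl; ring. }
    unfold T3.
    rewrite integral_plus, integral_scal by cont.
    rewrite (integral_ext (fun x => - (2 * a * e0 t0 x * g x) + _)
      (fun x => 2 * a * (/ 2 * e0 t0 x ^ 2 * (b x * g x) - g x * e0 t0 x))).
    2: { intros; field. }
    rewrite integral_scal by cont.
    rewrite G; ring. }
  assert (cdF : C0 (dF t0)) by (apply slice_cont; intros; apply dF_cont, nearby_t0).
  (* All four functions have integral zero, so what remains is a pointwise identity. *)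
  rewrite (integral_ext _ (fun x => (T1 x - dF t0 x - T2 x) + L * T3 x)).
  { rewrite integral_plus, !integral_minus, integral_scal, I1, I2, I3, variation_zero
      by cont; ring. }
  intros x.
  destruct (Q_speed t0 x p dde W (p_sign x)) as [HQ HsQ].
  assert (Hsq : 0 < sqrt (Q t0 x)) by now apply sqrt_lt_R0.
  assert (HsdQ : s * (dQ t0 x / (2 * sqrt (Q t0 x))) =
    - d0 t0 x / q x + q x * (lam t0 * dlam t0 * e1 t0 x ^ 2 + lam t0 ^ 2 * e1 t0 x * d1 t0 x)).
  { assert (HT : 0 < 1 + lam t0 ^ 2 * e1 t0 x ^ 2).
    { generalize (pow2_ge_0 (lam t0)), (pow2_ge_0 (e1 t0 x)); intros; nra. }
    replace (s * (dQ t0 x / (2 * sqrt (Q t0 x))))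
      with (s * s * dQ t0 x / (2 * (s * sqrt (Q t0 x)))).
    2: { field; split; [lra|]. intros E; rewrite E in s_square; lra. }
    rewrite s_square, HsQ; fold q; unfold dQ.
    rewrite <- (wave_speed_squared W x); fold q.
    set (Th := 1 + lam t0 ^ 2 * e1 t0 x ^ 2) in *; clearbody Th.
    field; split; [apply Hq|lra]. }
  assert (HL : jyy w x (e0 t0 x) = - lam t0 ^ 2 * jxx w x (e0 t0 x)).
  { generalize (lap_surface (lam t0) (e0 t0) w (jw_pos W) w_harm x).
    unfold lap; lra. }
  assert (Hwy : (1 + lam t0 ^ 2 * e1 t0 x ^ 2) * jy w x (e0 t0 x)
    = b x * g x + lam t0 ^ 2 * e1 t0 x * dg x).
  { unfold g; rewrite <- w_flux; unfold flux, dg; ring. }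
  (* The part [1 / q] cancels the [- d0 / q] that comes from differentiating Bernoulli's law and
     leaves [mu * d0 / q]. The last term is [lam^2] times the derivative of [e1 * q], which [T2]
     integrates away. *)
  assert (Hb : b x * q x = (1 + mu) / q x - a
    + lam t0 ^ 2 * (dde x * q x + e1 t0 x * dq x)).
  { generalize (b_spec x); rewrite (rho_top_speed W x); fold q; fold dq; intros E.
    apply (Rmult_eq_reg_r (q x)); [|apply Hq].
    replace (b x * q x * q x) with (b x * q x ^ 2) by ring; rewrite E.
    field; apply Hq. }
  unfold T1, T2, T3, dF; rewrite h0, HsdQ, HsQ, HL; fold q.
  change (j0 w x (e0 t0 x)) with (g x).
  unfold z, dik; rewrite Hk, Hik; fold L; change (dk t0) with L; fold (wx x).
  replace (q x * (1 + lam t0 ^ 2 * e1 t0 x ^ 2) * 1 *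
    (jy w x (e0 t0 x) * (L * e0 t0 x + 1 * d0 t0 x)))
    with (q x * (b x * g x + lam t0 ^ 2 * e1 t0 x * dg x) * (L * e0 t0 x + d0 t0 x))
    by (rewrite <- Hwy; ring).
  replace (q x * (b x * g x + lam t0 ^ 2 * e1 t0 x * dg x) * (L * e0 t0 x + d0 t0 x)) with
    (b x * q x * g x * d0 t0 x + q x * lam t0 ^ 2 * e1 t0 x * dg x * d0 t0 x
     + L * (q x * e0 t0 x * b x * g x + q x * lam t0 ^ 2 * e0 t0 x * e1 t0 x * dg x)) by ring.
  rewrite Hb; field; apply Hq.
Qed.

End Variation.

(** * Estimates for a Robin problem *)

Lemma periodic_Z (f : R -> R) (per : R) : (forall x, f (x + per) = f x) ->
  forall (n : Z) x, f (x + IZR n * per) = f x.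
Proof.
  intros Hp.
  assert (Hn : forall (n : nat) x, f (x + INR n * per) = f x).
  { induction n as [|n IH]; intros x.
    - simpl; f_equal; ring.
    - rewrite S_INR; replace (x + (INR n + 1) * per) with (x + INR n * per + per) by ring.
      now rewrite Hp. }
  intros n x; destruct (Z.le_gt_cases 0 n) as [H|H].
  - rewrite <- (Z2Nat.id n H), <- INR_IZR_INZ; apply Hn.
  - rewrite <- (Hn (Z.to_nat (- n))).
    rewrite INR_IZR_INZ, Z2Nat.id, opp_IZR by lia; f_equal; ring.
Qed.

Lemma periodic_reduce (f : R -> R) (per : R) : 0 < per -> (forall x, f (x + per) = f x) ->
  forall x, exists y, 0 <= y <= per /\ f y = f x.
Proof.
  intros Hper Hp x.
  destruct (archimed (x / per)) as [A1 A2].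
  exists (x + IZR (1 - up (x / per)) * per); split; [|now apply periodic_Z].
  rewrite minus_IZR.
  assert (E : x = x / per * per) by (field; lra).
  rewrite E at 1 3.
  replace (x / per * per + (1 - IZR (up (x / per))) * per)
    with ((x / per + 1 - IZR (up (x / per))) * per) by ring.
  split; [apply Rmult_le_pos; lra|].
  apply (Rle_trans _ (1 * per)); [apply Rmult_le_compat_r|]; lra.
Qed.

Lemma periodic_normalise (f : R -> R) (per : R) : 0 < per -> C0 f ->
  (forall x, f (x + per) = f x) -> (exists x, f x <> 0) ->
  exists c x0, 0 <= x0 <= per /\ c * f x0 = 1 /\ forall x, Rabs (c * f x) <= 1.
Proof.
  intros Hper Hf Hp [z Hz].
  destruct (continuity_ab_maj (fun x => Rabs (f x)) 0 per) as (x0 & Hmax & Hx0); [lra| |].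
  { intros; apply C0_pt; cont. }
  assert (Hall : forall x, Rabs (f x) <= Rabs (f x0)).
  { intros x; destruct (periodic_reduce f per Hper Hp x) as (y & Hy & <-); auto. }
  assert (H0 : 0 < Rabs (f x0)).
  { eapply Rlt_le_trans; [apply Rabs_pos_lt, Hz|apply Hall]. }
  assert (Hn : f x0 <> 0) by (intros E; rewrite E, Rabs_R0 in H0; lra).
  exists (/ f x0), x0; split; [trivial|]; split; [now apply Rinv_l|].
  intros x; rewrite Rabs_mult, Rabs_inv.
  apply (Rmult_le_reg_l (Rabs (f x0))); trivial.
  rewrite <- Rmult_assoc, Rinv_r, Rmult_1_l, Rmult_1_r by lra; apply Hall.
Qed.

Lemma integral_odd_periodic (f : R -> R) (per : R) : C0 f -> (forall x, f (x + per) = f x) ->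
  (forall x, f (- x) = - f x) -> integral f 0 per = 0.
Proof.
  intros Hf Hp Ho.
  assert (E := RInt_comp_lin f (-1) per 0 per (C0_ex_RInt _ _ _ Hf)).
  replace (-1 * 0 + per) with per in E by ring. replace (-1 * per + per) with 0 in E by ring.
  assert (E1 : integral (fun y => f y) 0 per = integral f per 0).
  { unfold integral; rewrite <- E; apply RInt_ext; intros x _.
    replace (-1 * x + per) with (- x + per) by ring; rewrite Hp, Ho.
    unfold scal; simpl; unfold mult; simpl; ring. }
  assert (E2 := integral_Chasles f 0 per 0 Hf).
  assert (E3 : integral f 0 0 = 0) by (unfold integral; apply (RInt_point 0 f)).
  rewrite <- E1 in E2; change (integral (fun y => f y) 0 per) with (integral f 0 per) in E2; lra.
Qed.

Section Robin.
Variables (per lam : R) (h dh : R -> R) (b : R -> R) (w : jet).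
Hypothesis per_pos : 0 < per.
Hypothesis h_der : forall x, is_derive h x (dh x).
Hypothesis dh_cont : C0 dh.
Hypothesis h_per : forall x, h (x + per) = h x.
Hypothesis h_pos : forall x, 0 < h x.
Hypothesis w_per : periodic2 per (j0 w).
Hypothesis w_bottom : forall x, j0 w x 0 = 0.
Hypothesis w_harm : forall x y, 0 < y < h x -> lap lam w x y = 0.
Hypothesis w_flux : forall x, flux lam h dh w x = b x * trace h w x.
Hypothesis w_norm : forall x, Rabs (trace h w x) <= 1.

Let g : R -> R := trace h w.

(** By Green's formula, [g] is orthogonal to the Robin defect [flux u - b * trace u] of any harmonic
    test function. If this defect is [al * m] up to [e], the pairing of [g] with [al * m] is an
    error term. *)
Lemma robin_test (u : jet) (m : R -> R) (al e : R) : C0 m -> C0 b ->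
  periodic2 per (j0 u) -> (forall x, j0 u x 0 = 0) ->
  (forall x y, lap lam u x y = 0) ->
  (forall x, Rabs (flux lam h dh u x - b x * trace h u x - al * m x) <= e) ->
  Rabs (al * integral (fun x => g x * m x) 0 per) <= e * per.
Proof.
  intros cm cb pu u0 Lu He.
  assert (G := green_harmonic per lam h dh h_der dh_cont h_per w h_pos w_per w_bottom w_harm
    u 0 pu u0).
  rewrite Rplus_0_l in G.
  rewrite (integral_ext (fun x => integral _ 0 (h x)) (fun _ => 0)), integral_const in G.
  2: { intros x; rewrite integral_zero; [ring|].
       intros; rewrite Lu; ring. }
  assert (cg : C0 g) by now apply (trace_cont h dh).
  assert (ctu : C0 (trace h u)) by now apply (trace_cont h dh).
  assert (cfu : C0 (flux lam h dh u)) by now apply flux_cont.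
  rewrite (integral_ext _ (fun x => - (g x * (flux lam h dh u x - b x * trace h u x - al * m x))
    - al * (g x * m x))) in G by (intros; rewrite w_flux; unfold g; ring).
  rewrite integral_minus, integral_opp, integral_scal in G by cont.
  replace (al * integral (fun x => g x * m x) 0 per) with
    (- integral (fun x => g x * (flux lam h dh u x - b x * trace h u x - al * m x)) 0 per) by lra.
  rewrite Rabs_Ropp.
  replace (e * per) with (integral (fun _ => e) 0 per) by (rewrite integral_const; ring).
  apply integral_bound; cont; [lra|].
  intros x; rewrite Rabs_mult.
  specialize (He x); specialize (w_norm x); fold (g x) in w_norm.
  rewrite <- (Rmult_1_l e); apply Rmult_le_compat; trivial; apply Rabs_pos.
Qed.

Definition slope (x : R) : R := jx w x (h x) + jy w x (h x) * dh x.

(* 18 = 16 + 2: the trace has slope [Th w_x + eta_x (flux)], with [Th <= 2] and [lam >= 1/2]. *)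
Lemma robin_slope (B : R) : C0 b -> / 2 <= lam -> (forall x, lam ^ 2 * dh x ^ 2 <= 1) ->
  (forall x, Rabs (dh x) <= 1) -> (forall x, Rabs (b x) <= B) ->
  forall al, integral (fun x => slope x ^ 2) al (al + per) <= 18 * B ^ 2 * per.
Proof.
  intros cb Hlam HTh Hdh HB al.
  assert (cw : C0 (fun x => jx w x (h x))).
  { apply C0_jet_surface; cont; now apply (C0_derive h dh). }
  assert (cwy : C0 (fun x => jy w x (h x))).
  { apply C0_jet_surface; cont; now apply (C0_derive h dh). }
  assert (cs : C0 slope) by (unfold slope; cont).
  assert (cf := flux_cont lam h dh h_der dh_cont w).
  assert (Hf2 : forall x, flux lam h dh w x ^ 2 <= B ^ 2).
  { intros x; rewrite w_flux, <- pow2_abs, Rabs_mult.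
    specialize (HB x); specialize (w_norm x).
    apply pow_incr; split; [apply Rmult_le_pos; apply Rabs_pos|].
    rewrite <- (Rmult_1_r B); apply Rmult_le_compat; trivial; apply Rabs_pos. }
  assert (R := rellich per lam h dh h_der dh_cont h_per w h_pos w_per w_bottom w_harm al
    ltac:(lra)).
  assert (R2 : integral (fun x => flux lam h dh w x ^ 2) al (al + per) <= B ^ 2 * per).
  { replace (B ^ 2 * per) with (integral (fun _ => B ^ 2) al (al + per))
      by (rewrite integral_const; ring).
    apply integral_le; cont; lra. }
  apply (Rle_trans _ (integral (fun x =>
    16 * (lam ^ 2 * (1 + lam ^ 2 * dh x ^ 2) * jx w x (h x) ^ 2) + 2 * B ^ 2) al (al + per))).
  - apply integral_le; cont; [lra|].
    intros x; unfold slope; rewrite (trace_derive_flux lam).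
    set (Th := 1 + lam ^ 2 * dh x ^ 2); set (wx := jx w x (h x)); set (f := flux lam h dh w x).
    assert (HTh1 : 1 <= Th <= 2).
    { unfold Th; specialize (HTh x); generalize (pow2_ge_0 (lam * dh x)); intros; nra. }
    assert (Hd2 : dh x ^ 2 <= 1).
    { rewrite <- pow2_abs; rewrite <- (pow1 2); apply pow_incr; split; [apply Rabs_pos|auto]. }
    assert (A1 : (wx * Th + dh x * f) ^ 2 <= 2 * (wx ^ 2 * Th ^ 2) + 2 * (dh x ^ 2 * f ^ 2)).
    { generalize (pow2_ge_0 (wx * Th - dh x * f)); nra. }
    assert (A2 : dh x ^ 2 * f ^ 2 <= B ^ 2).
    { specialize (Hf2 x); fold f in Hf2; generalize (pow2_ge_0 f), (pow2_ge_0 (dh x)); nra. }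
    assert (A3 : wx ^ 2 * Th ^ 2 <= 8 * (lam ^ 2 * Th * wx ^ 2)).
    { replace (wx ^ 2 * Th ^ 2) with (wx ^ 2 * Th * Th) by ring.
      replace (8 * (lam ^ 2 * Th * wx ^ 2)) with (wx ^ 2 * Th * (8 * lam ^ 2)) by ring.
      apply Rmult_le_compat_l; [apply Rmult_le_pos; [apply pow2_ge_0|lra]|].
      simpl; nra. }
    lra.
  - rewrite integral_plus, integral_scal, integral_const by cont.
    replace (al + per - al) with per by ring. lra.
Qed.

End Robin.

(** * Asymptotics along the branch *)

Lemma linear_coefficients (p0 p1 C d : R) : 0 < d ->
  (forall t, 0 <= t < d -> Rabs (p0 + t * p1) <= C * t ^ 2) -> p0 = 0 /\ p1 = 0.
Proof.
  intros Hd H; apply (polynomial_coefficients 0 p0 p1 C d Hd).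
  intros t Ht; specialize (H t Ht).
  replace (0 + t * p0 + t ^ 2 * p1) with (t * (p0 + t * p1)) by ring.
  rewrite Rabs_mult, (Rabs_pos_eq t) by lra.
  replace (C * t ^ 3) with (t * (C * t ^ 2)) by ring; apply Rmult_le_compat_l; lra.
Qed.

Lemma Rbar_lt_small (T : Rbar) : Rbar_lt 0 T ->
  exists r, 0 < r /\ forall t, t < r -> Rbar_lt t T.
Proof.
  destruct T as [T| |]; simpl; intros H; [exists T; auto|exists 1; split; auto; lra|easy].
Qed.

(** Terms are peeled off one at a time; the tail after [m] of them is geometric with bound
    [M / r^m], hence bounded at half the radius. *)
Lemma Ou_psum_tail M r (c : nat -> R -> R) : 0 < r -> geometric_family M r c ->
  Ou 1 (fun t x => psum c t x - c 0%nat x) /\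
  Ou 2 (fun t x => psum c t x - (c 0%nat x + t * c 1%nat x)) /\
  Ou 3 (fun t x => psum c t x - (c 0%nat x + t * c 1%nat x + t ^ 2 * c 2%nat x)).
Proof.
  intros Hr Hc.
  assert (G : forall x, geometric M r (fun n => c n x)) by (intros x n; apply Hc).
  assert (B : forall m, Ou 0 (fun t x => PSeries (fun n => c (m + n)%nat x) t)).
  { intros m; exists (2 * (M / r ^ m)), (r / 2); split; [lra|]; intros t x Ht.
    simpl; rewrite Rmult_1_r; apply (geometric_PSeries_bound _ r); trivial.
    - induction m as [|m IH]; [simpl; replace (M / 1) with M by field; apply G|].
      intros n; generalize (geometric_tail _ r _ Hr IH n); simpl.
      rewrite (Nat.add_succ_r m n).
      replace (M / (r * r ^ m)) with (M / r ^ m / r); trivial.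
      field; split; [apply Rgt_not_eq, pow_lt|]; lra.
    - rewrite Rabs_pos_eq; lra. }
  assert (E : forall m t x, Rabs t < r -> PSeries (fun n => c (m + n)%nat x) t
     = c m x + t * PSeries (fun n => c (S m + n)%nat x) t).
  { intros m t x Ht.
    assert (Gm : exists K, geometric K r (fun n => c (m + n)%nat x)).
    { induction m as [|m [K IH]]; [exists M; apply G|].
      exists (K / r); intros n; generalize (geometric_tail _ r _ Hr IH n); simpl.
      now rewrite (Nat.add_succ_r m n). }
    destruct Gm as [K Gm].
    rewrite (PSeries_tail K r _ t Hr Gm Ht), Nat.add_0_r; f_equal; f_equal.
    apply PSeries_ext; intros n; now rewrite Nat.add_succ_r. }
  assert (E' : forall t x, Rabs t < r ->
    psum c t x = c 0%nat x + t * PSeries (fun n => c (1 + n)%nat x) t) by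
    (intros; now apply (E 0%nat)).
  assert (Hloc : forall t, 0 <= t < r -> Rabs t < r) by (intros; rewrite Rabs_pos_eq; lra).
  repeat split.
  - apply (Ou_loc _ _ _ (Ou_mult 1 0 _ _ Ou_t (B 1%nat))); exists r; split; trivial.
    intros t x Ht; rewrite E' by auto; ring.
  - apply (Ou_loc _ _ _ (Ou_mult 1 1 _ _ Ou_t (Ou_mult 1 0 _ _ Ou_t (B 2%nat)))).
    exists r; split; trivial.
    intros t x Ht; rewrite E', (E 1%nat) by auto; ring.
  - apply (Ou_loc _ _ _ (Ou_mult 1 2 _ _ Ou_t (Ou_mult 1 1 _ _ Ou_t
      (Ou_mult 1 0 _ _ Ou_t (B 3%nat))))).
    exists r; split; trivial.
    intros t x Ht; rewrite E', (E 1%nat), (E 2%nat) by auto; ring.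
Qed.

(** * The power series of the surface and of [lam] at [t = 0] *)

Lemma C2_line_derive (f : R -> R) : C2_line f ->
  (forall x, is_derive f x (Derive f x)) /\
  (forall x, is_derive (Derive f) x (Derive_n f 2 x)) /\ C0 (Derive_n f 2).
Proof.
  intros H; split; [|split]; intros x.
  - apply Derive_correct; exact (proj1 (H 1%nat x ltac:(lia))).
  - apply (Derive_correct (Derive f)); exact (proj1 (H 2%nat x ltac:(lia))).
  - exact (proj2 (H 2%nat x ltac:(lia))).
Qed.

(** [e] stands for the surface and [d] for its [t]-derivative; the digit counts derivatives in [x].
    As sums of power series these functions live on both sides of [t = 0], and [e0] agrees with
    [eta] along the branch. *)
Record surface_series (d tau : R) (T : Rbar) (eta : R -> R -> R) (r : R)
    (e0 e1 d0 d1 : R -> R -> R) : Prop := {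
  ss_r : 0 < r;
  ss_e0_x : forall t x, Rabs t < r -> is_derive (e0 t) x (e1 t x);
  ss_d0_x : forall t x, Rabs t < r -> is_derive (d0 t) x (d1 t x);
  ss_e0_t : forall t x, Rabs t < r -> is_derive (fun t => e0 t x) t (d0 t x);
  ss_e1_t : forall t x, Rabs t < r -> is_derive (fun t => e1 t x) t (d1 t x);
  ss_e0_c : forall t x, Rabs t < r -> continuity_2d_pt e0 t x;
  ss_e1_c : forall t x, Rabs t < r -> continuity_2d_pt e1 t x;
  ss_d0_c : forall t x, Rabs t < r -> continuity_2d_pt d0 t x;
  ss_d1_c : forall t x, Rabs t < r -> continuity_2d_pt d1 t x;
  ss_eta : forall t x, 0 <= t < r -> Rbar_lt t T -> eta t x = e0 t x;
  ss_e0_O : Ou 2 (fun t x => e0 t x - (d + t * cos (tau * x)));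
  ss_e1_O : Ou 2 (fun t x => e1 t x - t * (- tau * sin (tau * x)));
  ss_d0_O : Ou 1 (fun t x => d0 t x - cos (tau * x));
  ss_e1_lip : exists K, forall t x y, 0 <= t < r ->
    Rabs (e1 t x - e1 t y) <= K * t * Rabs (x - y) }.

Arguments ss_r {d tau T eta r e0 e1 d0 d1}.
Arguments ss_e0_x {d tau T eta r e0 e1 d0 d1}.
Arguments ss_d0_x {d tau T eta r e0 e1 d0 d1}.
Arguments ss_e0_t {d tau T eta r e0 e1 d0 d1}.
Arguments ss_e1_t {d tau T eta r e0 e1 d0 d1}.
Arguments ss_e0_c {d tau T eta r e0 e1 d0 d1}.
Arguments ss_e1_c {d tau T eta r e0 e1 d0 d1}.
Arguments ss_d0_c {d tau T eta r e0 e1 d0 d1}.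
Arguments ss_d1_c {d tau T eta r e0 e1 d0 d1}.
Arguments ss_eta {d tau T eta r e0 e1 d0 d1}.
Arguments ss_e0_O {d tau T eta r e0 e1 d0 d1}.
Arguments ss_e1_O {d tau T eta r e0 e1 d0 d1}.
Arguments ss_d0_O {d tau T eta r e0 e1 d0 d1}.
Arguments ss_e1_lip {d tau T eta r e0 e1 d0 d1}.

Lemma surface_series_exists (d tau : R) (T : Rbar) (eta : R -> R -> R) :
  Rbar_lt 0 T -> analytic_C2_line T eta ->
  (exists C delta, 0 < delta /\ forall t x, 0 <= t < delta ->
      Rabs (eta t x - (d + t * cos (tau * x))) <= C * t ^ 2) ->
  exists r e0 e1 d0 d1, surface_series d tau T eta r e0 e1 d0 d1.
Proof.
  intros HT Han (C0' & dl & Hdl & Hexp).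
  destruct (Han 0 (Rle_refl 0) HT) as (r & M & c & Hr & HC2 & HM & Hser).
  destruct (Rbar_lt_small T HT) as (rT & HrT & HltT).
  pose (c1 := fun n => Derive (c n)).
  assert (D0 : forall n x, is_derive (c n) x (c1 n x)) by (intros; now apply C2_line_derive).
  assert (D1 : forall n x, is_derive (c1 n) x (Derive_n (c n) 2 x)) by
    (intros; now apply (C2_line_derive (c n))).
  assert (G0 : geometric_family M r c) by (intros n x; apply (HM n 0%nat); lia).
  assert (G1 : geometric_family M r c1) by (intros n x; apply (HM n 1%nat); lia).
  assert (G2 : geometric_family M r (fun n => Derive_n (c n) 2)) by
    (intros n x; apply (HM n 2%nat); lia).
  assert (L0 := family_lipschitz M r c c1 Hr D0 G1).
  assert (L1 := family_lipschitz M r c1 _ Hr D1 G2).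
  assert (Hr2 : 0 < r / 2) by lra.
  assert (G0' := family_derive_geometric M r c Hr G0).
  assert (G1' := family_derive_geometric M r c1 Hr G1).
  assert (L0' := family_derive_lipschitz M r c Hr L0).
  assert (L1' := family_derive_lipschitz M r c1 Hr L1).
  assert (D0' : forall n x, is_derive (family_derive c n) x (family_derive c1 n x)).
  { intros n x; eapply der_eq; [apply der_mult; [apply der_const|apply D0]|].
    unfold family_derive; cbv beta; ring. }
  destruct (Ou_psum_tail M r c Hr G0) as (_ & T0 & _).
  destruct (Ou_psum_tail M r c1 Hr G1) as (_ & T1 & _).
  destruct (Ou_psum_tail _ _ _ Hr2 G0') as (T0' & _ & _).
  assert (Eeta : forall t x, 0 <= t < r -> Rbar_lt t T -> eta t x = psum c t x).
  { intros t x Ht HtT; symmetry; apply is_pseries_unique.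
    assert (A := Hser t x (proj1 Ht) HtT ltac:(rewrite Rminus_0_r, Rabs_pos_eq; lra)).
    now rewrite Rminus_0_r in A. }
  assert (Ec : forall x, c 0%nat x = d /\ c 1%nat x = cos (tau * x)).
  { intros x; destruct T0 as (C1 & dl1 & Hdl1 & T0).
    enough (c 0%nat x - d = 0 /\ c 1%nat x - cos (tau * x) = 0) by lra.
    apply (linear_coefficients _ _ (C1 + C0') (Rmin (Rmin dl1 dl) (Rmin r rT))).
    { repeat apply Rmin_glb_lt; trivial. }
    intros t Ht.
    rmin_bounds.
    specialize (T0 t x ltac:(lra)); specialize (Hexp t x ltac:(lra)).
    rewrite (Eeta t x) in Hexp by (try apply HltT; lra).
    replace (c 0%nat x - d + t * (c 1%nat x - cos (tau * x)))
      with (- (psum c t x - (c 0%nat x + t * c 1%nat x))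
            + (psum c t x - (d + t * cos (tau * x)))) by ring.
    eapply Rle_trans; [apply Rabs_triang|]; rewrite Rabs_Ropp; lra. }
  assert (Ec1 : forall x, c1 0%nat x = 0 /\ c1 1%nat x = - tau * sin (tau * x)).
  { intros x; split; unfold c1.
    - rewrite (Derive_ext _ (fun _ => d)) by (intros; apply Ec); apply Derive_const.
    - rewrite (Derive_ext _ (fun x => cos (tau * x))) by (intros; apply Ec).
      apply is_derive_unique; eapply der_eq;
        [apply (der_comp cos); [apply is_derive_cos|apply der_lin]|ring]. }
  (* Differentiating in [t] halves the radius, and joint continuity requires half of what is left;
     [r / 8] stays strictly below [r / 4]. *)
  exists (r / 8), (psum c), (psum c1), (psum (family_derive c)), (psum (family_derive c1)).
  split.
  - lra.
  - intros; apply (psum_derive_x M r); trivial; lra.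
  - intros; apply (psum_derive_x (M / r) (r / 2)); trivial; lra.
  - intros; apply (psum_derive_t M r); trivial; lra.
  - intros; apply (psum_derive_t M r); trivial; lra.
  - intros; apply (psum_cont M M r); trivial; lra.
  - intros; apply (psum_cont M M r); trivial; lra.
  - intros; apply (psum_cont (M / r) (M / r) (r / 2)); trivial; lra.
  - intros; apply (psum_cont (M / r) (M / r) (r / 2)); trivial; lra.
  - intros; apply Eeta; trivial; lra.
  - apply (Ou_ext _ _ _ T0); intros t x; destruct (Ec x) as [-> ->]; ring.
  - apply (Ou_ext _ _ _ T1); intros t x; destruct (Ec1 x) as [-> ->]; ring.
  - apply (Ou_ext _ _ _ T0'); intros t x; unfold family_derive at 2.
    destruct (Ec x) as [_ ->]; simpl; ring.
  (* The flat surface at [t = 0] has zero slope, so the constant term drops out and a factor [t]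
     comes forward. *)
  - exists (2 * (M / r)); intros t x y Ht.
    unfold psum; rewrite !(PSeries_tail M r _ t Hr (fun n => G1 n _))
      by (rewrite Rabs_pos_eq; lra).
    destruct (Ec1 x) as [-> _]. destruct (Ec1 y) as [-> _].
    match goal with |- Rabs ?u <= _ => replace u with
      (t * (psum (fun n => c1 (S n)) t x - psum (fun n => c1 (S n)) t y))
      by (unfold psum; ring) end.
    rewrite Rabs_mult, (Rabs_pos_eq t) by lra.
    replace (2 * (M / r) * t * Rabs (x - y)) with (t * (2 * (M / r) * Rabs (x - y))) by ring.
    apply Rmult_le_compat_l; [lra|].
    apply (psum_lipschitz (M / r) _ r); trivial.
    + intros n u; apply (geometric_tail M r (fun n => c1 n u) Hr (fun n => G1 n u)).
    + intros n u v.
      replace (M / r * Rabs (u - v)) with (M * Rabs (u - v) / r) by (field; lra).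
      apply (geometric_tail (M * Rabs (u - v)) r (fun n => c1 n u - c1 n v) Hr
        (fun n => L1 n u v)).
    + rewrite Rabs_pos_eq; lra.
Qed.

Record lam_series (lam2 : R) (T : Rbar) (lam : R -> R) (r : R) (l dl : R -> R) : Prop := {
  ls_r : 0 < r;
  ls_t : forall t, Rabs t < r -> is_derive l t (dl t);
  ls_c : forall t, Rabs t < r -> continuous dl t;
  ls_lam : forall t, 0 <= t < r -> Rbar_lt t T -> lam t = l t;
  ls_O : near 1 (fun t _ => l t);
  ls_dO : Ou 2 (fun t _ => dl t - 2 * lam2 * t) }.

Arguments ls_r {lam2 T lam r l dl}.
Arguments ls_t {lam2 T lam r l dl}.
Arguments ls_c {lam2 T lam r l dl}.
Arguments ls_lam {lam2 T lam r l dl}.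
Arguments ls_O {lam2 T lam r l dl}.
Arguments ls_dO {lam2 T lam r l dl}.

Lemma lam_series_exists lam2 T lam : Rbar_lt 0 T -> analytic T lam ->
  bigO 4 (fun t => lam t - (1 + lam2 * t ^ 2)) ->
  exists r l dl, lam_series lam2 T lam r l dl.
Proof.
  intros HT Han (C0' & dl & Hdl & Hexp).
  destruct (Han 0 (Rle_refl 0) HT) as (r & M & c & Hr & HM & Hser).
  destruct (Rbar_lt_small T HT) as (rT & HrT & HltT).
  (* A family constant in [x], so that the lemmas on families of coefficients apply to a scalar
     series. *)
  pose (cc := fun n (x : R) => c n).
  assert (G : geometric_family M r cc) by (intros n x; apply HM).
  assert (G' := family_derive_geometric M r cc Hr G).
  assert (Hr2 : 0 < r / 2) by lra.
  destruct (Ou_psum_tail M r cc Hr G) as (T1 & _ & T3).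
  destruct (Ou_psum_tail _ _ _ Hr2 G') as (_ & T2' & _).
  assert (E : forall t, 0 <= t < r -> Rbar_lt t T -> lam t = psum cc t 0).
  { intros t Ht HtT; symmetry; apply is_pseries_unique.
    assert (A := Hser t (proj1 Ht) HtT ltac:(rewrite Rminus_0_r, Rabs_pos_eq; lra)).
    now rewrite Rminus_0_r in A. }
  assert (Ec : c 0%nat = 1 /\ c 1%nat = 0 /\ c 2%nat = lam2).
  { destruct T3 as (C1 & dl1 & Hdl1 & T3).
    enough (c 0%nat - 1 = 0 /\ c 1%nat = 0 /\ c 2%nat - lam2 = 0) by lra.
    apply (polynomial_coefficients _ _ _ (C1 + Rabs C0') (Rmin (Rmin (Rmin dl1 dl) (Rmin r rT)) 1)).
    { repeat apply Rmin_glb_lt; trivial; lra. }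
    intros t Ht.
    rmin_bounds.
    specialize (T3 t 0 ltac:(lra)); specialize (Hexp t ltac:(lra)).
    rewrite (E t) in Hexp by (try apply HltT; lra).
    replace (c 0%nat - 1 + t * c 1%nat + t ^ 2 * (c 2%nat - lam2))
      with (- (psum cc t 0 - (cc 0%nat 0 + t * cc 1%nat 0 + t ^ 2 * cc 2%nat 0))
            + (psum cc t 0 - (1 + lam2 * t ^ 2))) by (unfold cc at 2 3 4; ring).
    eapply Rle_trans; [apply Rabs_triang|]; rewrite Rabs_Ropp.
    assert (C0' * t ^ 4 <= Rabs C0' * t ^ 3).
    { assert (0 <= t ^ 4 <= t ^ 3) by
        (assert (0 <= t ^ 3) by (apply pow_le; lra); split; [apply pow_le; lra|];
         replace (t ^ 4) with (t * t ^ 3) by ring; nra).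
      generalize (Rle_abs C0'), (Rabs_pos C0'); nra. }
    lra. }
  destruct Ec as (E0 & E1 & E2).
  exists (r / 8), (fun t => psum cc t 0), (fun t => psum (family_derive cc) t 0); split.
  - lra.
  - intros; apply (psum_derive_t M r cc); trivial; lra.
  - intros t Ht; apply (ex_derive_continuous (fun t => psum (family_derive cc) t 0)).
    eexists; apply (psum_derive_t (M / r) (r / 2)); trivial; lra.
  - intros; apply E; trivial; lra.
  - apply (Ou_ext _ _ _ T1); intros t x; unfold cc at 2; rewrite E0; reflexivity.
  - apply (Ou_ext _ _ _ T2'); intros t x; unfold family_derive at 2 3; unfold cc at 2 3.
    rewrite E1, E2; simpl; unfold psum, family_derive, cc; ring.
Qed.

(* One-sided: the Lipschitz bound is only known on [[0, d]]. *)
Lemma derive_bound_of_lipschitz_left (f : R -> R) (l K d : R) : 0 < d ->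
  is_derive f d l -> (forall y, 0 <= y <= d -> Rabs (f d - f y) <= K * Rabs (d - y)) ->
  Rabs l <= K.
Proof.
  intros Hd Hf HL; apply Rnot_lt_le; intros Hn.
  apply is_derive_Reals in Hf.
  destruct (Hf (Rabs l - K) ltac:(lra)) as [dl Hdl].
  assert (Hm : 0 < Rmin d dl) by (apply Rmin_glb_lt; [trivial|apply cond_pos]).
  rmin_bounds.
  set (h := Rmin d dl / 2).
  assert (Hh : 0 < h /\ h < d /\ h < dl) by (unfold h; lra).
  specialize (Hdl (- h) ltac:(lra) ltac:(rewrite Rabs_Ropp, Rabs_pos_eq; lra)).
  specialize (HL (d - h) ltac:(lra)).
  replace (d - (d - h)) with h in HL by ring; rewrite (Rabs_pos_eq h) in HL by lra.
  assert (A : Rabs ((f (d + - h) - f d) / - h) <= K).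
  { replace ((f (d + - h) - f d) / - h) with ((f d - f (d - h)) / h).
    - unfold Rdiv; rewrite Rabs_mult, Rabs_inv, (Rabs_pos_eq h) by lra.
      apply (Rmult_le_reg_r h); [lra|]; rewrite Rmult_assoc, Rinv_l; lra.
    - replace (d - h) with (d + - h) by ring; field; lra. }
  assert (B : Rabs l <= Rabs ((f (d + - h) - f d) / - h - l) + Rabs ((f (d + - h) - f d) / - h)).
  { replace l with (- ((f (d + - h) - f d) / - h - l) + (f (d + - h) - f d) / - h) at 1 by ring.
    eapply Rle_trans; [apply Rabs_triang|]; rewrite Rabs_Ropp; lra. }
  lra.
Qed.

(** * The surface data near the laminar flow *)

Section Branch.
Variables (a d tau : R) (T : Rbar) (psi : R -> R -> R -> R) (eta : R -> R -> R) (lam : R -> R).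
Variable lam2 : R.
Hypothesis d_pos : 0 < d.
Hypothesis tau_pos : 0 < tau.
Hypothesis T_pos : Rbar_lt 0 T.
Hypothesis SB : stokes_branch a d tau T psi eta lam lam2.
Variables (r : R) (e0 e1 d0 d1 : R -> R -> R).
Hypothesis SS : surface_series d tau T eta r e0 e1 d0 d1.
Variables (rl : R) (l dl : R -> R).
Hypothesis LS : lam_series lam2 T lam rl l dl.

Notation per := (2 * PI / tau).

Lemma e0_zero x : e0 0 x = d.
Proof.
  destruct (ss_e0_O SS) as (C & dl' & Hdl & H).
  specialize (H 0 x ltac:(lra)).
  replace (C * 0 ^ 2) with 0 in H by ring.
  destruct (Req_dec (e0 0 x - (d + 0 * cos (tau * x))) 0) as [|Hn]; [lra|].
  apply Rabs_pos_lt in Hn; lra.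
Qed.

Lemma near_e0 : near d e0.
Proof.
  apply (Ou_ext 1 (fun t x => (e0 t x - (d + t * cos (tau * x))) + t * cos (tau * x))).
  - apply Ou_plus; [apply (Ou_le 2); [lia|apply SS]|].
    apply (Ou_mult 1 0 (fun t _ => t)); [apply Ou_t|apply (Ou_cos (fun _ x => tau * x))].
  - intros; ring.
Qed.

(** The coefficients on the strip are bounded together with their vertical derivatives, and the
    zeroth one is [U]. Hence [psi - U] is Lipschitz in the flattened height with a constant of order
    [t], which controls the surface speed without differentiating the series termwise. *)
Lemma psi_on_strip : exists C rp, 0 < rp /\
  (forall t x y, 0 <= t < rp -> 0 <= y <= e0 t x -> Rabs (psi t x y) <= C) /\
  (forall t x s, 0 <= t < rp -> 0 <= s <= d ->
    Rabs ((psi t x (d * e0 t x / d) - U a d d) - (psi t x (s * e0 t x / d) - U a d s))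
      <= C * t * Rabs (d - s)).
Proof.
  destruct (sb_psi_analytic _ _ _ _ _ _ _ _ SB 0 (Rle_refl 0) T_pos)
    as (rp & M & c & Hrp & HC2 & HM & Hser).
  destruct (Rbar_lt_small T T_pos) as (rT & HrT & HltT).
  destruct (sb_psi_expansion _ _ _ _ _ _ _ _ SB) as (C1 & dl1 & Hdl1 & Hexp).
  destruct (near_pos d e0 d_pos near_e0) as (dl2 & Hdl2 & He0).
  assert (Hr := ss_r SS).
  assert (E : forall t x s, 0 <= t < rp -> t < rT -> t < r -> 0 <= s <= d ->
     psi t x (s * e0 t x / d) = PSeries (fun n => c n x s) t).
  { intros t x s Ht HtT Htr Hs.
    assert (A := Hser t x s (proj1 Ht) (HltT t HtT)
      ltac:(rewrite Rminus_0_r, Rabs_pos_eq; lra) Hs).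
    rewrite Rminus_0_r in A; apply is_pseries_unique in A; rewrite A.
    unfold flatten; rewrite (ss_eta SS t x); trivial; [lra|].
    now apply HltT. }
  assert (HM0 : 0 <= M).
  { generalize (HM 0%nat 0%nat 0%nat 0 0 ltac:(lia) ltac:(lra)).
    rewrite pow_O, Rmult_1_r; generalize (Rabs_pos (partial_derive 0 0 (c 0%nat) 0 0)); lra. }
  assert (G : forall x s, 0 <= s <= d -> geometric M rp (fun n => c n x s)).
  { intros x s Hs n; apply (HM n 0%nat 0%nat); trivial; lia. }
  (* At [t = 0] the surface is flat, so flattening is the identity and the given expansion of [psi]
     shows [U]. *)
  assert (Ec0 : forall x s, 0 <= s <= d -> c 0%nat x s = U a d s).
  { intros x s Hs.
    assert (A := E 0 x s ltac:(lra) HrT Hr Hs).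
    rewrite PSeries_0, e0_zero in A.
    replace (s * d / d) with s in A by (field; lra); rewrite <- A.
    assert (B := Hexp 0 x s ltac:(lra)).
    rewrite (ss_eta SS), e0_zero in B by (trivial; lra).
    specialize (B Hs); replace (C1 * 0 ^ 2) with 0 in B by ring.
    match type of B with Rabs ?u <= 0 => destruct (Req_dec u 0) as [Z|Z];
      [lra|apply Rabs_pos_lt in Z; lra] end. }
  assert (L : forall n x s, 0 <= s <= d ->
    Rabs (c n x d - c n x s) * rp ^ n <= M * Rabs (d - s)).
  { intros n x s Hs.
    destruct (C2_plane_jet (c n) (HC2 n)) as (w & W0 & _ & Wy & _).
    destruct (MVT_gen (c n x) s d (fun y => jy w x y)) as (y & Hy & E1).
    - intros; rewrite <- W0; apply jy_spec.
    - intros; rewrite <- W0; apply C0_pt, (C0_derive _ (fun y => jy w x y)); intros; apply jy_spec.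
    - rewrite E1, Rabs_mult.
      rewrite Rmin_left, Rmax_right in Hy by lra.
      generalize (HM n 0%nat 1%nat x y ltac:(lia) ltac:(lra)); rewrite <- Wy; intros B.
      apply (Rmult_le_compat_r (Rabs (d - s))) in B; [lra|apply Rabs_pos]. }
  exists (2 * M + 2 * (M / rp)), (Rmin (Rmin (rp / 2) rT) (Rmin r dl2)).
  assert (HMr : 0 <= M / rp) by (apply Rmult_le_pos; [trivial|left; now apply Rinv_0_lt_compat]).
  split; [repeat apply Rmin_glb_lt; trivial; lra|].
  rmin_bounds.
  split.
  - intros t x y Ht Hy.
    assert (He := He0 t x ltac:(lra)).
    assert (Hs : 0 <= y * d / e0 t x <= d).
    { split.
      - apply Rmult_le_pos; [nra|left; apply Rinv_0_lt_compat; lra].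
      - apply (Rmult_le_reg_r (e0 t x)); [lra|].
        replace (y * d / e0 t x * e0 t x) with (y * d) by (field; lra). nra. }
    replace y with (y * d / e0 t x * e0 t x / d) by (field; lra).
    rewrite E by (trivial; lra).
    apply (Rle_trans _ (2 * M)); [|lra].
    apply (geometric_PSeries_bound _ rp); trivial; [now apply G|rewrite Rabs_pos_eq; lra].
  - intros t x s Ht Hs.
    assert (Ht' : Rabs t < rp) by (rewrite Rabs_pos_eq; lra).
    rewrite !E by lra.
    rewrite (PSeries_tail M rp (fun n => c n x d) t Hrp) by (trivial; apply G; lra).
    rewrite (PSeries_tail M rp (fun n => c n x s) t Hrp) by (trivial; apply G; lra).
    rewrite !Ec0 by lra.
    match goal with |- Rabs ?u <= _ => replace u with
      (t * (PSeries (fun n => c (S n) x d) t - PSeries (fun n => c (S n) x s) t)) by ring end.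
    rewrite Rabs_mult, (Rabs_pos_eq t) by lra.
    rewrite <- PSeries_minus.
    2,3: apply CV_radius_inside, (geometric_radius (M / rp) rp); trivial;
      apply (geometric_tail M rp (fun n => c n x _)); trivial; apply G; lra.
    assert (B : Rabs (PSeries (PS_minus (fun n => c (S n) x d) (fun n => c (S n) x s)) t)
      <= 2 * (M * Rabs (d - s) / rp)).
    { apply (geometric_PSeries_bound _ rp); trivial; [|rewrite Rabs_pos_eq; lra].
      apply (geometric_tail (M * Rabs (d - s)) rp (fun n => c n x d - c n x s)); trivial.
      intros n; now apply L. }
    apply (Rle_trans _ (t * (2 * (M * Rabs (d - s) / rp)))).
    + apply Rmult_le_compat_l; [lra|exact B].
    + replace (t * (2 * (M * Rabs (d - s) / rp))) with (2 * (M / rp) * t * Rabs (d - s))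
        by (field; lra).
      apply Rmult_le_compat_r; [apply Rabs_pos|]. apply Rmult_le_compat_r; lra.
Qed.

Definition speed (t x : R) : R := partial_derive 0 1 (psi t) x (e0 t x).
Definition eta_xx (t x : R) : R := Derive_n (eta t) 2 x.
Definition speed_x (t x : R) : R := partial_derive 1 1 (psi t) x (e0 t x)
  + partial_derive 0 2 (psi t) x (e0 t x) * e1 t x.
Definition rho_t (t x : R) : R := 1
  + l t ^ 2 * partial_derive 1 1 (psi t) x (e0 t x) * partial_derive 1 0 (psi t) x (e0 t x)
  + partial_derive 0 2 (psi t) x (e0 t x) * partial_derive 0 1 (psi t) x (e0 t x).

Lemma U_derive : is_derive (U a d) d (kappa a d).
Proof.
  unfold U, kappa; auto_derive; trivial; field; lra.
Qed.

(** Restates the waves with [e0] and [l] in place of [eta] and [lam], because [t]-derivatives are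
    available for the sums of series. The bound [C] on [psi] is uniform in [t]. *)
Lemma branch_wave : exists rw C, 0 < rw /\ rw <= r /\ rw <= rl /\
  (forall t, t < rw -> Rbar_lt t T) /\
  forall t, 0 <= t < rw -> exists p : jet,
    jet_wave a (bernoulli a d) per p (e0 t) (e1 t) (eta_xx t) (l t) /\
    j0 p = psi t /\
    (forall x, top_speed p (e0 t) x = speed t x) /\
    (forall x, top_speed_derive p (e0 t) (e1 t) x = speed_x t x) /\
    (forall x, rho p (e0 t) (l t) x = rho_t t x) /\
    (forall x y, 0 <= y <= e0 t x -> Rabs (j0 p x y) <= C).
Proof.
  destruct psi_on_strip as (C & rp & Hrp & HC & _).
  destruct (Rbar_lt_small T T_pos) as (rT & HrT & HltT).
  assert (Hr := ss_r SS). assert (Hrl := ls_r LS).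
  exists (Rmin (Rmin rp rT) (Rmin r rl)), C.
  rmin_bounds.
  split; [repeat apply Rmin_glb_lt; trivial|].
  split; [lra|]. split; [lra|]. split; [intros; apply HltT; lra|].
  intros t Ht.
  assert (HtT : Rbar_lt t T) by (apply HltT; lra).
  assert (W := sb_wave _ _ _ _ _ _ _ _ SB t (proj1 Ht) HtT).
  assert (Ee : forall x, eta t x = e0 t x) by (intros; apply (ss_eta SS); trivial; lra).
  assert (El : lam t = l t) by (apply (ls_lam LS); trivial; lra).
  destruct (C2_plane_jet _ (ww_psi_C2 _ _ _ _ _ _ W)) as (p & P0 & Px & Py & Pxx & Pxy & Pyy).
  destruct (C2_line_derive _ (ww_eta_C2 _ _ _ _ _ _ W)) as (H1 & H2 & H3).
  assert (Hat : Rabs t < r) by (rewrite Rabs_pos_eq; lra).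
  assert (Ed : forall x, Derive (eta t) x = e1 t x).
  { intros x; rewrite (Derive_ext _ (e0 t)) by trivial.
    apply is_derive_unique, (ss_e0_x SS); trivial. }
  exists p; split; [|repeat split].
  - rewrite <- El; split.
    + apply W.
    + intros; rewrite <- Ee; apply W.
    + intros; apply (ss_e0_x SS); trivial.
    + intros x; apply (is_derive_ext (Derive (eta t))); [exact Ed|apply H2].
    + exact H3.
    + intros; rewrite <- !Ee; apply (ww_eta_sym _ _ _ _ _ _ W).
    + intros x y; rewrite P0; apply (ww_psi_sym _ _ _ _ _ _ W).
    + intros x y Hy; rewrite <- Ee in Hy; unfold lap; rewrite Pxx, Pyy.
      generalize (ww_eq _ _ _ _ _ _ W x y Hy); lra.
    + intros; rewrite P0; apply W.
    + intros; rewrite P0, <- Ee; apply W.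
    + intros; rewrite Px, Py, <- Ee; apply W.
  - exact P0.
  - intros; unfold top_speed, speed; now rewrite Py.
  - intros; unfold top_speed_derive, speed_x; now rewrite Pxy, Pyy.
  - intros; unfold rho, rho_t; now rewrite Px, Py, Pxy, Pyy.
  - intros x y Hy; rewrite P0; apply HC; trivial; lra.
Qed.

(** The vertical derivative of the flattened wave at the top is [speed * e0 / d], and that of [U] is
    [kappa]. Their difference is at most the Lipschitz constant [C * t] of [psi_on_strip]. *)
Lemma near_speed : near (kappa a d) speed.
Proof.
  destruct psi_on_strip as (C & rp & Hrp & _ & HC).
  destruct branch_wave as (rw & C' & Hrw & _ & _ & _ & HW).
  assert (N : near (kappa a d) (fun t x => speed t x * (e0 t x / d))).
  { exists C, (Rmin rp rw); split; [now apply Rmin_glb_lt|].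
    intros t x Ht; rmin_bounds.
    destruct (HW t ltac:(lra)) as (p & _ & P0 & Ps & _).
    simpl; rewrite Rmult_1_r.
    apply (derive_bound_of_lipschitz_left (fun s => psi t x (s * e0 t x / d) - U a d s) _ _ d d_pos).
    - apply der_minus; [|apply U_derive].
      rewrite <- P0.
      assert (D : is_derive (fun s => s * e0 t x / d) d (e0 t x / d)).
      { eapply der_eq; [unfold Rdiv; eauto with der|cbv beta; field; lra]. }
      apply (der_comp (j0 p x) (fun s => s * e0 t x / d)); trivial.
      rewrite <- Ps; unfold top_speed.
      replace (d * e0 t x / d) with (e0 t x) by (field; lra); apply jy_spec.
    - intros s Hs; apply HC; trivial; lra. }
  destruct (near_pos d e0 d_pos near_e0) as (dl2 & Hdl2 & He0).
  apply (near_loc _ (fun t x => speed t x * (e0 t x / d) * (d / e0 t x))).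
  - apply (near_eq (kappa a d * (d / d))); [|field; lra].
    apply near_mult; trivial; apply near_div; [lra|apply near_const|apply near_e0].
  - exists dl2; split; trivial; intros t x Ht; specialize (He0 t x Ht); field; lra.
Qed.

(** The slope is Lipschitz in [x] with a constant of order [t], and that constant bounds its
    derivative. *)
Lemma near_eta_xx : near 0 eta_xx.
Proof.
  destruct branch_wave as (rw & C' & Hrw & Hrr & _ & _ & HW).
  destruct (ss_e1_lip SS) as [K HK].
  apply near_0; exists K, rw; split; trivial; intros t x Ht.
  destruct (HW t Ht) as (p & W & _).
  assert (D := jw_dde W x).
  simpl; rewrite Rmult_1_r.
  (* The shift places [x] at the right end of the unit interval. *)
  apply (derive_bound_of_lipschitz_left (fun y => e1 t (x - 1 + y)) _ _ 1 Rlt_0_1).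
  - eapply der_eq; [apply (der_comp (e1 t)); [|]|].
    + replace (x - 1 + 1) with x by ring; exact D.
    + eapply der_eq; [eauto with der|cbv beta; reflexivity].
    + ring.
  - intros y Hy; eapply Rle_trans; [apply HK; lra|].
    right; f_equal; f_equal; ring.
Qed.


(** * The eigenfunctions and their first mode *)

Variables (mu : R -> R) (mu2 : R).
Hypothesis kappa_nz : kappa a d <> 0.
Hypothesis disp : Defs.sigma a d tau = 0.
Hypothesis SE : forall t, 0 <= t -> Rbar_lt t T ->
  second_eigenvalue per (psi t) (eta t) (lam t) (mu t).
Hypothesis MU : bigO 4 (fun t => mu t - mu2 * t ^ 2).

Notation kap := (kappa a d).
Let b0 : R := tau * coth (tau * d).

Lemma td_pos : 0 < tau * d.
Proof. now apply Rmult_lt_0_compat. Qed.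

(** The dispersion equation: the limit [(1 - a kap) / kap^2] of the Robin coefficient is the
    Dirichlet-Neumann symbol of the first mode. *)
Lemma b0_kappa : kap ^ 2 * b0 = 1 - a * kap.
Proof. unfold b0; generalize disp; unfold Defs.sigma; intros; lra. Qed.

Lemma near_e1 : near 0 e1.
Proof.
  apply near_0, (Ou_ext 1 (fun t x => (e1 t x - t * (- tau * sin (tau * x)))
    + t * (- tau * sin (tau * x)))); [|intros; ring].
  apply Ou_plus; [apply (Ou_le 2); [lia|apply SS]|].
  apply (Ou_mult 1 0 (fun t _ => t)); [apply Ou_t|].
  apply Ou_scal, (Ou_sin (fun _ x => tau * x)).
Qed.

Lemma Ou_theta : Ou 2 (fun t x => l t ^ 2 * e1 t x ^ 2).
Proof.
  apply (Ou_mult 0 2).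
  - apply (near_Ou (1 ^ 2)), near_pow, LS.
  - apply (Ou_ext 2 (fun t x => e1 t x * e1 t x)); [|intros; ring].
    apply (Ou_mult 1 1); apply near_0_inv, near_e1.
Qed.

Lemma near_theta : near 1 (fun t x => 1 + l t ^ 2 * e1 t x ^ 2).
Proof.
  apply (near_eq (1 + 0)); [|ring]; apply near_plus; [apply near_const|].
  apply near_0, (Ou_le 2); [lia|apply Ou_theta].
Qed.

Lemma speed_squared : exists dt, 0 < dt /\ forall t x, 0 <= t < dt ->
  speed t x ^ 2 * (1 + l t ^ 2 * e1 t x ^ 2) = 2 * (bernoulli a d - e0 t x).
Proof.
  destruct branch_wave as (rw & C & Hrw & _ & _ & _ & HW).
  exists rw; split; trivial; intros t x Ht.
  destruct (HW t Ht) as (p & W & _ & Hs & _).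
  rewrite <- Hs; exact (wave_speed_squared W x).
Qed.

Lemma bernoulli_kappa : 2 * bernoulli a d = 2 * d + kap ^ 2.
Proof. unfold bernoulli, kappa; field; lra. Qed.

(** Bernoulli's law is quadratic in the speed and [speed - kap] is already [O(t)], so its square is
    negligible. Dividing the linear part by [2 * kap] raises [near_speed] to the next order. *)
Lemma speed_expansion : Ou 2 (fun t x => speed t x - (kap - t * cos (tau * x) / kap)).
Proof.
  destruct speed_squared as (dt & Hdt & E).
  apply (Ou_loc 2 (fun t x => / (2 * kap) * (- 2 * (e0 t x - (d + t * cos (tau * x)))
    - (speed t x ^ 2) * (l t ^ 2 * e1 t x ^ 2) - (speed t x - kap) * (speed t x - kap)))).
  - apply Ou_scal, Ou_minus; [apply Ou_minus|].
    + apply Ou_scal, SS.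
    + apply (Ou_mult 0 2); [|apply Ou_theta].
      apply (near_Ou (kap ^ 2)), near_pow, near_speed.
    + apply (Ou_mult 1 1); apply near_speed.
  - exists dt; split; trivial; intros t x Ht; specialize (E t x Ht).
    generalize bernoulli_kappa; intros Bk.
    replace (speed t x ^ 2 * (l t ^ 2 * e1 t x ^ 2))
      with (2 * d + kap ^ 2 - 2 * e0 t x - speed t x ^ 2) by (rewrite <- Bk; lra).
    field; exact kappa_nz.
Qed.

(** Solves the differentiated Bernoulli law for the tangential derivative; its factor stays away
    from zero because [kap] is nonzero. *)
Lemma near_speed_x : near 0 speed_x.
Proof.
  destruct branch_wave as (rw & C & Hrw & _ & _ & _ & HW).
  assert (N : near (2 * kap * 1) (fun t x => 2 * speed t x * (1 + l t ^ 2 * e1 t x ^ 2))).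
  { apply near_mult; [|apply near_theta]; apply near_mult; [apply near_const|apply near_speed]. }
  assert (N2 : near (kap ^ 2) (fun t x => 2 * speed t x * (1 + l t ^ 2 * e1 t x ^ 2)
     * (kap / 2))).
  { apply (near_eq (2 * kap * 1 * (kap / 2))); [|field]; apply near_mult; trivial.
    apply near_const. }
  destruct (near_pos _ _ (pow2_gt_0 _ kappa_nz) N2) as (d3 & Hd3 & P).
  apply (near_loc 0 (fun t x => (- 2 * e1 t x - speed t x ^ 2 *
      (l t ^ 2 * (2 * e1 t x * eta_xx t x))) / (2 * speed t x * (1 + l t ^ 2 * e1 t x ^ 2)))).
  - apply (near_eq ((- 2 * 0 - kap ^ 2 * (1 ^ 2 * (2 * 0 * 0))) / (2 * kap * 1)));
      [|field; exact kappa_nz].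
    apply near_div; [lra| |exact N].
    apply near_minus; [apply near_mult; [apply near_const|apply near_e1]|].
    apply near_mult; [apply near_pow, near_speed|].
    apply near_mult; [apply near_pow, LS|].
    apply near_mult; [|apply near_eta_xx].
    apply near_mult; [apply near_const|apply near_e1].
  - exists (Rmin rw d3); split; [now apply Rmin_glb_lt|]; intros t x Ht.
    rmin_bounds.
    destruct (HW t ltac:(lra)) as (p & W & _ & Hs & Hsx & _).
    assert (E := wave_speed_squared_derive W x).
    rewrite Hs, Hsx in E.
    specialize (P t x ltac:(lra)).
    assert (Hnz : 2 * speed t x * (1 + l t ^ 2 * e1 t x ^ 2) <> 0).
    { intros Z; rewrite Z in P; generalize (pow2_gt_0 _ kappa_nz); lra. }
    apply (Rmult_eq_reg_r (2 * speed t x * (1 + l t ^ 2 * e1 t x ^ 2))); trivial.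
    unfold Rdiv; rewrite Rmult_assoc, Rinv_l, Rmult_1_r by trivial; lra.
Qed.

(** With [psi_x = - e1 * speed] on the surface, dividing the eigenvalue condition by [speed] makes
    it the Robin condition [flux = robin * trace]. *)
Definition robin (t x : R) : R := (rho_t t x + mu t) / speed t x ^ 2.

Lemma mu_expansion : Ou 3 (fun t (_ : R) => mu t - mu2 * t ^ 2).
Proof.
  apply (Ou_le 4); [lia|].
  destruct MU as (C & dt & Hdt & H); exists C, dt; split; auto.
Qed.

Lemma Ou_mu : Ou 2 (fun t (_ : R) => mu t).
Proof.
  apply (Ou_ext 2 (fun t _ => (mu t - mu2 * t ^ 2) + mu2 * (t * t))); [|intros; ring].
  apply Ou_plus; [apply (Ou_le 3); [lia|apply mu_expansion]|].
  apply Ou_scal, (Ou_mult 1 1 (fun t _ => t) (fun t _ => t)); apply Ou_t.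
Qed.

(** [rho_top_speed] replaces the second derivatives of [psi] by surface quantities whose limits are
    known. *)
Lemma near_robin : near b0 robin.
Proof.
  destruct branch_wave as (rw & C & Hrw & _ & _ & _ & HW).
  apply (near_eq ((1 - a * kap + 0) / kap ^ 2)).
  2: { apply (Rmult_eq_reg_l (kap ^ 2)); [|apply pow_nonzero, kappa_nz].
       rewrite b0_kappa; field; exact kappa_nz. }
  apply near_div; [apply pow_nonzero, kappa_nz| |apply near_pow, near_speed].
  apply near_plus; [|apply near_0, (Ou_le 2); [lia|apply Ou_mu]].
  apply (near_loc _ (fun t x => 1 - a * speed t x + l t ^ 2 * speed t x *
    (eta_xx t x * speed t x + e1 t x * speed_x t x))).
  - apply (near_eq (1 - a * kap + 1 ^ 2 * kap * (0 * kap + 0 * 0))); [|ring].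
    apply near_plus.
    + apply near_minus; [apply near_const|].
      apply near_mult; [apply near_const|apply near_speed].
    + apply near_mult; [apply near_mult; [apply near_pow, LS|apply near_speed]|].
      apply near_plus; apply near_mult;
        [apply near_eta_xx|apply near_speed|apply near_e1|apply near_speed_x].
  - exists rw; split; trivial; intros t x Ht.
    destruct (HW t Ht) as (p & W & _ & Hs & Hsx & Hr & _).
    rewrite <- Hr, (rho_top_speed W), Hs, Hsx; reflexivity.
Qed.

Lemma speed_sign : exists dt, 0 < dt /\ forall t x, 0 <= t < dt -> 0 < kap * speed t x.
Proof.
  assert (N : near (kap ^ 2) (fun t x => kap * speed t x)).
  { apply (near_eq (kap * kap)); [|ring].
    apply near_mult; [apply near_const|apply near_speed]. }
  assert (K := pow2_gt_0 _ kappa_nz).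
  destruct (near_pos _ _ K N) as (dt & Hdt & H).
  exists dt; split; trivial; intros t x Ht; specialize (H t x Ht); lra.
Qed.

Set Implicit Arguments.
Record normal_mode (t : R) (w : jet) (x0 : R) : Prop := {
  nm_per : periodic2 per (j0 w);
  nm_bottom : forall x, j0 w x 0 = 0;
  nm_harm : forall x y, 0 < y < e0 t x -> lap (l t) w x y = 0;
  nm_flux : forall x, flux (l t) (e0 t) (e1 t) w x = robin t x * trace (e0 t) w x;
  nm_x0 : 0 <= x0 <= per;
  nm_one : trace (e0 t) w x0 = 1;
  nm_le : forall x, Rabs (trace (e0 t) w x) <= 1;
  nm_even : forall x, trace (e0 t) w (- x) = trace (e0 t) w x }.
Unset Implicit Arguments.

Lemma normal_mode_exists : exists dt, 0 < dt /\
  forall t, 0 <= t < dt -> exists w x0, normal_mode t w x0.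
Proof.
  destruct branch_wave as (rw & C & Hrw & Hrr & Hrl & HrT & HW).
  destruct speed_sign as (ds & Hds & Hsg).
  exists (Rmin rw ds); split; [now apply Rmin_glb_lt|]; intros t Ht.
  rmin_bounds.
  assert (HtT : Rbar_lt t T) by (apply HrT; lra).
  destruct (HW t ltac:(lra)) as (p & W & P0 & Hs & _).
  destruct (SE t (proj1 Ht) HtT) as (mus & (_ & _ & v & Hv & _) & Hmu).
  (* [mus] counts from zero, so index 1 belongs to the second eigenvalue. *)
  specialize (Hv 1%nat); rewrite Hmu in Hv.
  destruct (C2_plane_jet _ (ef_C2 _ _ _ _ _ _ Hv)) as (w & W0 & Wx & Wy & Wxx & Wxy & Wyy).
  assert (Ee : forall x, eta t x = e0 t x) by (intros; apply (ss_eta SS); trivial; lra).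
  assert (El : lam t = l t) by (apply (ls_lam LS); trivial; lra).
  assert (wper : periodic2 per (j0 w)).
  { intros x y; rewrite W0; apply (ef_sym _ _ _ _ _ _ Hv). }
  assert (wbot : forall x, j0 w x 0 = 0) by (intros; rewrite W0; apply Hv).
  assert (wharm : forall x y, 0 < y < e0 t x -> lap (l t) w x y = 0).
  { intros x y Hy; rewrite <- Ee in Hy; unfold lap; rewrite Wxx, Wyy, <- El; now apply Hv. }
  assert (wflux : forall x, flux (l t) (e0 t) (e1 t) w x = robin t x * trace (e0 t) w x).
  { intros x; assert (E := ef_top _ _ _ _ _ _ Hv x).
    unfold rho_hat in E; rewrite Ee, El in E.
    fold (speed t x) in E.
    assert (Hpx : partial_derive 1 0 (psi t) x (e0 t x) = - e1 t x * speed t x).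
    { rewrite <- Hs, <- (wave_top_slope W).
      rewrite <- (is_derive_unique _ _ _ (jx_spec p x (e0 t x))), P0; reflexivity. }
    rewrite Hpx in E.
    assert (Hnz : speed t x <> 0).
    { intros Z; specialize (Hsg t x ltac:(lra)); rewrite Z in Hsg; lra. }
    unfold robin, rho_t, flux, trace; rewrite Wx, Wy, W0, Hpx.
    change (partial_derive 0 1 (psi t) x (e0 t x)) with (speed t x).
    apply (Rmult_eq_reg_l (speed t x)); trivial.
    match type of E with ?L - ?Rh / _ * ?V = _ =>
      replace (speed t x * (partial_derive 0 1 (v 1%nat) x (e0 t x)
        - l t ^ 2 * e1 t x * partial_derive 1 0 (v 1%nat) x (e0 t x))) with L by ring;
      replace L with (Rh / speed t x * V + mu t / speed t x * V) by lra end.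
    field; exact Hnz. }
  assert (Hde := jw_de W).
  assert (cde := wave_de_cont W).
  assert (pe := jw_e_per W).
  destruct (trace_nonzero per (l t) (e0 t) (e1 t) Hde cde pe w (jw_pos W)
    wper wbot wharm (period_pos tau tau_pos)) as [z Hz].
  { destruct (ef_nontrivial _ _ _ _ _ _ Hv) as (x & y & Hy & Hn).
    exists x, y; rewrite <- Ee, W0; auto. }
  destruct (periodic_normalise (trace (e0 t) w) per (period_pos tau tau_pos)) as (c & x0 & Hx0 & H1 & H2).
  { now apply (trace_cont _ (e1 t)). }
  { intros x; unfold trace; rewrite pe; apply wper. }
  { now exists z. }
  exists (jet_scal c w), x0; split; trivial.
  - intros x y; simpl; now rewrite wper.
  - intros x; simpl; rewrite wbot; ring.
  - intros x y Hy; generalize (wharm x y Hy); unfold lap; simpl; intros E.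
    replace (_ + _) with (c * (l t ^ 2 * jxx w x y + jyy w x y)) by ring; simpl; rewrite E; ring.
  - intros x; generalize (wflux x); unfold flux, trace; simpl; intros E.
    replace (_ - _) with (c * (jy w x (e0 t x) - l t ^ 2 * e1 t x * jx w x (e0 t x))) by ring.
    simpl; rewrite E; ring.
  - intros x; unfold trace; simpl; rewrite <- !Ee, (proj1 (ww_eta_sym _ _ _ _ _ _
      (sb_wave _ _ _ _ _ _ _ _ SB t (proj1 Ht) HtT))), W0.
    f_equal; apply (proj1 (ef_sym _ _ _ _ _ _ Hv (eta t x))).
Qed.

Lemma robin_cont : exists dt, 0 < dt /\ forall t, 0 <= t < dt -> C0 (robin t).
Proof.
  destruct branch_wave as (rw & C & Hrw & _ & _ & _ & HW).
  destruct speed_sign as (ds & Hds & Hsg).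
  exists (Rmin rw ds); split; [now apply Rmin_glb_lt|]; intros t Ht.
  rmin_bounds.
  destruct (HW t ltac:(lra)) as (p & W & _ & Hs & Hsx & Hr & _).
  assert (cq : C0 (speed t)).
  { intros x; apply (continuous_ext _ _ x Hs), (top_speed_cont W). }
  assert (crho : C0 (rho_t t)).
  { intros x; apply (continuous_ext _ _ x Hr).
    assert (ce := wave_e_cont W).
    assert (cS : forall f, (C02 f) -> C0 (fun x => f x (e0 t x))).
    { intros f Hf; now apply C0_jet_surface. }
    assert (C0 (fun x => jxy p x (e0 t x))) by (apply cS; cont).
    assert (C0 (fun x => jyy p x (e0 t x))) by (apply cS; cont).
    assert (C0 (fun x => jx p x (e0 t x))) by (apply cS; cont).
    assert (C0 (fun x => jy p x (e0 t x))) by (apply cS; cont).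
    assert (C0 (rho p (e0 t) (l t))) by (unfold rho; cont).
    auto. }
  unfold robin; apply C0_div; cont.
  intros x; apply pow_nonzero; intros Z; specialize (Hsg t x ltac:(lra)).
  rewrite Z in Hsg; lra.
Qed.

(** [al] is the amplitude of the Robin defect of the test function in the laminar limit; at
    parameter [t] the defect changes by [O(t)]. For [k = 0] the hyperbolic test function
    degenerates, and [y] takes its place with [z coth z > 1]. *)
Lemma mode_test (k : nat) : exists al : R,
  (k <> 1%nat -> al <> 0) /\
  exists C dt, 0 < dt /\ forall t w x0, 0 <= t < dt -> normal_mode t w x0 ->
  Rabs (al * mode tau x0 (trace (e0 t) w) k) <= C * t.
Proof.
  assert (Hper := period_pos tau tau_pos).
  destruct branch_wave as (rw & C & Hrw & _ & _ & _ & HW).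
  destruct robin_cont as (dr & Hdr & Hrc).
  assert (Hmain : forall (al : R) (u : R -> R -> jet) (Er : R -> R -> R),
    Ou 1 Er ->
    (forall t x0, periodic2 per (j0 (u t x0))) ->
    (forall t x0 x, j0 (u t x0) x 0 = 0) ->
    (forall t x0 x y, lap (l t) (u t x0) x y = 0) ->
    (forall t x0 x, Rabs (flux (l t) (e0 t) (e1 t) (u t x0) x
      - robin t x * trace (e0 t) (u t x0) x - al * cos (INR k * (tau * (x - x0)))) <= Rabs (Er t x)) ->
    exists C dt, 0 < dt /\ forall t w x0, 0 <= t < dt -> normal_mode t w x0 ->
      Rabs (al * mode tau x0 (trace (e0 t) w) k) <= C * t).
  { intros al u Er (K & dE & HdE & HE) up ub ul ue.
    exists (K * per), (Rmin (Rmin rw dr) dE); split; [repeat apply Rmin_glb_lt; trivial|].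
    intros t w x0 Ht N.
    rmin_bounds.
    destruct (HW t ltac:(lra)) as (p & W & _).
    replace (K * per * t) with (K * t * per) by ring.
    apply (robin_test per (l t) (e0 t) (e1 t) (robin t) w Hper (jw_de W)
      (wave_de_cont W) (jw_e_per W)
      (jw_pos W) (nm_per N) (nm_bottom N) (nm_harm N)
      (nm_flux N) (nm_le N) (u t x0) (fun x => cos (INR k * (tau * (x - x0)))));
      cont.
    - apply Hrc; lra.
    - intros x; eapply Rle_trans; [apply ue|].
      specialize (HE t x ltac:(lra)); simpl in HE; lra. }
  assert (Hz := td_pos). assert (Hsz := sinh_pos _ Hz).
  destruct k as [|k].
  - exists (1 - b0 * d); split.
    + intros _; unfold b0, coth.
      generalize (sinh_lt_z_cosh _ Hz); intros H1 E.
      assert (E2 : (1 - tau * (cosh (tau * d) / sinh (tau * d)) * d) * sinh (tau * d)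
        = sinh (tau * d) - tau * d * cosh (tau * d)) by (field; lra).
      rewrite E in E2; lra.
    + apply (Hmain _ (fun _ _ => jet_y) (fun t x => 1 - robin t x * e0 t x - (1 - b0 * d))).
      * apply near_minus; [apply near_const|].
        apply near_mult; [apply near_robin|apply near_e0].
      * intros t x0 x y; reflexivity.
      * intros; reflexivity.
      * intros; unfold lap; simpl; ring.
      * intros t x0 x; unfold flux, trace; simpl; rewrite Rmult_0_l, cos_0.
        right; f_equal; ring.
  - set (rk := INR (S k) * tau).
    assert (HSk : 1 <= INR (S k)) by (rewrite S_INR; generalize (pos_INR k); lra).
    exists (rk * cosh (rk * d) - b0 * sinh (rk * d)); split.
    + intros Hk E.
      assert (HSk2 : 1 < INR (S k)) by (apply (lt_INR 1); lia).
      assert (G := coth_increasing (INR (S k)) (tau * d) HSk2 Hz).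
      replace (INR (S k) * (tau * d)) with (rk * d) in G by (unfold rk; ring).
      assert (E2 : (rk * cosh (rk * d) - b0 * sinh (rk * d)) * sinh (tau * d)
        = tau * (INR (S k) * (cosh (rk * d) * sinh (tau * d)) - cosh (tau * d) * sinh (rk * d))).
      { unfold b0, coth, rk at 1; field; lra. }
      rewrite E, Rmult_0_l in E2.
      assert (0 < tau * (INR (S k) * (cosh (rk * d) * sinh (tau * d))
        - cosh (tau * d) * sinh (rk * d))) by (now apply Rmult_lt_0_compat). lra.
    + assert (Np : near (rk * d) (fun t x => rk * l t * e0 t x)).
      { apply (near_eq (rk * 1 * d)); [|ring].
        apply near_mult; [apply near_mult; [apply near_const|apply LS]|apply near_e0]. }
      assert (Nch : near (cosh (rk * d)) (fun t x => cosh (rk * l t * e0 t x))).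
      { apply (near_comp cosh); trivial; eexists; apply cosh_derive. }
      assert (Nsh : near (sinh (rk * d)) (fun t x => sinh (rk * l t * e0 t x))).
      { apply (near_comp sinh); trivial; eexists; apply sinh_derive. }
      (* [E1] is the deviation of the cosine part of the defect; [E2] is the sine part, caused by
         the slope of the surface. *)
      set (E1 := fun t x => rk * l t * cosh (rk * l t * e0 t x)
          - robin t x * sinh (rk * l t * e0 t x) - (rk * cosh (rk * d) - b0 * sinh (rk * d))).
      set (E2 := fun t x => l t ^ 2 * e1 t x * (rk * sinh (rk * l t * e0 t x))).
      assert (O1 : Ou 1 E1).
      { unfold E1; apply (near_minus (rk * cosh (rk * d)) (b0 * sinh (rk * d))).
        - apply (near_eq (rk * 1 * cosh (rk * d))); [|ring].
          apply near_mult; trivial; apply near_mult; [apply near_const|apply LS].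
        - apply near_mult; trivial; apply near_robin. }
      assert (O2 : Ou 1 E2).
      { apply near_0_inv; unfold E2.
        apply (near_eq (1 ^ 2 * 0 * (rk * sinh (rk * d)))); [|ring].
        apply near_mult; [apply near_mult; [apply near_pow, LS|apply near_e1]|].
        apply near_mult; [apply near_const|trivial]. }
      apply (Hmain _ (fun t x0 => jet_mode (rk * l t) rk x0)
        (fun t x => Rabs (E1 t x) + Rabs (E2 t x))).
      * apply Ou_plus; [destruct O1 as (K & dE & HdE & HE)|destruct O2 as (K & dE & HdE & HE)];
          exists K, dE; split; trivial; intros; rewrite Rabs_Rabsolu; auto.
      * intros t x0 x y; simpl; f_equal.
        replace (rk * (x + per - x0)) with (rk * (x - x0) + 2 * INR (S k) * PI)
          by (unfold rk; field; lra).
        apply cos_period.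
      * intros t x0 x; simpl; rewrite Rmult_0_r, sinh_0; ring.
      * intros t x0 x y; unfold lap; simpl; ring.
      * intros t x0 x; unfold flux, trace; simpl jy; simpl jx; simpl j0.
        replace (INR (S k) * (tau * (x - x0))) with (rk * (x - x0)) by (unfold rk; ring).
        rewrite (Rabs_pos_eq (Rabs _ + Rabs _))
          by (generalize (Rabs_pos (E1 t x)), (Rabs_pos (E2 t x)); lra).
        match goal with |- Rabs ?u <= _ => replace u with
          (E1 t x * cos (rk * (x - x0)) + E2 t x * sin (rk * (x - x0)))
          by (unfold E1, E2; ring) end.
        eapply Rle_trans; [apply Rabs_triang|]; rewrite !Rabs_mult.
        assert (A1 : Rabs (cos (rk * (x - x0))) <= 1) by apply Rabs_le, COS_bound.
        assert (A2 : Rabs (sin (rk * (x - x0))) <= 1) by apply Rabs_le, SIN_bound.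
        generalize (Rabs_pos (E1 t x)), (Rabs_pos (E2 t x)); nra.
Qed.

(** Smallness is uniform over finitely many modes; their number is fixed by the Fejer kernel before
    [t] is chosen. *)
Lemma modes_small (N : nat) (e : R) : 0 < e -> exists dt, 0 < dt /\
  forall t w x0 k, 0 <= t < dt -> normal_mode t w x0 -> (k < N)%nat -> k <> 1%nat ->
  Rabs (mode tau x0 (trace (e0 t) w) k) <= e.
Proof.
  intros He; induction N as [|N (d1' & Hd1' & IH)].
  - exists 1; split; [lra|]; intros; lia.
  - destruct (mode_test N) as (al & Hal & C & d2 & Hd2 & HC).
    destruct (Nat.eq_dec N 1) as [E|E].
    + exists d1'; split; trivial; intros t w x0 k Ht Nm Hk Hk1; apply IH; trivial; lia.
    + specialize (Hal E); apply Rabs_pos_lt in Hal.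
      destruct (small_mult C (e * Rabs al)) as (d3 & Hd3 & H3); [now apply Rmult_lt_0_compat|].
      exists (Rmin (Rmin d1' d2) d3).
      split; [repeat apply Rmin_glb_lt; trivial|]; intros t w x0 k Ht Nm Hk Hk1.
      rmin_bounds.
      destruct (Nat.eq_dec k N) as [->|Hn]; [|apply (IH t); trivial; [lra|lia]].
      specialize (HC t w x0 ltac:(lra) Nm); rewrite Rabs_mult in HC.
      apply (Rmult_le_reg_l (Rabs al)); trivial.
      specialize (H3 t ltac:(lra)); generalize (Rle_abs C); nra.
Qed.

Lemma slope_bounded : exists K dt, 0 < K /\ 0 < dt /\
  forall t w x0, 0 <= t < dt -> normal_mode t w x0 ->
  forall al, integral (fun x => slope (e0 t) (e1 t) w x ^ 2) al (al + per) <= K.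
Proof.
  assert (Hper := period_pos tau tau_pos).
  destruct branch_wave as (rw & C & Hrw & _ & _ & _ & HW).
  destruct robin_cont as (dr & Hdr & Hrc).
  destruct (near_Ou _ _ near_robin) as (B & dB & HdB & HB).
  destruct (near_pos _ _ Rlt_0_1 (ls_O LS)) as (dL & HdL & HL).
  destruct (near_small _ _ 1 near_e1 Rlt_0_1) as (d3 & Hd3 & H3).
  destruct (near_small 0 (fun t x => l t ^ 2 * e1 t x ^ 2) 1
    (near_0 _ (Ou_le 2 1 _ ltac:(lia) Ou_theta)) Rlt_0_1) as (d4 & Hd4 & H4).
  (* The added 1 makes the bound strictly positive, as [local_lower] requires. *)
  exists (18 * B ^ 2 * per + 1), (Rmin (Rmin (Rmin rw dr) (Rmin dB dL)) (Rmin d3 d4)).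
  split; [generalize (pow2_ge_0 B); nra|].
  split; [repeat apply Rmin_glb_lt; trivial|].
  intros t w x0 Ht N al.
  rmin_bounds.
  destruct (HW t ltac:(lra)) as (p & W & _).
  eapply Rle_trans; [|apply Rlt_le, Rlt_plus_1].
  apply (robin_slope per (l t) (e0 t) (e1 t) (robin t) w Hper (jw_de W)
      (wave_de_cont W) (jw_e_per W)
      (jw_pos W) (nm_per N) (nm_bottom N) (nm_harm N)
      (nm_flux N) (nm_le N)).
  - apply Hrc; lra.
  - generalize (HL t 0 ltac:(lra)); lra.
  - intros x; specialize (H4 t x ltac:(lra)); apply Rabs_def2 in H4; lra.
  - intros x; specialize (H3 t x ltac:(lra)); rewrite Rminus_0_r in H3; lra.
  - intros x; generalize (HB t x ltac:(lra)); simpl; lra.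
Qed.

Lemma first_mode_lower : exists dt, 0 < dt /\
  forall t w x0, 0 <= t < dt -> normal_mode t w x0 ->
  per / 16 <= Rabs (integral (fun x => trace (e0 t) w x * cos (tau * x)) 0 per).
Proof.
  assert (Hper := period_pos tau tau_pos).
  destruct slope_bounded as (K & dK & HK & HdK & HS).
  destruct branch_wave as (rw & C & Hrw & _ & _ & _ & HW).
  set (B := / (1 - cos (tau * Rmin (PI / tau) (/ (4 * K)))) * 2).
  (* [N > 4 B] keeps the lower bound above [N per / 4]. With [e] chosen so that the other modes
     contribute at most [N per / 8], twice the first mode is at least [per / 8]. *)
  destruct (INR_unbounded (Rmax 1 (4 * B))) as [N HN].
  assert (HN1 := Rmax_l 1 (4 * B)). assert (HN2 := Rmax_r 1 (4 * B)).
  assert (HN0 : (0 < N)%nat) by (apply INR_lt; simpl; lra).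
  set (e := per / (8 * (2 * INR N + 1))).
  assert (He : 0 < e) by (apply Rdiv_lt_0_compat; lra).
  destruct (modes_small N e He) as (dm & Hdm & HM).
  exists (Rmin (Rmin dK dm) rw); split; [repeat apply Rmin_glb_lt; trivial|].
  intros t w x0 Ht Nm.
  rmin_bounds.
  destruct (HW t ltac:(lra)) as (p & W & _).
  set (g := trace (e0 t) w).
  assert (Hde := jw_de W).
  assert (cde := wave_de_cont W).
  assert (ce := wave_e_cont W).
  assert (pe := jw_e_per W).
  assert (cg : C0 g) by now apply (trace_cont _ (e1 t)).
  assert (Hg : forall x, is_derive g x (slope (e0 t) (e1 t) w x)).
  { intros x; now apply trace_derive. }
  assert (cs : C0 (slope (e0 t) (e1 t) w)).
  { unfold slope; apply C0_plus; [|apply C0_mult; trivial]; apply C0_jet_surface; cont. }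
  assert (pg : forall x, g (x + per) = g x).
  { intros x; unfold g, trace; rewrite pe; apply (nm_per Nm). }
  assert (Low := local_lower g _ tau x0 K tau_pos (nm_x0 Nm) Hg cs HK
    (HS t w x0 ltac:(lra) Nm) pg (nm_le Nm) (nm_one Nm)).
  fold B in Low.
  assert (F1 := fejer_lower tau x0 tau_pos g B N cg HN0 Low).
  assert (F2 := fejer_upper tau x0 g N e cg (Rlt_le _ _ He)
    (fun k Hk Hk1 => HM t w x0 k ltac:(lra) Nm Hk Hk1)).
  assert (Ee : (2 * INR N + 1) * e = per / 8) by (unfold e; field; lra).
  rewrite Ee in F2.
  assert (A1 : per / 16 <= Rabs (mode tau x0 g 1)) by nra.
  eapply Rle_trans; [exact A1|].
  (* Evenness removes the sine coefficient, so the mode centred at [x0] is [cos (tau * x0)] times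
     the one centred at 0. *)
  assert (Es : integral (fun x => g x * sin (tau * x)) 0 per = 0).
  { apply integral_odd_periodic.
    - cont.
    - intros x; rewrite pg; f_equal.
      replace (tau * (x + per)) with (tau * x + 2 * INR 1 * PI) by (simpl; field; lra).
      apply sin_period.
    - intros x; unfold g; rewrite (nm_even Nm).
      replace (tau * - x) with (- (tau * x)) by ring; rewrite sin_neg; ring. }
  assert (Em : mode tau x0 g 1 = cos (tau * x0) * integral (fun x => g x * cos (tau * x)) 0 per).
  { unfold mode.
    rewrite (integral_ext _ (fun x => cos (tau * x0) * (g x * cos (tau * x))
      + sin (tau * x0) * (g x * sin (tau * x)))).
    - rewrite integral_plus, !integral_scal, Es by cont; ring.
    - intros x; replace (INR 1 * (tau * (x - x0))) with (tau * x - tau * x0) by (simpl; ring).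
      rewrite cos_minus; ring. }
  rewrite Em, Rabs_mult.
  rewrite <- (Rmult_1_l (Rabs (integral _ _ _))) at 2.
  apply Rmult_le_compat_r; [apply Rabs_pos|apply Rabs_le, COS_bound].
Qed.

(** The test function [- y] has Robin defect exactly [e0 * robin - 1], so the error in [robin_test]
    is zero. *)
Lemma mode_zero_test t w x0 p dde : normal_mode t w x0 -> C0 (robin t) ->
  jet_wave a (bernoulli a d) per p (e0 t) (e1 t) dde (l t) ->
  integral (fun x => trace (e0 t) w x * (e0 t x * robin t x - 1)) 0 per = 0.
Proof.
  intros N cb W.
  assert (H : Rabs (1 * integral (fun x => trace (e0 t) w x * (e0 t x * robin t x - 1)) 0 per)
     <= 0 * per).
  { apply (robin_test per (l t) (e0 t) (e1 t) (robin t) w (period_pos tau tau_pos)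
      (jw_de W)
      (wave_de_cont W) (jw_e_per W)
      (jw_pos W) (nm_per N) (nm_bottom N) (nm_harm N)
      (nm_flux N) (nm_le N) (jet_scal (-1) jet_y)
      (fun x => e0 t x * robin t x - 1)); trivial.
    - assert (ce := wave_e_cont W); cont.
    - intros x y; reflexivity.
    - intros x; simpl; ring.
    - intros x y; unfold lap; simpl; ring.
    - intros x; unfold flux, trace; simpl.
      match goal with |- Rabs ?u <= 0 => replace u with 0 by ring end.
      rewrite Rabs_R0; lra. }
  rewrite Rmult_1_l, Rmult_0_l in H.
  match goal with |- ?u = 0 => destruct (Req_dec u 0) as [|Z]; trivial;
    apply Rabs_pos_lt in Z; lra end.
Qed.

(** * Expansion of the identity to order [t^2] *)

Let ratio (t : R) : R := dl t / l t.

Lemma ratio_expansion : Ou 2 (fun t (_ : R) => ratio t - 2 * lam2 * t).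
Proof.
  destruct (near_pos _ _ Rlt_0_1 (ls_O LS)) as (dL & HdL & HL).
  apply (Ou_loc 2 (fun t x => (dl t - 2 * lam2 * t) * (/ l t)
    + 2 * lam2 * (t * (/ l t - / 1)))).
  - apply Ou_plus.
    + apply (Ou_mult 2 0 (fun t _ => dl t - 2 * lam2 * t) (fun t _ => / l t)); [apply LS|].
      apply (near_Ou (/ 1)), (near_inv 1 (fun t _ => l t)); [lra|apply LS].
    + apply Ou_scal, (Ou_mult 1 1 (fun t _ => t) (fun t _ => / l t - / 1)); [apply Ou_t|].
      apply (near_inv 1 (fun t _ => l t)); [lra|apply LS].
  - exists dL; split; trivial; intros t x Ht; specialize (HL t x Ht).
    unfold ratio; field; lra.
Qed.

Lemma near_ratio : near 0 (fun t _ => ratio t).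
Proof.
  apply near_0, (Ou_ext 1 (fun t _ => (ratio t - 2 * lam2 * t) + 2 * lam2 * t)); [|intros; ring].
  apply Ou_plus; [apply (Ou_le 2); [lia|apply ratio_expansion]|apply Ou_scal, Ou_t].
Qed.

(* The coefficients of [g] and of its derivative in the variation identity, after the
   multiple [kappa + a d] of the test by [y] has been subtracted. *)
Let coef_g (t x : R) : R := mu t * d0 t x / speed t x
  + ratio t * l t ^ 2 * speed t x * e1 t x ^ 2
  + ratio t * (- (speed t x * (l t ^ 2 * e1 t x ^ 2))
     + (e0 t x * robin t x - 1) * (speed t x - kap + a * (e0 t x - d))).
Let coef_dg (t x : R) : R := ratio t * (speed t x * l t ^ 2 * e0 t x * e1 t x).

Let lead_g : R := mu2 / kap + 2 * lam2 * ((d * b0 - 1) * (a - 1 / kap)).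
Let lead_dg : R := - (2 * lam2 * kap * d * tau).

Lemma coef_g_expansion : Ou 3 (fun t x => coef_g t x - t ^ 2 * lead_g * cos (tau * x)).
Proof.
  assert (Oc : Ou 0 (fun _ x => cos (tau * x))) by apply (Ou_cos (fun _ x => tau * x)).
  assert (Ot := Ou_t).
  assert (Otc : Ou 1 (fun t x => t * cos (tau * x))) by now apply (Ou_mult 1 0 (fun t _ => t)).
  assert (Nq : near (1 / kap) (fun t x => 1 / speed t x)).
  { apply near_div; [exact kappa_nz|apply near_const|apply near_speed]. }
  assert (P1 : Ou 3 (fun t x => mu t * d0 t x / speed t x - mu2 / kap * t ^ 2 * cos (tau * x))).
  { apply (Ou_ext 3 (fun t x => (mu t - mu2 * t ^ 2) * (d0 t x * (1 / speed t x))
      + (t * t) * (mu2 * ((d0 t x - cos (tau * x)) * (1 / speed t x)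
                   + cos (tau * x) * (1 / speed t x - 1 / kap)))));
      [|intros; unfold Rdiv; ring].
    apply Ou_plus.
    - apply (Ou_mult 3 0 (fun t _ => mu t - mu2 * t ^ 2)); [apply mu_expansion|].
      apply (Ou_mult 0 0); [|apply (near_Ou _ _ Nq)].
      apply (Ou_ext 0 (fun t x => (d0 t x - cos (tau * x)) + cos (tau * x))); [|intros; ring].
      apply Ou_plus; trivial; apply (Ou_le 1); [lia|apply SS].
    - apply (Ou_mult 2 1 (fun t _ => t * t));
        [apply (Ou_mult 1 1 (fun t _ => t) (fun t _ => t)); trivial|].
      apply Ou_scal, Ou_plus.
      + apply (Ou_mult 1 0); [apply SS|apply (near_Ou _ _ Nq)].
      + apply (Ou_mult 0 1 (fun _ x => cos (tau * x))); trivial. }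
  assert (O1 := near_0_inv _ near_ratio).
  assert (P2 : Ou 3 (fun t x => ratio t * l t ^ 2 * speed t x * e1 t x ^ 2)).
  { apply (Ou_ext 3 (fun t x => ratio t * (speed t x * (l t ^ 2 * e1 t x ^ 2))));
      [|intros; ring].
    apply (Ou_mult 1 2 (fun t _ => ratio t)); trivial.
    apply (Ou_mult 0 2); [apply (near_Ou _ _ near_speed)|apply Ou_theta]. }
  (* The bracket is needed to first order only, since [ratio] is [O(t)]. Here [a - 1 / kap] is the
     coefficient of [t cos (tau x)] in [speed - kap + a (e0 - d)]. *)
  assert (P3 : Ou 2 (fun t x => - (speed t x * (l t ^ 2 * e1 t x ^ 2))
     + (e0 t x * robin t x - 1) * (speed t x - kap + a * (e0 t x - d))
     - t * ((d * b0 - 1) * (a - 1 / kap) * cos (tau * x)))).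
  { apply (Ou_ext 2 (fun t x => - (speed t x * (l t ^ 2 * e1 t x ^ 2))
     + (e0 t x * robin t x - 1) * ((speed t x - (kap - t * cos (tau * x) / kap))
        + a * (e0 t x - (d + t * cos (tau * x))))
     + ((e0 t x * robin t x - 1) - (d * b0 - 1)) * ((a - 1 / kap) * (t * cos (tau * x)))));
      [|intros; field; exact kappa_nz].
    assert (Nb : near (d * b0 - 1) (fun t x => e0 t x * robin t x - 1)).
    { apply near_minus; [|apply near_const].
      apply near_mult; [apply near_e0|apply near_robin]. }
    apply Ou_plus; [apply Ou_plus|].
    - apply Ou_opp, (Ou_mult 0 2); [apply (near_Ou _ _ near_speed)|apply Ou_theta].
    - apply (Ou_mult 0 2); [apply (near_Ou _ _ Nb)|].
      apply Ou_plus; [apply speed_expansion|apply Ou_scal, SS].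
    - apply (Ou_mult 1 1); [exact Nb|apply Ou_scal, Otc]. }
  apply (Ou_ext 3 (fun t x =>
    (mu t * d0 t x / speed t x - mu2 / kap * t ^ 2 * cos (tau * x))
    + ratio t * l t ^ 2 * speed t x * e1 t x ^ 2
    + ratio t * (- (speed t x * (l t ^ 2 * e1 t x ^ 2))
      + (e0 t x * robin t x - 1) * (speed t x - kap + a * (e0 t x - d))
      - t * ((d * b0 - 1) * (a - 1 / kap) * cos (tau * x)))
    + (ratio t - 2 * lam2 * t) * ((d * b0 - 1) * (a - 1 / kap) * (t * cos (tau * x))))).
  - apply Ou_plus; [apply Ou_plus; [apply Ou_plus|]|]; trivial.
    + apply (Ou_mult 1 2 (fun t _ => ratio t)); trivial.
    + apply (Ou_mult 2 1 (fun t _ => ratio t - 2 * lam2 * t)); [apply ratio_expansion|].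
      apply Ou_scal, Otc.
  - intros t x; unfold coef_g, lead_g; ring.
Qed.

Lemma coef_dg_expansion : Ou 3 (fun t x => coef_dg t x - t ^ 2 * lead_dg * sin (tau * x)).
Proof.
  assert (Os : Ou 0 (fun _ x => sin (tau * x))) by apply (Ou_sin (fun _ x => tau * x)).
  assert (Ots : Ou 1 (fun t x => t * sin (tau * x))).
  { apply (Ou_mult 1 0 (fun t _ => t)); [apply Ou_t|trivial]. }
  assert (N : near (kap * d) (fun t x => speed t x * l t ^ 2 * e0 t x)).
  { apply (near_eq (kap * 1 ^ 2 * d)); [|ring].
    apply near_mult; [apply near_mult; [apply near_speed|apply near_pow, LS]|apply near_e0]. }
  apply (Ou_ext 3 (fun t x =>
    (ratio t - 2 * lam2 * t) * ((speed t x * l t ^ 2 * e0 t x) * e1 t x)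
    + 2 * lam2 * (t * ((speed t x * l t ^ 2 * e0 t x) * (e1 t x - t * (- tau * sin (tau * x)))
       + (speed t x * l t ^ 2 * e0 t x - kap * d) * (- tau * (t * sin (tau * x))))))).
  - apply Ou_plus.
    + apply (Ou_mult 2 1 (fun t _ => ratio t - 2 * lam2 * t)); [apply ratio_expansion|].
      apply (Ou_mult 0 1); [apply (near_Ou _ _ N)|apply near_0_inv, near_e1].
    + apply Ou_scal, (Ou_mult 1 2 (fun t _ => t)); [apply Ou_t|].
      apply Ou_plus.
      * apply (Ou_mult 0 2); [apply (near_Ou _ _ N)|apply SS].
      * apply (Ou_mult 1 1); [exact N|apply Ou_scal, Ots].
  - intros t x; unfold coef_dg, lead_dg; ring.
Qed.

Lemma reduced_identity : exists dt, 0 < dt /\ forall t w x0, 0 < t < dt -> normal_mode t w x0 ->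
  C0 (coef_g t) /\ C0 (coef_dg t) /\ C0 (slope (e0 t) (e1 t) w) /\ C0 (trace (e0 t) w) /\
  integral (fun x => coef_g t x * trace (e0 t) w x
    + coef_dg t x * slope (e0 t) (e1 t) w x) 0 per = 0.
Proof.
  assert (Hper := period_pos tau tau_pos).
  destruct branch_wave as (rw & C & Hrw & Hrr & Hrl & HrT & HW).
  destruct robin_cont as (dr & Hdr & Hrc).
  destruct speed_sign as (ds & Hds & Hsg).
  exists (Rmin (Rmin rw dr) ds); split; [repeat apply Rmin_glb_lt; trivial|].
  intros t w x0 Ht N.
  rmin_bounds.
  destruct (HW t ltac:(lra)) as (p & W & P0 & Hs & Hsx & Hrho & HC).
  (* The speed has the sign of [kap] for all small [t]. *)
  set (s := kap / Rabs kap).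
  assert (Hak : 0 < Rabs kap) by now apply Rabs_pos_lt.
  assert (Hss : s * s = 1).
  { unfold s; replace (kap / Rabs kap * (kap / Rabs kap)) with (kap ^ 2 / Rabs kap ^ 2)
      by (field; lra).
    rewrite pow2_abs; field; exact kappa_nz. }
  assert (Hsp : forall t x, 0 <= t < ds -> 0 < s * speed t x).
  { intros u x Hu; specialize (Hsg u x Hu); unfold s.
    replace (kap / Rabs kap * speed u x) with (kap * speed u x / Rabs kap) by (field; lra).
    now apply Rdiv_lt_0_compat. }
  assert (Hnz : forall x, speed t x <> 0).
  { intros x Z; specialize (Hsp t x ltac:(lra)); rewrite Z in Hsp; lra. }
  (* This radius keeps the whole neighbourhood of [t] at nonnegative parameters and below every
     threshold. *)
  assert (Hr0 : 0 < Rmin t (Rmin (Rmin rw dr) ds - t)) by (apply Rmin_glb_lt; lra).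
  assert (Hnear : forall u, Rabs (u - t) < Rmin t (Rmin (Rmin rw dr) ds - t) ->
    0 <= u /\ u < Rmin (Rmin rw dr) ds).
  { intros u Hu; rmin_bounds.
    apply Rabs_def2 in Hu; lra. }
  assert (Hnr : forall u, Rabs (u - t) < Rmin t (Rmin (Rmin rw dr) ds - t) -> Rabs u < r).
  { intros u Hu; apply Hnear in Hu; rewrite Rabs_pos_eq; lra. }
  assert (Hnl : forall u, Rabs (u - t) < Rmin t (Rmin (Rmin rw dr) ds - t) -> Rabs u < rl).
  { intros u Hu; apply Hnear in Hu; rewrite Rabs_pos_eq; lra. }
  assert (Hat : Rabs t < r) by (rewrite Rabs_pos_eq; lra).
  assert (Hde := jw_de W).
  assert (cde := wave_de_cont W).
  assert (ce := wave_e_cont W).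
  assert (cb := Hrc t ltac:(lra)).
  assert (cq : C0 (speed t)).
  { intros x; apply (continuous_ext _ _ x Hs), (top_speed_cont W). }
  assert (cd0 : C0 (d0 t)).
  { apply (C0_derive _ (d1 t)); intros; now apply (ss_d0_x SS). }
  assert (cg : C0 (trace (e0 t) w)) by now apply (trace_cont _ (e1 t)).
  assert (cs : C0 (slope (e0 t) (e1 t) w)).
  { unfold slope; apply C0_plus; [|apply C0_mult; trivial]; apply C0_jet_surface; cont. }
  assert (ciq : C0 (fun x => / speed t x)) by now apply C0_inv.
  assert (ccg : C0 (coef_g t)).
  { unfold coef_g, Rdiv; cont. }
  assert (ccd : C0 (coef_dg t)) by (unfold coef_dg; cont).
  assert (pd0 : forall x, d0 t (x + per) = d0 t x).
  { intros x.
    assert (D1 := ss_e0_t SS t (x + per) Hat).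
    assert (D2 := ss_e0_t SS t x Hat).
    rewrite <- (is_derive_unique _ _ _ D1), <- (is_derive_unique _ _ _ D2).
    apply Derive_ext_loc; exists (mkposreal _ Hr0); intros u Hu.
    apply Hnear in Hu; destruct (HW u ltac:(lra)) as (pu & Wu & _); apply Wu. }
  do 4 (split; [trivial|]).
  assert (V := variation_identity a (bernoulli a d) per t e0 e1 d0 d1 l dl s C
    (mkposreal _ Hr0) w Hper Hss
    (fun u x Hu => ss_e0_t SS u x (Hnr u Hu))
    (fun u x Hu => ss_e1_t SS u x (Hnr u Hu))
    (fun u x Hu => ss_e0_c SS u x (Hnr u Hu))
    (fun u x Hu => ss_e1_c SS u x (Hnr u Hu))
    (fun u x Hu => ss_d0_c SS u x (Hnr u Hu))
    (fun u x Hu => ss_d1_c SS u x (Hnr u Hu))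
    (fun u Hu => ls_t LS u (Hnl u Hu))
    (fun u Hu => ls_c LS u (Hnl u Hu))).
  specialize (fun H => V H (nm_per N) (nm_bottom N) (nm_harm N)
    p (eta_xx t) (robin t) (mu t) W).
  assert (Hw : forall u, Rabs (u - t) < Rmin t (Rmin (Rmin rw dr) ds - t) -> exists p dde,
    jet_wave a (bernoulli a d) per p (e0 u) (e1 u) dde (l u) /\
    (forall x, 0 < s * top_speed p (e0 u) x) /\
    (forall x y, 0 <= y <= e0 u x -> Rabs (j0 p x y) <= C)).
  { intros u Hu; apply Hnear in Hu.
    destruct (HW u ltac:(lra)) as (pu & Wu & _ & Hsu & _ & _ & HCu).
    exists pu, (eta_xx u); split; [trivial|]; split; trivial.
    intros x; rewrite Hsu; apply Hsp; lra. }
  specialize (V Hw ltac:(intros x; rewrite Hs; apply Hsp; lra)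
    (fun x => ss_d0_x SS t x Hat) pd0 (nm_flux N) cb).
  specialize (V ltac:(intros x; rewrite Hs, Hrho; unfold robin; field; apply Hnz)).
  assert (Z := mode_zero_test t w x0 p _ N cb W).
  assert (Hl : l t <> 0) by (generalize (jw_lam W); lra).
  (* Splitting off [kap + a * d] times the zero-mode test turns the bracket into a product with the
     factor [speed - kap + a * (e0 - d)], of order [t], plus a slope term of order [t^2]. *)
  rewrite (integral_ext (fun x => mu t * d0 t x * trace (e0 t) w x / top_speed p (e0 t) x + _ + _)
    (fun x => (coef_g t x * trace (e0 t) w x + coef_dg t x * slope (e0 t) (e1 t) w x)
      + ratio t * (kap + a * d) * (trace (e0 t) w x * (e0 t x * robin t x - 1)))) in V.
  - rewrite (integral_plus (fun x => coef_g t x * trace (e0 t) w x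
      + coef_dg t x * slope (e0 t) (e1 t) w x)) in V by cont.
    rewrite integral_scal, Z in V by cont; lra.
  - intros x; rewrite Hs; unfold coef_g, coef_dg, slope, ratio.
    field; split; [exact Hl|apply Hnz].
Qed.

(** The identity reads [t^2 * X * c = O(t^3)] with [c] the first mode of the trace. As [|c|] is at
    least [per / 16], dividing by [t^2] and letting [t] tend to zero leaves [X = 0]. *)
Lemma leading_order : lead_g - tau * lead_dg = 0.
Proof.
  assert (Hper := period_pos tau tau_pos).
  destruct reduced_identity as (dt1 & Hdt1 & RI).
  destruct normal_mode_exists as (dt2 & Hdt2 & NE).
  destruct first_mode_lower as (dt3 & Hdt3 & FL).
  destruct slope_bounded as (K & dt4 & HK & Hdt4 & HS).
  destruct coef_g_expansion as (C1 & dt5 & Hdt5 & E1).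
  destruct coef_dg_expansion as (C2 & dt6 & Hdt6 & E2).
  destruct branch_wave as (rw & C & Hrw & _ & _ & _ & HW).
  set (D := Rmin (Rmin (Rmin dt1 dt2) (Rmin dt3 dt4)) (Rmin (Rmin dt5 dt6) rw)).
  assert (HD : 0 < D) by (unfold D; repeat apply Rmin_glb_lt; trivial).
  assert (HDle : D <= dt1 /\ D <= dt2 /\ D <= dt3 /\ D <= dt4 /\ D <= dt5 /\ D <= dt6 /\ D <= rw).
  { unfold D; rmin_bounds; repeat split; lra. }
  set (X := lead_g - tau * lead_dg).
  set (Q := Rabs C1 * per + Rabs C2 * (per + K)).
  assert (HQ : 0 <= Q).
  { unfold Q; generalize (Rabs_pos C1), (Rabs_pos C2); intros; nra. }
  assert (Main : forall t, 0 < t < D -> Rabs X * (per / 16) <= Q * t).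
  { intros t Ht.
    destruct (NE t ltac:(lra)) as (w & x0 & N).
    destruct (RI t w x0 ltac:(lra) N) as (cG & cD & cs & cg & RIt).
    specialize (FL t w x0 ltac:(lra) N). specialize (HS t w x0 ltac:(lra) N 0).
    rewrite Rplus_0_l in HS.
    destruct (HW t ltac:(lra)) as (p & W & _).
    set (g := trace (e0 t) w) in *. set (dg := slope (e0 t) (e1 t) w) in *.
    set (c := integral (fun x => g x * cos (tau * x)) 0 per) in *.
    assert (Hg : forall x, is_derive g x (dg x)) by
      (intros; apply trace_derive; apply W).
    assert (pg : g per = g 0).
    { unfold g, trace; rewrite <- (Rplus_0_l per) at 1 2.
      rewrite (jw_e_per W); apply (nm_per N). }
    (* Integration by parts: the derivative terms reduce to the same mode [c]. *)
    assert (Ec : integral (fun x => sin (tau * x) * dg x) 0 per = - tau * c).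
    { assert (T0 : integral (fun x => sin (tau * x) * dg x + tau * (g x * cos (tau * x))) 0 per = 0).
      { rewrite (integral_derive (fun x => sin (tau * x) * g x)).
        - replace (tau * per) with (2 * PI) by (field; lra).
          rewrite sin_2PI, Rmult_0_r, sin_0; ring.
        - intros x; eapply der_eq.
          + apply (der_mult (fun x => sin (tau * x))); [|apply Hg].
            apply (der_comp sin); [apply is_derive_sin|apply der_lin].
          + cbv beta; ring.
        - cont. }
      rewrite integral_plus, integral_scal in T0 by cont; fold c in T0; lra. }
    assert (Id : t ^ 2 * (X * c) = - integral (fun x =>
        (coef_g t x - t ^ 2 * lead_g * cos (tau * x)) * g x
        + (coef_dg t x - t ^ 2 * lead_dg * sin (tau * x)) * dg x) 0 per).
    { rewrite (integral_ext _ (fun x => (coef_g t x * g x + coef_dg t x * dg x)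
        - (t ^ 2 * lead_g * (g x * cos (tau * x))
           + t ^ 2 * lead_dg * (sin (tau * x) * dg x)))) by (intros; ring).
      rewrite integral_minus, integral_plus by cont.
      rewrite integral_plus in RIt by cont.
      rewrite integral_plus, RIt, !integral_scal, Ec by cont.
      fold c; unfold X; ring. }
    assert (Bd : Rabs (t ^ 2 * (X * c)) <= Q * t ^ 3).
    { rewrite Id, Rabs_Ropp.
      assert (Ht3 : 0 <= t ^ 3) by (apply pow_le; lra).
      eapply Rle_trans; [apply (integral_bound _
        (fun x => Rabs C1 * t ^ 3 + Rabs C2 * t ^ 3 * (1 + dg x ^ 2)))|].
      - lra.
      - cont.
      - cont.
      - intros x; eapply Rle_trans; [apply Rabs_triang|].
        rewrite !Rabs_mult.
        specialize (E1 t x ltac:(lra)); specialize (E2 t x ltac:(lra)).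
        assert (Hgx := nm_le N x); fold g in Hgx.
        (* The slope is controlled only in mean square, so its modulus is dominated by
           [1 + dg^2]. *)
        assert (Hdx : Rabs (dg x) <= 1 + dg x ^ 2).
        { rewrite <- pow2_abs; generalize (pow2_ge_0 (Rabs (dg x) - 1)), (Rabs_pos (dg x)); nra. }
        apply Rplus_le_compat.
        + rewrite <- (Rmult_1_r (Rabs C1 * t ^ 3)).
          apply Rmult_le_compat; try apply Rabs_pos; trivial.
          eapply Rle_trans; [exact E1|apply Rmult_le_compat_r; [trivial|apply Rle_abs]].
        + apply Rmult_le_compat; try apply Rabs_pos; trivial.
          eapply Rle_trans; [exact E2|apply Rmult_le_compat_r; [trivial|apply Rle_abs]].
      - rewrite integral_plus, integral_const, integral_scal by cont.
        rewrite integral_plus, integral_const by cont.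
        assert (0 <= Rabs C2 * t ^ 3) by (apply Rmult_le_pos; [apply Rabs_pos|trivial]).
        unfold Q; nra. }
    rewrite !Rabs_mult, (Rabs_pos_eq (t ^ 2)) in Bd by apply pow2_ge_0.
    assert (Ht2 : 0 < t ^ 2) by (apply pow_lt; lra).
    apply (Rmult_le_reg_l (t ^ 2)); trivial.
    replace (t ^ 2 * (Q * t)) with (Q * t ^ 3) by ring.
    eapply Rle_trans; [|exact Bd].
    apply Rmult_le_compat_l; [lra|]; apply Rmult_le_compat_l; [apply Rabs_pos|exact FL]. }
  destruct (Req_dec X 0) as [|HX]; trivial; exfalso.
  assert (HX0 : 0 < Rabs X * (per / 16)) by (apply Rmult_lt_0_compat; [now apply Rabs_pos_lt|lra]).
  destruct (small_mult Q _ HX0) as (dq & Hdq & Hsm).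
  assert (Hm : 0 < Rmin D dq) by now apply Rmin_glb_lt.
  rmin_bounds.
  specialize (Main (Rmin D dq / 2) ltac:(lra)); specialize (Hsm (Rmin D dq / 2) ltac:(lra)).
  generalize (Rle_abs Q); nra.
Qed.

(** The dispersion equation turns [a - 1 / kap] into [- kap * b0]. The vorticity then disappears,
    and the two contributions of [lam2] combine into [kap * tau * H (tau * d)]. *)
Lemma second_eigenvalue_coefficient : mu2 = - A a d tau * lam2.
Proof.
  assert (E := leading_order); unfold lead_g, lead_dg in E.
  assert (Hz := td_pos). assert (Hsz := sinh_pos _ Hz).
  assert (Eb := b0_kappa).
  assert (E1 : a - 1 / kap = - kap * b0).
  { apply (Rmult_eq_reg_l kap); [|exact kappa_nz].
    replace (kap * (a - 1 / kap)) with (- (1 - a * kap)) by (field; exact kappa_nz).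
    rewrite <- Eb; ring. }
  rewrite E1 in E.
  assert (EH : (d * b0 - 1) * (- kap * b0) + tau * (kap * d * tau) = kap * tau * H (tau * d)).
  { unfold b0, H, coth; ring. }
  assert (E2 : mu2 / kap = - (2 * lam2 * (kap * tau * H (tau * d)))).
  { rewrite <- EH; lra. }
  replace mu2 with (kap * (mu2 / kap)) by (field; exact kappa_nz).
  rewrite E2; unfold A; ring.
Qed.

End Branch.

Theorem mainTheorem1 :
  forall (a dc d tau : R) (T : Rbar)
         (psi : R -> R -> R -> R) (eta : R -> R -> R) (lam mu : R -> R)
         (lam2 mu2 : R),
    critical_depth a dc -> dc < d -> kappa a d <> 0 ->
    dispersion_root a d tau ->
    Rbar_lt 0 T ->
    stokes_branch a d tau T psi eta lam lam2 ->
    (forall t, 0 <= t -> Rbar_lt t T ->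
       second_eigenvalue (2 * PI / tau) (psi t) (eta t) (lam t) (mu t)) ->
    bigO 4 (fun t => mu t - mu2 * t ^ 2) ->
    mu2 = - A a d tau * lam2 /\
    (forall z, 0 < z -> 0 < H z) /\
    0 < A a d tau.
Proof.
  intros a dc d tau T psi eta lam mu lam2 mu2 [Hdc _] Hd Hk [Htau Hdisp] HT SB SE MU.
  assert (d_pos : 0 < d) by lra.
  split; [|split; [exact H_positive|]].
  - destruct (surface_series_exists d tau T eta HT (sb_eta_analytic _ _ _ _ _ _ _ _ SB)
      (sb_eta_expansion _ _ _ _ _ _ _ _ SB)) as (r & e0 & e1 & d0 & d1 & SS).
    destruct (lam_series_exists lam2 T lam HT (sb_lam_analytic _ _ _ _ _ _ _ _ SB)
      (sb_lam_expansion _ _ _ _ _ _ _ _ SB)) as (rl & l & dl & LS).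
    eapply second_eigenvalue_coefficient; eassumption.
  - unfold A; apply Rmult_lt_0_compat; [|now apply H_positive, Rmult_lt_0_compat].
    apply Rmult_lt_0_compat; [|exact Htau].
    apply Rmult_lt_0_compat; [lra|now apply pow2_gt_0].
Qed.
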